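(* Let $k$ and $d$ be positive integers such that $d \leq 2(k+1)$. Every graph $G$ which is $(k,d)$-sparse and has no $(k+1)$-overfull subgraph decomposes into $k+1$ forests such that in one of the forests every connected component contains at most $d$ edges.
   Context: Graphs are finite, undirected, have no loops, and may contain parallel edges. For a graph $H$, write $v(H)=|V(H)|$ and $e(H)=|E(H)|$. Subgraphs below are understood to have at least one vertex. For positive integers $k$ and $d$, a graph $G$ is $(k,d)$-sparse if for every subgraph $H$ of $G$ we have $$\beta(H) := (k+1)(k+d)\,v(H) - (k+d+1)\,e(H) - k^2 \geq 0.$$ For a positive integer $n$, a subgraph $H$ of a graph $G$ is $n$-overfull if $e(H) > n(v(H)-1)$. A decomposition of $G$ into $k+1$ forests is a partition of $E(G)$ into $k+1$ pairwise disjoint, possibly empty sets, each of which is the edge set of an acyclic graph on the vertex set $V(G)$ (two parallel edges form a cycle). *)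

(* Defs.v *)
From mathcomp Require Import all_boot all_order all_algebra.
Set Implicit Arguments.
Unset Strict Implicit.
Unset Printing Implicit Defensive.

Import GRing.Theory Num.Theory.
Local Open Scope ring_scope.

(* Parallel edges are distinct elements of [edge] with the same ends; loops are
   excluded because every edge has exactly two ends. *)
Record multigraph := Multigraph {
  vertex : finType;
  edge : finType;
  ends : edge -> {set vertex};
  card_ends : forall e, #|ends e| = 2%N
}.

Record subgraph (G : multigraph) := Subgraph {
  sub_vertices : {set vertex G};
  sub_edges : {set edge G};
  sub_nonempty : sub_vertices != set0;
  sub_ends : forall e, e \in sub_edges -> ends e \subset sub_vertices
}.

Section Graphs.
Variable G : multigraph.
Implicit Types (H : subgraph G) (F : {set edge G}) (x y : vertex G).

Definition nb_vertices H : nat := #|sub_vertices H|.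
Definition nb_edges H : nat := #|sub_edges H|.

Definition beta (k d : nat) H : int :=
  ((k + 1) * (k + d) * nb_vertices H)%N%:Z
  - ((k + d + 1) * nb_edges H)%N%:Z - (k ^ 2)%N%:Z.

Definition sparse (k d : nat) : Prop := forall H, 0 <= beta k d H.

Definition overfull (n : nat) H : Prop :=
  n%:Z * ((nb_vertices H)%:Z - 1) < (nb_edges H)%:Z.

(* A cycle is given by its distinct vertices v_0, ..., v_(n-1), n >= 2, and
   distinct edges e_0, ..., e_(n-1), where e_i joins v_i to v_(i+1 mod n).
   Distinctness of the edges only matters for n = 2. *)
Definition is_cycle (vs : seq (vertex G)) (es : seq (edge G)) : Prop :=
  [/\ (1 < size vs)%N, uniq vs, uniq es &
      [seq ends e | e <- es] = [seq [set x; next vs x] | x <- vs]].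

(* The following notions are about the spanning graph (V(G), F). *)

Definition acyclic F : Prop :=
  forall vs es, is_cycle vs es -> ~ {subset es <= F}.

Definition adjacent F : rel (vertex G) :=
  fun x y => [exists e in F, ends e == [set x; y]].

Definition component F x : {set vertex G} :=
  [set y | connect (adjacent F) x y].

Definition component_edges F x : {set edge G} :=
  [set e in F | ends e \subset component F x].

Definition forest_decomposition (m : nat) (P : 'I_m -> {set edge G}) : Prop :=
  [/\ \bigcup_(i < m) P i = [set: edge G],
      forall i j, i != j -> [disjoint P i & P j] &
      forall i, acyclic (P i)].

End Graphs.

(* Main.v *)
Require Import Defs.
From mathcomp Require Import all_boot zify.
From Stdlib Require Import Classical.
Set Implicit Arguments.
Unset Strict Implicit.
Unset Printing Implicit Defensive.

(** By Nash-Williams' theorem ([forest_cover]) a graph without (k+1)-overfull subgraph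
    decomposes into k+1 forests. One forest is called red, the others blue. The excess of
    such a decomposition is the number of edges beyond d in the red components, summed
    over these components, and it has to be brought down to 0 ([excess_vanishes]).

    Suppose that the least excess is positive. Choose a decomposition of least excess and
    a root r near the middle of a red component with more than d edges ([central_ex]),
    and direct the blue forests towards r. Explore red components one after the other:
    a component may be entered if a blue arc leads into it from an earlier one
    ([legal]). Among the decompositions of least excess with an exploration, take one
    for which the sequence of the sizes of the explored components is lexicographically
    least, an extension of a sequence being smaller than the sequence ([meas]).

    Minimality is exploited through the augmentation step ([augmentation]): if no edge of
    the i-th blue forest crosses a vertex set A that avoids r but meets an explored
    component, then a red edge of the first such component, or of an earlier one, can be
    made blue, which contradicts minimality ([no_augment]). Hence, with H the set of
    explored vertices, each blue forest joins all of H to r and H is closed under blue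
    arcs ([explored_conn], [explored_closed]), so that H spans at least k(|H|-1) blue
    edges. If e_0 > d, e_1, ..., e_(t-1) are the sizes of the explored components,
    sparsity of H is contradicted ([not_sparse]) as soon as
    (k+1)(e_1 + ... + e_(t-1)) >= d(t-1) ([small_bound]).

    So the components with few edges have to be compensated by components with many.
    Suppose that a component with at most one edge is entered by the i-th blue arc xy from
    the component K. Make xy red. This cuts the descendants of x in the i-th forest off
    from r. If they meet a component explored before K, or contain the entry vertex of K,
    the augmentation step applies to them; otherwise one red edge of K that separates x
    from the entry vertex can be made blue, and K becomes smaller. Either way minimality
    is contradicted unless the excess has grown. The same is done with several arcs that
    leave K in the same colour, cutting K at several places ([early_no], [late_no],
    [exch1_early] to [exch3_early]). It follows that K has at least d edges, or d-1 if the
    child has one, and that in each colour K has at most one isolated child and at most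
    two small children, or one if it has d-1 edges ([one_item] to [three_items]).

    This would be enough if K never had both an isolated child y, entered by xy, and a
    child with one edge. When it does, x turns out to be a leaf of K whose red neighbour p
    is a descendant of x ([isolated_leaf], [leaf_desc]). Then x can leave K: px becomes
    blue and xy red, and {x, y} is a component with one edge that hangs from the last
    vertex h before x on the blue path from p to x. It can be used, in the component of
    h, like a child with one edge ([virtual_item]). Charging these virtual children
    as well compensates exactly the children that were not accounted for
    ([land_bound], [colour_bound]). The hypothesis d <= 2(k+1) makes components with two
    edges large enough, and two children with one edge no more expensive than one
    isolated child. *)

(** In large contexts [lia] spends its time on hypotheses that are not comparisons of
    natural numbers; they are discarded first. *)
Ltac is_arith T :=
  lazymatch T with
  | is_true (leq _ _) => idtac
  | is_true (leq _ _ && leq _ _) => idtac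
  | is_true (~~ leq _ _) => idtac
  | @eq nat _ _ => idtac
  | ~ (@eq nat _ _) => idtac
  end.
Ltac nat_lia :=
  repeat match goal with
  | H : ?T |- _ => tryif is_arith T then fail else clear H
  end; lia.

(** * Connectivity and forests *)

Section Connectivity.
Variable G : multigraph.
Notation V := (vertex G).
Notation E := (edge G).
Implicit Types (F X : {set E}) (e f : E) (x y z a b : V).

Definition conn F : rel V := connect (adjacent F).
Definition joins e x y := ends e == [set x; y].

Lemma joins_sym e x y : joins e x y = joins e y x.
Proof. by rewrite /joins setUC. Qed.

Lemma joins_neq e x y : joins e x y -> x != y.
Proof.
move=> /eqP H; apply/negP => /eqP xy; have := card_ends e.
by rewrite H xy setUid cards1.
Qed.

Lemma joins_ex e : exists x y, joins e x y.
Proof.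
have /eqP/cards2P [x [y [_ H]]] := card_ends e.
by exists x, y; apply/eqP.
Qed.

Lemma joins_inj e x y z : joins e x y -> joins e x z -> y = z.
Proof.
move=> jy jz; have := joins_neq jy; move/eqP: jz; rewrite (eqP jy) => H ne.
have : y \in [set x; z] by rewrite -H !inE eqxx orbT.
by rewrite !inE eq_sym (negPf ne) => /eqP.
Qed.

Lemma joins2 e a b x y : joins e a b -> joins e x y ->
  (x = a /\ y = b) \/ (x = b /\ y = a).
Proof.
move=> j1 j2; have : x \in ends e by rewrite (eqP j2) !inE eqxx.
rewrite (eqP j1) !inE => /orP[] /eqP ex; subst x.
  by left; split=> //; apply: joins_inj j2 j1.
by right; split=> //; apply: (joins_inj j2); rewrite joins_sym.
Qed.

Lemma joins_in e x y : joins e x y -> x \in ends e.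
Proof. by move=> /eqP ->; rewrite !inE eqxx. Qed.

Lemma ends_joins e x : x \in ends e -> exists y, joins e x y.
Proof.
have [a [b j]] := joins_ex e; rewrite (eqP j) !inE => /orP[] /eqP ->.
  by exists b.
by exists a; rewrite joins_sym.
Qed.

Lemma adjacentP F x y : reflect (exists2 e, e \in F & joins e x y) (adjacent F x y).
Proof.
apply: (iffP existsP) => [[e /andP[eF j]]|[e eF j]]; first by exists e.
by exists e; rewrite eF.
Qed.

Lemma adjacent_sym F : symmetric (adjacent F).
Proof.
by move=> x y; apply/adjacentP/adjacentP => -[e eF j]; exists e; rewrite // joins_sym.
Qed.

Lemma connC F x y : conn F x y = conn F y x.
Proof. exact: (sym_connect_sym (@adjacent_sym F)). Qed.

Lemma conn0 F x : conn F x x. Proof. exact: connect0. Qed.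

Lemma conn_trans F y x z : conn F x y -> conn F y z -> conn F x z.
Proof. exact: connect_trans. Qed.

Lemma conn1 F e x y : e \in F -> joins e x y -> conn F x y.
Proof. by move=> eF j; apply: connect1; apply/adjacentP; exists e. Qed.

Lemma conn_ind F (R : V -> V -> Prop) :
  (forall x, R x x) ->
  (forall e x y z, e \in F -> joins e x y -> conn F y z -> R y z -> R x z) ->
  forall x y, conn F x y -> R x y.
Proof.
move=> R0 RS x y /connectP[p]; elim: p x => [|w p IH] x /=.
  by move=> _ ->.
case/andP=> /adjacentP[e eF j] pp ly.
apply: (RS e x w y) => //; last exact: IH.
by apply/connectP; exists p.
Qed.

(** Two vertices are usually shown to be disconnected by a function that is constant on
    edges and separates them. *)
Lemma conn_inv (T : Type) (c : V -> T) F :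
  (forall e x y, e \in F -> joins e x y -> c x = c y) ->
  forall x y, conn F x y -> c x = c y.
Proof.
move=> H; apply: conn_ind => // e x y z eF j _ <-; exact: H eF j.
Qed.

Lemma conn_sub F F' : F \subset F' -> forall x y, conn F x y -> conn F' x y.
Proof.
move=> /subsetP s; apply: conn_ind => [x|e x y z eF j _]; first exact: conn0.
by apply: conn_trans; apply: conn1 j; apply: s.
Qed.

Lemma conn_add F e a b : joins e a b -> forall x y, conn (e |: F) x y ->
  [\/ conn F x y, conn F x a /\ conn F b y | conn F x b /\ conn F a y].
Proof.
move=> j; apply: conn_ind => [x|f x y z]; first by constructor 1; exact: conn0.
rewrite !inE => /orP[/eqP->|fF] j' _.
  case: (joins2 j j') => -[-> ->] [h|[h1 h2]|[h1 h2]].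
  - by constructor 2; split=> //; exact: conn0.
  - by constructor 2; split=> //; exact: conn0.
  - by constructor 1.
  - by constructor 3; split=> //; exact: conn0.
  - by constructor 1.
  - by constructor 3; split=> //; exact: conn0.
have h0 := conn1 fF j'.
case=> [h|[h1 h2]|[h1 h2]].
- by constructor 1; apply: conn_trans h0 h.
- by constructor 2; split=> //; apply: conn_trans h0 h1.
- by constructor 3; split=> //; apply: conn_trans h0 h1.
Qed.

Lemma conn_rem F e a b : e \in F -> joins e a b -> forall x y, conn F x y ->
  [\/ conn (F :\ e) x y, conn (F :\ e) x a /\ conn (F :\ e) b y
    | conn (F :\ e) x b /\ conn (F :\ e) a y].
Proof. by move=> eF j x y; rewrite -{1}(setD1K eF); apply: conn_add. Qed.

(** Every edge is a bridge: for proofs this is handier than the absence of cycles, to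
    which it is related by [forest_acyclic]. *)
Definition forest F :=
  forall e x y, e \in F -> joins e x y -> ~~ conn (F :\ e) x y.

Lemma forest_sub F F' : F' \subset F -> forest F -> forest F'.
Proof.
move=> sF fF e x y eF j; apply: contra (fF e x y (subsetP sF _ eF) j).
exact/conn_sub/setSD.
Qed.

Lemma forest_add F e x y : forest F -> joins e x y -> ~~ conn F x y ->
  forest (e |: F).
Proof.
move=> fF j nc f a b; rewrite !inE; case: (eqVneq f e) => [-> _|ne /= fF'] j'.
  apply: contra nc => h.
  have {}h : conn F a b by apply: conn_sub h; apply/subsetP => g; rewrite !inE; case: eqP.
  by case: (joins2 j j') h => -[-> ->] //; rewrite connC.
have nab := fF f a b fF' j'.
have -> : (e |: F) :\ f = e |: (F :\ f).
  by apply/setP => g; rewrite !inE; case: (eqVneq g e) => // ->; rewrite eq_sym ne.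
apply/negP => /(conn_add j) H.
have sub := conn_sub (subsetDl F [set f]).
case: H => [h|[h1 h2]|[h1 h2]].
- by rewrite h in nab.
- case/negP: nc; apply: (conn_trans (y := a)); first by rewrite connC; apply: sub.
  by apply: (conn_trans (conn1 fF' j')); rewrite connC; apply: sub.
- case/negP: nc; apply: (conn_trans (y := b)); first by apply: sub.
  rewrite connC; apply: (conn_trans (y := a)); first by rewrite connC; apply: sub.
  exact: conn1 fF' j'.
Qed.

(** In a forest the path between two vertices is unique, so if each of two
    edges can be avoided, both can. *)
Lemma forest_inter F e f x y : forest F ->
  conn (F :\ e) x y -> conn (F :\ f) x y -> conn (F :\ e :\ f) x y.
Proof.
move=> fF he hf; case: (boolP (f \in F :\ e)) => [fFe|nf]; last first.
  by rewrite (setDidPl _) // disjoint_sym disjoints1.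
have [a [b j]] := joins_ex f.
have fFF : f \in F by move: fFe; rewrite inE => /andP[].
have s : forall u v, conn (F :\ e :\ f) u v -> conn (F :\ f) u v.
  by apply: conn_sub; rewrite setSD // subsetDl.
case: (conn_rem fFe j he) => // -[h1 h2]; exfalso; case/negP: (fF f a b fFF j).
  apply: conn_trans (conn_trans _ hf) _; first by rewrite connC; apply: s h1.
  by rewrite connC; apply: s.
rewrite connC; apply: conn_trans (conn_trans _ hf) _; first by rewrite connC; apply: s h1.
by rewrite connC; apply: s.
Qed.

(** Some edge on the path from x to y enters A. To obtain it without speaking of paths,
    remove crossing edges that x and y can do without until one of them is a bridge
    between x and y; by [forest_inter] it separates them in F too. *)
Lemma forest_cross F (A : pred V) x y : forest F -> conn F x y -> ~~ A x -> A y ->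
  exists e a b, [/\ e \in F, joins e a b, A a, ~~ A b & ~~ conn (F :\ e) x y].
Proof.
move: {2}#|F| (leqnn #|F|) => n; elim: n F => [|n IH] F.
  rewrite leqn0 cards_eq0 => /eqP -> _ c nx ay; exfalso.
  have H : A x = A y by apply: (@conn_inv _ A set0) c => e u v; rewrite inE.
  by rewrite -H (negPf nx) in ay.
move=> le fF c nx ay.
case: (classic (exists e a b, [/\ e \in F, joins e a b, A a & ~~ A b])); last first.
  move=> H; exfalso; move: ay nx; rewrite -(@conn_inv _ A F _ x y c) => [->//|].
  move=> e u v eF j; case au: (A u); case av: (A v) => //; case: H.
    by exists e, u, v; rewrite av.
  by exists e, v, u; rewrite au joins_sym.
move=> [e [a [b [eF j aa nb]]]].
case: (boolP (conn (F :\ e) x y)) => [c'|nc]; last by exists e, a, b.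
have lt : #|F :\ e| <= n by move: le; rewrite (cardsD1 e F) eF.
have [f [u [v [fF' jf au av nf]]]] := IH _ lt (forest_sub (subsetDl _ _) fF) c' nx ay.
exists f, u, v; split=> //; first by move: fF'; rewrite inE => /andP[].
by apply: contra nf => h; apply: forest_inter.
Qed.

(** The other edges of a cycle bypass its first edge. *)
Lemma forest_acyclic F : forest F -> acyclic F.
Proof.
move=> fF vs es [szv uv ue Hm] sub.
case: vs szv uv Hm => [//|v0 p] szv uv Hm.
have sz : size es = size (v0 :: p) by rewrite -(size_map (@ends G)) Hm size_map.
case: es ue Hm sub sz => [|e0 es] // ue Hm sub [sz].
have step i : i <= size p -> joins (nth e0 (e0 :: es) i) (nth v0 (v0 :: p) i) (nth v0 p i).
  move=> ip; rewrite /joins -(nth_map e0 set0 (@ends G)); last by rewrite /= sz.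
  by rewrite Hm (nth_map v0) // next_nth mem_nth // index_uniq.
have nz i : 0 < i <= size p -> nth e0 (e0 :: es) i \in F :\ e0.
  case/andP=> i0 ip; rewrite !inE sub ?mem_nth //= ?sz // andbT.
  case: i i0 ip => // i _ ip /=; case/andP: ue => n0 _.
  by apply: contraNneq n0 => <-; rewrite mem_nth // sz.
have c i : i < size p -> conn (F :\ e0) (nth v0 p 0) (nth v0 p i).
  elim: i => [|i IH] ip; first exact: conn0.
  apply: conn_trans (IH (ltnW ip)) _.
  apply: conn1 (nz i.+1 _) _; first by rewrite /= ltnW.
  exact: (step i.+1 (ltnW ip)).
have e0F : e0 \in F by apply: sub; rewrite mem_head.
have := fF e0 v0 (nth v0 p 0) e0F (step 0 isT).
case/negP; rewrite connC.
case: p szv {uv Hm} sz step nz c => [//|v1 p] _ sz step nz c.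
apply: conn_trans (c (size p) (ltnSn _)) _.
have := step (size p).+1 (leqnn _).
rewrite /= [X in joins _ _ X]nth_default // => j.
by apply: conn1 (nz (size p).+1 _) j => /=.
Qed.

End Connectivity.

(** * Forests given by parent functions *)

Section Functional.
Variable G : multigraph.
Notation V := (vertex G).
Notation E := (edge G).
Implicit Types (F X : {set E}) (e f : E) (x y z a b r u v : V).
Implicit Types (phi : V -> V) (tau : E -> V) (mu : V -> nat).

(** A parent function phi fixes the roots; mu is any rank that it lowers elsewhere. *)
Definition decr phi mu := forall z, phi z != z -> mu (phi z) < mu z.

(** The root above z: no chain of parents is longer than the largest rank. *)
Definition label phi mu z := iter (\max_(w : V) mu w) phi z.

Lemma label_fixed phi mu z : decr phi mu -> phi (label phi mu z) = label phi mu z.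
Proof.
move=> D; have : mu z <= \max_(w : V) mu w by apply: leq_bigmax.
rewrite /label; elim: (\max_(w : V) _) z => [|n IH] z le /=.
  by apply/eqP/negPn/negP => /D; lia.
case: (eqVneq (phi z) z) => [h|/D lt]; first by rewrite -iterS iter_fix.
by rewrite -!iterS !iterSr -iterSr iterS IH //; lia.
Qed.

Lemma label_id phi mu z : phi z = z -> label phi mu z = z.
Proof. exact: iter_fix. Qed.

Lemma label_step phi mu z : decr phi mu -> label phi mu (phi z) = label phi mu z.
Proof. by move=> D; rewrite /label -iterSr iterS label_fixed. Qed.

Lemma label_inv phi mu (W : pred V) : (forall z, W z -> phi z != z -> W (phi z)) ->
  forall z, W z -> W (label phi mu z).
Proof.
move=> c z; rewrite /label; elim: (\max_(w : V) _) z => [|n IH] z Wz //=.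
by case: (eqVneq (phi (iter n phi z)) (iter n phi z)) => [->|ne];
  [exact: IH | apply: c ne; exact: IH].
Qed.

Lemma label_le phi mu z : decr phi mu -> mu (label phi mu z) <= mu z.
Proof.
move=> D; apply: (@label_inv phi mu (fun w => mu w <= mu z)) => // w le /D lt.
exact: leq_trans (ltnW lt) le.
Qed.

Lemma label_conn phi mu X (W : pred V) :
  (forall z, W z -> phi z != z -> W (phi z) /\ exists2 e, e \in X & joins e z (phi z)) ->
  forall z, W z -> conn X z (label phi mu z).
Proof.
move=> c z Wz.
suff /andP[] : conn X z (label phi mu z) && W (label phi mu z) by [].
rewrite /label; elim: (\max_(w : V) _) => [|n /andP[h1 h2]] /=; first by rewrite conn0.
set w := iter n phi z in h1 h2 *.
case: (eqVneq (phi w) w) => [->|ne]; first by rewrite h1 h2.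
by have [h3 [e eX j]] := c w h2 ne; rewrite h3 (conn_trans h1 (conn1 eX j)).
Qed.

(** A set of edges oriented by a decreasing parent function, one edge per
    tail: the standard way to exhibit a forest together with its components. *)
Definition pgraph X phi tau :=
  (forall e, e \in X -> joins e (tau e) (phi (tau e))) /\ {in X &, injective tau}.

Lemma pgraph_sep X phi tau mu x y : decr phi mu -> pgraph X phi tau ->
  conn X x y -> label phi mu x = label phi mu y.
Proof.
move=> D [g _]; apply: conn_inv => e a b eX j.
by case: (joins2 j (g e eX)) => -[<- <-]; rewrite label_step.
Qed.

(** If e is removed, its tail may be turned into a root; the labels for the new parent
    function are constant on components and differ at the ends of e. *)
Lemma pgraph_forest X phi tau mu : decr phi mu -> pgraph X phi tau -> forest X.
Proof.
move=> D [g inj].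
suff main e : e \in X -> ~~ conn (X :\ e) (tau e) (phi (tau e)).
  move=> e x y eX j; case: (joins2 j (g e eX)) (main e eX) => -[-> ->] //.
  by rewrite connC.
move=> eX; pose phi1 z := if z == tau e then z else phi z.
have D1 : decr phi1 mu by move=> z; rewrite /phi1; case: (z == _); [rewrite eqxx|exact: D].
have ne : phi (tau e) != tau e by rewrite eq_sym; exact: joins_neq (g e eX).
apply/negP => /(@conn_inv _ _ (label phi1 mu)) H.
have : label phi1 mu (tau e) = label phi1 mu (phi (tau e)).
  apply: H => f x y; rewrite !inE => /andP[nf fX] j.
  have nt : tau f != tau e by apply: contra nf => /eqP/inj ->.
  have p1 : phi1 (tau f) = phi (tau f) by rewrite /phi1 (negPf nt).
  by case: (joins2 j (g f fX)) => -[<- <-]; rewrite -p1 label_step.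
rewrite label_id; last by rewrite /phi1 eqxx.
have l1 := label_le (phi (tau e)) D1; have l2 := D _ ne.
by move=> h; rewrite -h in l1; lia.
Qed.

(** The arcs of a forest directed to r, without reference to a parent function: the
    parent functions change during the proof, the arcs of untouched edges do not. *)
Definition darc X r u v :=
  exists e, [/\ e \in X, joins e u v & conn (X :\ e) v r].

Lemma pgraph_darc X phi mu r (W : pred V) : decr phi mu ->
  (forall z, W z -> phi z != z -> W (phi z) /\ exists2 e, e \in X & joins e z (phi z)) ->
  (forall z, W z -> phi z = z -> z = r) ->
  forall u, W u -> phi u != u -> darc X r u (phi u).
Proof.
move=> D c rt u Wu nu; have [Wp [e eX j]] := c u Wu nu.
exists e; split=> //.
have Wl := @label_inv phi mu W (fun z Wz nz => (c z Wz nz).1) _ Wp.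
rewrite -(rt _ Wl (label_fixed _ D)).
apply: (@label_conn _ _ _ (fun z => W z && (mu z < mu u))); last by rewrite Wp D.
move=> z /andP[Wz lt] nz; have [Wpz [f fX jf]] := c z Wz nz; split.
  by rewrite Wpz (ltn_trans (D _ nz) lt).
exists f => //; rewrite !inE fX andbT; apply/eqP => fe; subst f.
case: (joins2 j jf) => -[h1 h2]; first by rewrite h1 ltnn in lt.
by have := D _ nz; rewrite h2; nat_lia.
Qed.

(** All edges of X point to r, or to some other root in the components without r. *)
Record rooted X r phi tau mu : Prop := Rooted {
  rt_decr : decr phi mu;
  rt_root : phi r = r;
  rt_graph : pgraph X phi tau;
  rt_full : forall z, phi z != z -> exists2 e, e \in X & tau e = z;
  rt_uniq : forall z, conn X z r -> phi z = z -> z = r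
}.

Lemma rt_edge X r phi tau mu z : rooted X r phi tau mu -> phi z != z ->
  exists2 e, e \in X & joins e z (phi z).
Proof.
move=> R nz; have [e eX te] := rt_full R nz; exists e => //.
by have := (rt_graph R).1 e eX; rewrite te.
Qed.

(** Each vertex chooses a neighbour nearer to the root of its component. Every edge is
    chosen by one of its ends: otherwise both ends reach the root without it, and the
    edge is not a bridge. *)
Lemma rooting X r : forest X -> exists phi tau mu, rooted X r phi tau mu.
Proof.
move=> fX; pose rt z := if conn X z r then r else fingraph.root (adjacent X) z.
have sy := sym_connect_sym (@adjacent_sym _ X).
have rtc z : conn X z (rt z).
  by rewrite /rt; case: ifP => // _; exact: connect_root.
have rte z w : conn X z w -> rt z = rt w.
  move=> c; rewrite /rt.
  have -> : conn X z r = conn X w r.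
    by apply/idP/idP; apply: conn_trans; rewrite // connC.
  by case: ifP => // _; apply/eqP; rewrite root_connect.
have rtr : rt r = r by rewrite /rt conn0.
pose P z n := [exists p : n.-tuple V, path (adjacent X) z p && (last z p == rt z)].
have exP z : exists n, P z n.
  have /connectP [p pp lp] := rtc z; exists (size p); apply/existsP.
  by exists (in_tuple p); rewrite /= pp lp eqxx.
pose m z := ex_minn (exP z).
have step z : z != rt z -> exists w, adjacent X z w && (m w < m z).
  move=> nz; rewrite {2}/m; case: ex_minnP => n /existsP[p /andP[pp /eqP lp]] mn.
  case: p pp lp => -[|w p] //= sz pp lp; first by rewrite -lp eqxx in nz.
  case/andP: pp => aw pp; exists w; rewrite aw /=.
  have rw : rt w = rt z by apply: rte; rewrite connC; exact: connect1.
  rewrite /m; case: ex_minnP => n' _ mn'; rewrite -(eqP sz) ltnS; apply: mn'.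
  by apply/existsP; exists (in_tuple p); rewrite /= pp rw lp eqxx.
pose phi z := if z == rt z then z else odflt z [pick w | adjacent X z w && (m w < m z)].
have phiP z : phi z != z -> adjacent X z (phi z) && (m (phi z) < m z).
  rewrite /phi; case: (z == rt z); first by rewrite eqxx.
  by case: pickP => [w h _ | _] /=; rewrite ?eqxx.
have fixP z : phi z = z -> z = rt z.
  move=> h; apply/eqP/negPn/negP => nz.
  have [w hw] := step z nz; move: h; rewrite /phi (negPf nz).
  case: pickP => [v /andP[_ lt] /= h|/(_ w)]; last by rewrite hw.
  by rewrite h ltnn in lt.
have D : decr phi m by move=> z /phiP/andP[].
pose pe z := [pick e in X | joins e z (phi z)].
have peP z : phi z != z -> exists e, [/\ e \in X, joins e z (phi z) & pe z = Some e].
  move=> /phiP/andP[/adjacentP[e eX j] _]; rewrite /pe.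
  by case: pickP => [f /andP[? ?]|/(_ e)]; [exists f | rewrite eX j].
have peX z e : pe z = Some e -> e \in X /\ joins e z (phi z).
  by rewrite /pe; case: pickP => // f /andP[? ?] [<-].
have peE e : e \in X -> exists z, pe z == Some e.
  move=> eX; have [a [b j]] := joins_ex e.
  case: (boolP (pe a == Some e)) => [h|na]; first by exists a.
  case: (boolP (pe b == Some e)) => [h|nb]; first by exists b.
  exfalso; case/negP: (fX e a b eX j).
  have c z : conn (X :\ e) z (label phi m z).
    apply: (@label_conn phi m _ predT) => // w _ nw; split=> //.
    have [f [fX' jf pf]] := peP w nw; exists f => //.
    rewrite !inE fX' andbT; apply/eqP => fe; subst f.
    by case: (joins2 j jf) => -[h _]; move: na nb; rewrite -h pf eqxx.
  have le z : label phi m z = rt z.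
    rewrite (fixP _ (label_fixed z D)); apply: rte; rewrite connC.
    by apply: conn_sub (c z); exact: subsetDl.
  apply: conn_trans (c a) _; rewrite le (rte a b) ?(conn1 eX j) // -le connC.
  exact: c.
pose tau e := odflt r [pick z | pe z == Some e].
have tauP e : e \in X -> pe (tau e) = Some e.
  move=> /peE[z hz]; rewrite /tau; case: pickP => [w /eqP //|/(_ z)].
  by rewrite hz.
exists phi, tau, m; split=> //.
- by rewrite /phi rtr eqxx.
- split=> [e eX|e f eX fX' h]; first by have [] := peX _ _ (tauP e eX).
  by have := tauP e eX; rewrite h tauP // => -[].
- move=> z nz; have [e [eX j pz]] := peP z nz; exists e => //.
  have [_ j'] := peX _ _ (tauP e eX).
  case: (joins2 j j') => -[h1 h2] //; exfalso.
  have l1 := D z nz; have := D (tau e); rewrite h2 h1; rewrite eq_sym in nz.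
  by move=> /(_ nz); lia.
- by move=> z c h; rewrite (fixP z h) /rt c.
Qed.

(** If u did not point to v along e, then u would reach r without e, and so would v. *)
Lemma darc_parent X r phi tau mu u v : forest X -> rooted X r phi tau mu ->
  darc X r u v -> phi u = v.
Proof.
move=> fX R [e [eX j c]]; apply/eqP/negPn/negP => nv.
have cv : conn X u r.
  apply: conn_trans (conn1 eX j) _; apply: conn_sub c; exact: subsetDl.
case/negP: (fX e u v eX j); apply: (conn_trans (y := r)); last by rewrite connC.
have lr : label phi mu u = r.
  apply: (rt_uniq R); last exact: label_fixed (rt_decr R).
  apply: (@label_inv phi mu (fun z => conn X z r)) => // z cz nz.
  have [f fX' jf] := rt_edge R nz; apply: conn_trans cz; rewrite connC.
  exact: conn1 fX' jf.
rewrite -lr; apply: (@label_conn phi mu _ (fun z => mu z <= mu u)) => // z le nz.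
split; first exact: leq_trans (ltnW (rt_decr R nz)) le.
have [f fX' jf] := rt_edge R nz; exists f => //; rewrite !inE fX' andbT.
apply/eqP => fe; subst f; case: (joins2 j jf) => -[h1 h2].
  by rewrite -h1 h2 eqxx in nv.
by have := rt_decr R nz; rewrite h2; nat_lia.
Qed.

Lemma rooted_conn X r phi tau mu z : rooted X r phi tau mu ->
  conn X z r -> phi z != z -> conn X (phi z) r.
Proof.
move=> R c nz; have [e eX j] := rt_edge R nz.
by apply: conn_trans c; rewrite connC; exact: conn1 eX j.
Qed.

End Functional.

(** * Sizes of components, and how edges change them *)

Section Sizes.
Variable G : multigraph.
Notation V := (vertex G).
Notation E := (edge G).
Implicit Types (F X : {set E}) (e f : E) (x y z a b r u v w : V).

Lemma mem_component F x y : (y \in component F x) = conn F x y.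
Proof. by rewrite inE. Qed.

Lemma component_eq F x y : conn F x y -> component F x = component F y.
Proof.
move=> c; apply/setP => z; rewrite !mem_component.
by apply/idP/idP; apply: conn_trans; rewrite // connC.
Qed.

Lemma mem_cedges F e a b x : joins e a b ->
  (e \in component_edges F x) = (e \in F) && conn F x a.
Proof.
move=> j; rewrite inE; case eF: (e \in F) => //=.
rewrite (eqP j) subUset !sub1set !mem_component.
apply/andP/idP => [[]//|c]; split=> //; exact: conn_trans c (conn1 eF j).
Qed.

Definition esz F x := #|component_edges F x|.

Lemma esz_conn F x y : conn F x y -> esz F x = esz F y.
Proof. by move=> c; rewrite /esz /component_edges (component_eq c). Qed.

Lemma esz_eq0 F e x : esz F x = 0 -> e \in F -> x \in ends e -> False.
Proof.
move=> /eqP; rewrite cards_eq0 => /eqP e0 eF /ends_joins[y j].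
by have := mem_cedges F x j; rewrite e0 inE eF conn0.
Qed.

Lemma esz_gt0 F e x : e \in F -> x \in ends e -> 0 < esz F x.
Proof. by move=> eF xe; rewrite lt0n; apply/eqP => /esz_eq0 /(_ eF xe). Qed.

Lemma esz0_conn F x y : esz F x = 0 -> conn F x y -> y = x.
Proof.
move=> e0; case/connectP => -[//|w p] /= /andP[/adjacentP[e eF j] _] _.
by case: (esz_eq0 e0 eF (joins_in j)).
Qed.

(** F and F' have the same edges at the vertices of the component of x in F, so that
    this component is common to both. *)
Definition agree F F' x :=
  forall e y, conn F x y -> y \in ends e -> (e \in F') = (e \in F).

Lemma agree_conn F F' x y : agree F F' x -> conn F' x y = conn F x y.
Proof.
move=> H; apply/idP/idP => c; move: H.
- elim/(@conn_ind _ F') : c => {x y} [x _|e x y z eF j _ IH H]; first exact: conn0.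
  have cxy : conn F x y.
    by apply: (conn1 _ j); rewrite -(H e x (conn0 _ _) (joins_in j)).
  by apply: (conn_trans cxy (IH _)) => f w c; apply: H; exact: (conn_trans cxy c).
- elim/(@conn_ind _ F) : c => {x y} [x _|e x y z eF j _ IH H]; first exact: conn0.
  apply: (conn_trans (y := y)).
    by apply: (conn1 _ j); rewrite (H e x (conn0 _ _) (joins_in j)).
  by apply: IH => f w c; apply: H; exact: (conn_trans (conn1 eF j) c).
Qed.

Lemma agree_component F F' x : agree F F' x -> component F' x = component F x.
Proof. by move=> H; apply/setP => y; rewrite !mem_component (agree_conn _ H). Qed.

Lemma agree_cedges F F' x : agree F F' x -> component_edges F' x = component_edges F x.
Proof.
move=> H; apply/setP => e; have [a [b j]] := joins_ex e.
rewrite !(mem_cedges _ _ j) (agree_conn _ H); case c: (conn F x a); rewrite ?andbF //.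
by rewrite (H e a c (joins_in j)).
Qed.

Lemma agree_esz F F' x : agree F F' x -> esz F' x = esz F x.
Proof. by move=> H; rewrite /esz (agree_cedges H). Qed.

(** ** Joining two components by a new edge *)

Section Add.
Variables (F : {set E}) (e : E) (a b : V).
Hypotheses (j : joins e a b) (nc : ~~ conn F a b).
Let F' := e |: F.

Lemma add_notin : e \notin F.
Proof. by apply: contra nc => eF; exact: conn1 eF j. Qed.

Lemma add_agree x : ~~ conn F a x -> ~~ conn F b x -> agree F F' x.
Proof.
move=> na nb f y c yf; rewrite !inE; case: (eqVneq f e) => //= fe; subst f; exfalso.
move: yf; rewrite (eqP j) !inE => /orP[] /eqP yy; subst y.
  by rewrite connC c in na.
by rewrite connC c in nb.
Qed.

Lemma add_conn_ab : conn F' a b.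
Proof. by apply: conn1 j; rewrite setU11. Qed.

Lemma add_sub x y : conn F x y -> conn F' x y.
Proof. by apply: conn_sub; exact: subsetUr. Qed.

Lemma add_component : component F' a = component F a :|: component F b.
Proof.
apply/setP => y; rewrite in_setU !mem_component; apply/idP/orP => [/(conn_add j)|[|]].
- by case=> [->|[_ ->]|[h _]]; [left|right|case/negP: nc].
- exact: add_sub.
- by move=> /add_sub; exact: (conn_trans add_conn_ab).
Qed.

Lemma add_cedges :
  component_edges F' a = e |: (component_edges F a :|: component_edges F b).
Proof.
apply/setP => f; have [x [y jf]] := joins_ex f.
rewrite in_setU1 in_setU !(mem_cedges _ _ jf) in_setU1.
have := add_component => /setP/(_ x); rewrite in_setU !mem_component => ->.
case: (eqVneq f e) => [fe|_] /=; last by rewrite andb_orr.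
by subst f; case: (joins2 j jf) => -[-> _]; rewrite conn0 ?orbT.
Qed.

Lemma add_disj : [disjoint component_edges F a & component_edges F b].
Proof.
apply/pred0P => f /=; have [x [y jf]] := joins_ex f; rewrite !(mem_cedges _ _ jf).
apply/negbTE/negP => /andP[/andP[_ h1] /andP[_ h2]]; case/negP: nc.
by apply: conn_trans h1 _; rewrite connC.
Qed.

Lemma esz_add : esz F' a = (esz F a + esz F b).+1.
Proof.
rewrite /esz add_cedges cardsU1 cardsU.
have -> : component_edges F a :&: component_edges F b = set0.
  by apply/eqP; rewrite setI_eq0 add_disj.
by rewrite cards0 subn0 in_setU !(mem_cedges _ _ j) (negPf add_notin) add1n.
Qed.

End Add.

Section Excess.
Variable d : nat.

(** The sum ranges over the components as vertex sets, so that each is counted once. *)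
Definition excess F := \sum_(C in [set component F x | x : V])
  (#|[set e in F | ends e \subset C]| - d).

(** Stated without subtracting from the excess; it also serves to remove an edge. *)
Lemma excess_add F e a b : joins e a b -> ~~ conn F a b ->
  excess (e |: F) + (esz F a - d) + (esz F b - d)
  = excess F + ((esz F a + esz F b).+1 - d).
Proof.
move=> j nc; set F' := e |: F.
pose R := [set component F x | x : V & ~~ conn F a x && ~~ conn F b x].
pose g (F : {set E}) (C : {set V}) := #|[set e in F | ends e \subset C]| - d.
have gE H x : g H (component H x) = esz H x - d by [].
have e1 : [set component F x | x : V] = component F a |: (component F b |: R).
  apply/setP => C; rewrite !in_setU1; apply/imsetP/or3P => [[x _ ->]|[/eqP->|/eqP->|]].
  - case ca: (conn F a x); first by constructor 1; rewrite (component_eq ca).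
    case cb: (conn F b x); first by constructor 2; rewrite (component_eq cb).
    by constructor 3; apply/imsetP; exists x; rewrite // inE ca cb.
  - by exists a.
  - by exists b.
  - by case/imsetP => x _ ->; exists x.
have ag x : ~~ conn F a x && ~~ conn F b x -> agree F F' x.
  by case/andP; exact: add_agree.
have e2 : [set component F' x | x : V] = component F' a |: R.
  apply/setP => C; rewrite !in_setU1; apply/imsetP/orP => [[x _ ->]|[/eqP->|]].
  - case ca: (conn F a x).
      by left; rewrite -(component_eq (add_sub e ca)).
    case cb: (conn F b x).
      by left; rewrite -(component_eq (add_sub e cb)) (component_eq (add_conn_ab F j)).
    right; apply/imsetP; exists x; rewrite ?inE ?ca ?cb //.
    by apply: agree_component; apply: ag; rewrite ca cb.
  - by exists a.
  - by case/imsetP => x; rewrite inE => /ag/agree_component h ->; exists x.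
have nb : component F b \notin R.
  apply/imsetP => -[x]; rewrite inE => /andP[_ nb] h; case/negP: nb.
  by rewrite -mem_component h mem_component conn0.
have na : component F a \notin component F b |: R.
  rewrite in_setU1; apply/norP; split.
    by apply: contra nc => /eqP h; rewrite -mem_component h mem_component conn0.
  apply/imsetP => -[x]; rewrite inE => /andP[nx _] h; case/negP: nx.
  by rewrite -mem_component h mem_component conn0.
have na' : component F' a \notin R.
  apply/imsetP => -[x]; rewrite inE => /andP[nx _] h; case/negP: nx.
  have : a \in component F x by rewrite -h mem_component conn0.
  by rewrite mem_component connC.
rewrite /excess e1 e2 !big_setU1 //= -/(g F' _) -/(g F (component F a)) -/(g F (component F b)).
rewrite !gE (esz_add j nc).
have -> : \sum_(C in R) (#|[set e in F' | ends e \subset C]| - d)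
        = \sum_(C in R) (#|[set e in F | ends e \subset C]| - d).
  apply: eq_bigr => C /imsetP[x]; rewrite inE => /ag h ->.
  rewrite -{1}(agree_component h); change (esz F' x - d = esz F x - d).
  by rewrite (agree_esz h).
set S := (\sum_(C in R) _); set u := _.+1 - d; move: S u (esz F a - d) (esz F b - d) => S u p q; lia.
Qed.

End Excess.


(** In a forest rooted at x, mapping an edge to its tail is a bijection onto the
    vertices of the component other than x. *)
Lemma tree_card F x : forest F -> #|component F x| = (esz F x).+1.
Proof.
move=> fF; have [phi [tau [mu R]]] := rooting x fF.
have [g inj] := rt_graph R.
rewrite (cardsD1 x) mem_component conn0 add1n; congr _.+1.
have -> : component F x :\ x = [set tau e | e in component_edges F x].
  apply/setP => z; rewrite in_setD1 mem_component; apply/andP/imsetP => [[nz c]|[e]].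
    have ne : phi z != z.
      by apply: contra nz => /eqP h; apply/eqP; apply: (rt_uniq R); rewrite // connC.
    have [e eF te] := rt_full R ne; exists e => //.
    by rewrite (mem_cedges _ _ (g e eF)) eF te.
  have [a [b jab]] := joins_ex e; rewrite (mem_cedges _ _ jab) => /andP[eF c] ->.
  have je := g e eF; split.
    apply/eqP => h; have := joins_neq je; rewrite h (rt_root R) eqxx //.
  case: (joins2 jab je) => -[-> _] //.
  exact: conn_trans c (conn1 eF jab).
rewrite card_in_imset // => e f; rewrite !inE => /andP[eF _] /andP[fF' _].
exact: inj.
Qed.

(** ** Cutting a tree so as to separate given vertices *)

Lemma cut_conn F f x y : forest F -> f \in F -> conn F x y -> ~~ conn (F :\ f) x y ->
  exists a b, [/\ joins f a b, ~~ conn (F :\ f) a b,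
    conn (F :\ f) x a & conn (F :\ f) y b].
Proof.
move=> fF fin c nc; have [a [b j]] := joins_ex f.
have nab := fF f a b fin j.
case: (conn_rem fin j c) => [h|[h1 h2]|[h1 h2]]; first by rewrite h in nc.
  by exists a, b; split=> //; rewrite connC.
by exists b, a; split=> //; rewrite 1?joins_sym 1?connC.
Qed.

Lemma cut_esz F f x y : forest F -> f \in F -> conn F x y -> ~~ conn (F :\ f) x y ->
  esz F x = (esz (F :\ f) x + esz (F :\ f) y).+1.
Proof.
move=> fF fin c nc; have [a [b [j nab xa yb]]] := cut_conn fF fin c nc.
rewrite (esz_conn xa) (esz_conn yb) -(esz_add j nab) (setD1K fin).
by apply: esz_conn; apply: conn_sub xa; exact: subsetDl.
Qed.

Lemma cut_excess d F f x y : forest F -> f \in F -> conn F x y -> ~~ conn (F :\ f) x y ->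
  excess d F + (esz (F :\ f) x - d) + (esz (F :\ f) y - d)
  = excess d (F :\ f) + (esz F x - d).
Proof.
move=> fF fin c nc; have [a [b [j nab xa yb]]] := cut_conn fF fin c nc.
have := excess_add d j nab; rewrite (setD1K fin) (esz_conn xa) (esz_conn yb) => ->.
rewrite -(esz_add j nab) (setD1K fin); congr (_ + (_ - _)).
by apply: esz_conn; rewrite connC; apply: conn_sub xa; exact: subsetDl.
Qed.

Lemma cut_side F f x y z : forest F -> f \in F -> conn F x y -> ~~ conn (F :\ f) x y ->
  conn F x z -> conn (F :\ f) x z || conn (F :\ f) y z.
Proof.
move=> fF fin c nc cz; have [a [b [j nab xa yb]]] := cut_conn fF fin c nc.
have nxb : ~~ conn (F :\ f) x b.
  by apply: contra nc => h; apply: conn_trans h _; rewrite connC.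
case: (conn_rem fin j cz) => [->//|[h1 h2]|[h1 h2]].
  by rewrite (conn_trans yb h2) orbT.
by rewrite h1 in nxb.
Qed.

(** If c is constant on the components of a forest, this condition makes sure that the
    edges fs can be added to it without creating a cycle, whatever the components are. *)
Fixpoint chain_ok (c : V -> V) (fs : seq E) : Prop :=
  if fs is f :: fs' then exists a b, [/\ joins f a b, c a != c b &
    chain_ok (fun z => if c z == c a then c b else c z) fs'] else True.

Lemma chain_forest c fs X : forest X ->
  (forall x y, conn X x y -> c x = c y) -> chain_ok c fs ->
  forest (X :|: [set f in fs]).
Proof.
elim: fs c X => [|f fs IH] c X fX cc /=.
  by move=> _; apply: forest_sub fX; apply/subsetP => e; rewrite !inE orbF.
case=> a [b [j nab ok]].
have nc : ~~ conn X a b by apply: contra nab => /cc ->.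
have -> : X :|: [set g in f :: fs] = (f |: X) :|: [set g in fs].
  by apply/setP => e; rewrite !inE orbCA orbA.
apply: IH ok; first exact: forest_add j nc.
move=> x y /(conn_add j)[/cc->//|[/cc-> /cc<-]|[/cc-> /cc<-]].
  by rewrite eqxx; case: ifP => // /eqP.
by rewrite eqxx; case: ifP => // /eqP.
Qed.

(** If moreover g and r have the same colour, although X does not join them, then
    adding fs does not join them either. *)
Lemma chain_sep c fs X g r : (forall x y, conn X x y -> c x = c y) -> chain_ok c fs ->
  c g = c r -> ~~ conn X g r -> ~~ conn (X :|: [set f in fs]) g r.
Proof.
elim: fs c X => [|f fs IH] c X cc /=.
  move=> _ _; apply: contra; apply: conn_sub; apply/subsetP => e; rewrite !inE.
  by rewrite orbF.
case=> a [b [j nab ok]] cgr nc.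
have -> : X :|: [set g in f :: fs] = (f |: X) :|: [set g in fs].
  by apply/setP => e; rewrite !inE orbCA orbA.
apply: IH ok _ _.
- move=> x y /(conn_add j)[/cc->//|[/cc-> /cc<-]|[/cc-> /cc<-]].
    by rewrite eqxx; case: ifP => // /eqP.
  by rewrite eqxx; case: ifP => // /eqP.
- by rewrite cgr.
apply/negP => /(conn_add j)[h|[h1 h2]|[h1 h2]].
- by rewrite h in nc.
- by rewrite -(cc _ _ h1) cgr (cc _ _ h2) eqxx in nab.
- by rewrite -(cc _ _ h1) cgr (cc _ _ h2) eqxx in nab.
Qed.

(** Between vertices of different colours some edge changes colour. *)
Lemma separate2 F (c : V -> V) t1 t2 : forest F -> conn F t1 t2 -> c t1 != c t2 ->
  exists f, [/\ f \in F, ~~ conn (F :\ f) t1 t2 & chain_ok c [:: f]].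
Proof.
move=> fF c12 n12.
have [f [a [b [fin j ca cb nc]]]] := forest_cross (A := fun z => c z == c t2) fF c12 n12 (eqxx _).
exists f; split=> //=; exists a, b; split=> //.
by rewrite (eqP ca) eq_sym.
Qed.

(** Two edges with ends of different colours can be chosen to separate three vertices of
    different colours, and such that they create no cycle between the colours. Edges
    leaving the colour of t1 on the paths to t2 and to t3 do, unless they lead to the same
    colour; in that case one of them is exchanged for an edge entering the colour of t2
    or of t3. *)
Lemma separate3 F (c : V -> V) t1 t2 t3 : forest F -> conn F t1 t2 -> conn F t1 t3 ->
  c t1 != c t2 -> c t1 != c t3 -> c t2 != c t3 ->
  exists f1 f2, [/\ f1 \in F, f2 \in F :\ f1, chain_ok c [:: f1; f2] &
    [/\ ~~ conn (F :\ f1 :\ f2) t1 t2, ~~ conn (F :\ f1 :\ f2) t1 t3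
      & ~~ conn (F :\ f1 :\ f2) t2 t3]].
Proof.
move=> fF c12 c13 n12 n13 n23.
have sub f e : forall x y, conn (F :\ f :\ e) x y -> conn (F :\ f) x y.
  by apply: conn_sub; exact: subsetDl.
(* an edge leaving the colour of t1 and separating t1 from t2 *)
have n21 : c t2 != c t1 by rewrite eq_sym.
have c21 : conn F t2 t1 by rewrite connC.
have [f [a [b [fin j /eqP ca cb nc]]]] :=
  forest_cross (A := fun z => c z == c t1) fF c21 n21 (eqxx _).
have fF1 : forest (F :\ f) by apply: forest_sub fF; exact: subsetDl.
have side : forall u, conn F t1 u -> conn (F :\ f) t2 u || conn (F :\ f) t1 u.
  by move=> u cu; apply: (cut_side fF fin c21 nc); exact: conn_trans c21 cu.
case: (boolP (conn (F :\ f) t2 t3)) => [c23|nc23].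
  (* t1 is alone on its side: split t2 from t3 with the merged colours *)
  pose c' z := if c z == c a then c b else c z.
  have ne : c' t2 != c' t3.
    by rewrite /c' ca (negPf n21) eq_sym in n13 *; rewrite (negPf n13).
  have [g [gin ng ok]] := separate2 fF1 c23 ne.
  exists f, g; split=> //.
    by exists a, b; split=> //; rewrite ca eq_sym.
  have nc13 : ~~ conn (F :\ f) t1 t3.
    by apply: contra nc => h; apply: conn_trans c23 _; rewrite connC.
  split=> //; first by apply: contra nc => /sub; rewrite connC.
  by apply: contra nc13 => /sub.
have c31 : conn (F :\ f) t3 t1.
  by have := side _ c13; rewrite (negPf nc23) connC.
have n31 : c t3 != c t1 by rewrite eq_sym.
have [g [a' [b' [gin j' /eqP ca' cb' nc']]]] :=
  forest_cross (A := fun z => c z == c t1) fF1 c31 n31 (eqxx _).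
have gF : g \in F by move: gin; rewrite inE => /andP[].
have gf : g != f by move: gin; rewrite !inE => /andP[].
have sep12 : ~~ conn (F :\ f :\ g) t1 t2 by apply: contra nc => /sub; rewrite connC.
have sep13 : ~~ conn (F :\ f :\ g) t1 t3 by rewrite connC.
have sep23 : ~~ conn (F :\ f :\ g) t2 t3 by apply: contra nc23 => /sub.
case: (eqVneq (c b) (c b')) => [bb|nbb]; last first.
  exists f, g; split=> //; exists a, b; split=> //; first by rewrite ca eq_sym.
  exists a', b'; split=> //.
  by rewrite ca ca' eqxx (negPf cb').
have fF2 : forest (F :\ f :\ g) by apply: forest_sub fF1; exact: subsetDl.
(* both edges join the colour of t1 to the colour of b; replace one of them *)
case: (eqVneq (c t3) (c b)) => [b3|nb3].
  (* keep g; cut t2 off inside its own piece *)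
  have [x [y [jx nxy xt2 yt1]]] := cut_conn fF fin c21 nc.
  have nx : c x != c t2.
    case: (joins2 j jx) => -[-> _]; first by rewrite ca.
    by rewrite -b3 eq_sym.
  have cx : conn (F :\ f :\ g) x t2.
    have [u [v [ju nuv u3 v1]]] := cut_conn fF1 gin c31 nc'.
    have cx0 : conn (F :\ f) x t2 by rewrite connC.
    case: (conn_rem gin ju cx0) => // -[_ h]; exfalso.
      case/negP: nc; apply: (conn_trans (y := v)); last by rewrite connC; exact: sub v1.
      by rewrite connC; exact: sub h.
    case/negP: nc23; apply: (conn_trans (y := u)); last by rewrite connC; exact: sub u3.
    by rewrite connC; exact: sub h.
  have [f' [p [q [fin' jp /eqP cp cq ncx]]]] :=
    forest_cross (A := fun z => c z == c t2) fF2 cx nx (eqxx _).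
  have f'g : f' \in F :\ g by move: fin'; rewrite !inE => /and3P[-> _ ->].
  have s3 : forall u v, conn (F :\ f :\ g :\ f') u v -> conn (F :\ f :\ g) u v.
    by apply: conn_sub; exact: subsetDl.
  have s4 : forall u v, conn (F :\ f :\ g :\ f') u v -> conn (F :\ f) u v.
    by move=> u v /s3/sub.
  have eqF : F :\ g :\ f' = f |: (F :\ f :\ g :\ f').
    have := fin'; rewrite !inE => /and3P[_ ff' _].
    apply/setP => z; rewrite !inE.
    by case: (eqVneq z f) => [->|] //=; rewrite fin (eq_sym f g) gf (eq_sym f f') ff'.
  exists g, f'; split=> //.
    exists a', b'; split=> //; first by rewrite ca' eq_sym.
    exists p, q; split=> //; rewrite cp ca' -bb -b3.
    rewrite (negPf n21).
    case: (eqVneq (c q) (c t1)) => _; first exact: n23.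
    by rewrite eq_sym.
  split.
  - rewrite connC eqF; apply/negP => /(conn_add jx)[h|[h1 h2]|[h1 h2]].
    + by case/negP: nc; exact: s4 h.
    + by case/negP: ncx; rewrite connC.
    + by case/negP: nc; apply: (conn_trans (y := y)); [exact: s4 h1|rewrite connC].
  - rewrite eqF; apply/negP => /(conn_add jx)[h|[h1 h2]|[h1 h2]].
    + by case/negP: sep13; exact: s3 h.
    + case/negP: nc; apply: (conn_trans (y := x)); first by [].
      by rewrite connC; exact: s4 h1.
    + case/negP: nc23; apply: (conn_trans (y := x)); first by [].
      exact: s4 h2.
  - rewrite eqF; apply/negP => /(conn_add jx)[h|[h1 h2]|[h1 h2]].
    + by case/negP: sep23; exact: s3 h.
    + by case/negP: ncx; rewrite connC.
    + case/negP: nc; apply: (conn_trans (y := y)); first exact: s4 h1.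
      by rewrite connC.
(* keep f; cut t3 off inside its own piece *)
have [x [y [jx nxy xt3 yt1]]] := cut_conn fF1 gin c31 nc'.
have nx : c x != c t3.
  case: (joins2 j' jx) => -[-> _]; first by rewrite ca'.
  by rewrite -bb eq_sym.
have cx : conn (F :\ f :\ g) x t3 by rewrite connC.
have [f' [p [q [fin' jp /eqP cp cq ncx]]]] :=
  forest_cross (A := fun z => c z == c t3) fF2 cx nx (eqxx _).
have s3 : forall u v, conn (F :\ f :\ g :\ f') u v -> conn (F :\ f :\ g) u v.
  by apply: conn_sub; exact: subsetDl.
have s5 : forall u v, conn (F :\ f :\ f') u v -> conn (F :\ f) u v.
  by apply: conn_sub; exact: subsetDl.
have eqF : F :\ f :\ f' = g |: (F :\ f :\ g :\ f').
  have := fin'; rewrite !inE => /and3P[gf' _ _].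
  apply/setP => z; rewrite !inE.
  by case: (eqVneq z g) => [->|] //=; rewrite gF gf (eq_sym g f') gf'.
exists f, f'; split=> //.
- by move: fin'; rewrite !inE => /and3P[_ -> ->].
- exists a, b; split=> //; first by rewrite ca eq_sym.
  exists p, q; split=> //; rewrite cp ca (negPf n31).
  case: (eqVneq (c q) (c t1)) => _; first exact: nb3.
  by rewrite eq_sym.
split.
- by apply: contra nc => /s5; rewrite connC.
- rewrite connC eqF; apply/negP => /(conn_add jx)[h|[h1 h2]|[h1 h2]].
  + by case/negP: nc'; exact: s3 h.
  + by case/negP: ncx; rewrite connC.
  + case/negP: nc'; apply: (conn_trans (y := y)); first exact: s3 h1.
    by rewrite connC.
- by apply: contra nc23 => /s5.
Qed.

End Sizes.

Section Trees.
Variables (G : multigraph) (d : nat).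
Notation V := (vertex G).
Notation E := (edge G).
Implicit Types (F : {set E}) (f : E) (x : V).

Lemma esz_mono F F' x : F \subset F' -> esz F x <= esz F' x.
Proof.
move=> sF; apply: subset_leq_card; apply/subsetP => f; have [a [b j]] := joins_ex f.
by rewrite !(mem_cedges _ _ j) => /andP[/(subsetP sF) -> /(conn_sub sF)].
Qed.

(** Two edges whose removal separates three vertices split their tree into exactly
    three pieces. *)
Lemma cut3 F f1 f2 t1 t2 t3 : forest F -> f1 \in F -> f2 \in F :\ f1 ->
  conn F t1 t2 -> conn F t1 t3 -> let F2 := F :\ f1 :\ f2 in
  ~~ conn F2 t1 t2 -> ~~ conn F2 t1 t3 -> ~~ conn F2 t2 t3 ->
  [/\ esz F t1 = esz F2 t1 + esz F2 t2 + esz F2 t3 + 2,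
  excess d F + (esz F2 t1 - d) + (esz F2 t2 - d) + (esz F2 t3 - d)
    = excess d F2 + (esz F t1 - d),
  forall x, x \in ends f1 -> conn F t1 x & forall x, x \in ends f2 -> conn F t1 x].
Proof.
move=> fF h1 h2 c12 c13 F2.
have fF1 : forest (F :\ f1) by apply: forest_sub fF; exact: subsetDl.
have main a b c : conn F a b -> conn F a c -> ~~ conn F2 a b -> ~~ conn F2 a c ->
    ~~ conn F2 b c -> conn (F :\ f1) a b ->
    [/\ esz F a = esz F2 a + esz F2 b + esz F2 c + 2,
    excess d F + (esz F2 a - d) + (esz F2 b - d) + (esz F2 c - d)
      = excess d F2 + (esz F a - d),
    forall x, x \in ends f1 -> conn F a x & forall x, x \in ends f2 -> conn F a x].
  move=> cab cac nab nac nbc c1ab.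
  have n1 : ~~ conn (F :\ f1) a c.
    apply/negP => c1ac; have := cut_side fF1 h2 c1ab nab c1ac.
    by rewrite -/F2 (negPf nac) (negPf nbc).
  have e1 := cut_esz fF h1 cac n1; have x1 := cut_excess d fF h1 cac n1.
  have e2 := cut_esz fF1 h2 c1ab nab; have x2 := cut_excess d fF1 h2 c1ab nab.
  have ec : esz F2 c = esz (F :\ f1) c.
    apply: agree_esz => f y cy ye; rewrite [LHS]in_setD1; case: (eqVneq f f2) => //= ff.
    subst f; exfalso; have [u [v [j _ cu cv]]] := cut_conn fF1 h2 c1ab nab.
    have sub := @conn_sub _ F2 _ (subsetDl (F :\ f1) [set f2]).
    case/negP: n1; move: ye; rewrite (eqP j) !inE => /orP[]/eqP ey; subst y.
      by apply: conn_trans (sub _ _ cu) _; rewrite connC.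
    by apply: conn_trans c1ab (conn_trans (sub _ _ cv) _); rewrite connC.
  have s1 := @conn_sub _ (F :\ f1) _ (subsetDl F [set f1]).
  have s2 x y (h : conn F2 x y) : conn F x y.
    by apply: (s1 x y); apply: conn_sub h; exact: subsetDl.
  rewrite -/F2 in e2 x2 *; rewrite ec; split; first by nat_lia.
  - move: x1 x2; rewrite e1 e2; move: (excess d F) (excess d F2) (excess d _) => A B C.
    move: (esz F2 a) (esz F2 b) (esz _ c) => u v w; nat_lia.
  - have [u [v [j _ cu cv]]] := cut_conn fF h1 cac n1.
    move=> x; rewrite (eqP j) !inE => /orP[]/eqP ->; first exact: s1.
    by apply: conn_trans cac _; exact: s1.
  - have [u [v [j _ cu cv]]] := cut_conn fF1 h2 c1ab nab.
    move=> x; rewrite (eqP j) !inE => /orP[]/eqP ->; first exact: s2.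
    by apply: conn_trans cab _; exact: s2.
move=> n12 n13 n23.
case: (boolP (conn (F :\ f1) t1 t2)) => [h|m12]; first exact: main.
have e12 := esz_conn c12; have e13 := esz_conn c13.
case: (boolP (conn (F :\ f1) t1 t3)) => [h|m13].
  have [||||||u v k1 k2] := @main t1 t3 t2 => //; first by rewrite connC.
  by split=> //; nat_lia.
have c23 : conn F t2 t3 by apply: conn_trans c13; rewrite connC.
case: (boolP (conn (F :\ f1) t2 t3)) => [h|m23].
  have [||||||u v k1 k2] := @main t2 t3 t1 => //; rewrite 1?connC //.
  by rewrite e12; split; [nat_lia|nat_lia|..] => x hx; apply: (conn_trans c12); auto.
by have := cut_side fF h1 c12 m12 c13; rewrite (negPf m13) (negPf m23).
Qed.

End Trees.

(** * Augmenting a family of forests *)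

Lemma max_exists (P : nat -> Prop) b : (exists n, P n) -> (forall n, P n -> n <= b) ->
  exists n, P n /\ forall m, P m -> m <= n.
Proof.
move=> [n Pn] bd; apply: NNPP => no.
have up i : exists m, P m /\ i <= m.
  elim: i => [|i [m [Pm le]]]; first by exists n.
  case: (classic (exists m', P m' /\ m < m')) => [[m' [Pm' lt]]|H].
    by exists m'; split=> //; lia.
  exfalso; apply: no; exists m; split=> // m' Pm'.
  by rewrite leqNgt; apply/negP => lt; apply: H; exists m'.
by have [m [/bd]] := up b.+1; lia.
Qed.

Section Hook.
Variables (G : multigraph) (n : nat).
Notation V := (vertex G).
Notation E := (edge G).
Implicit Types (F X A : {set E}) (e f : E) (x y z a b r u v w : V).
Implicit Types (col : E -> option 'I_n) (c i : 'I_n) (s : seq V).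

Definition blue col c := [set e | col e == Some c].
Definition red col := [set e | col e == None].

Definition recolor col e0 o := fun e => if e == e0 then o else col e.

(** An exploration of the components of F along arcs of the blue forests; s lists the
    entry vertices, of which the first J are considered. *)
Definition legal col F r s J :=
  (forall j, 0 < j < J -> exists c u m, [/\ m < j, conn F (nth r s m) u &
     darc (blue col c) r u (nth r s j)]) /\
  (forall m j, m < j < J -> ~~ conn F (nth r s m) (nth r s j)).

Lemma legal_le col F r s J J' : J' <= J -> legal col F r s J -> legal col F r s J'.
Proof.
move=> le [h1 h2]; split=> [j|m j] /andP[? ?]; [apply: (h1 j)|apply: (h2 m j)]; lia.
Qed.

Lemma blue_recolor_same col e0 c : blue (recolor col e0 (Some c)) c = e0 |: blue col c.
Proof.
apply/setP => e; rewrite !inE /recolor.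
by case: (eqVneq e e0) => // _; rewrite eqxx.
Qed.

Lemma blue_recolor_other col e0 o c : o != Some c ->
  blue (recolor col e0 o) c = blue col c :\ e0.
Proof.
move=> no; apply/setP => e; rewrite !inE /recolor.
by case: (eqVneq e e0) => // _; rewrite (negPf no).
Qed.

Lemma darc_sub X X' r u v : X \subset X' -> darc X r u v -> darc X' r u v.
Proof.
move=> s [e [eX j h]]; exists e; split=> //; first exact: (subsetP s).
by apply: conn_sub h; apply: setSD.
Qed.

(** If the entry vertex v of the first component meeting A is outside A, then a red edge
    of this component that enters A can be given colour i. Otherwise the arc entering v
    joins A to its complement and can be given colour i; its own forest has then lost an
    edge, and the argument is repeated with the part that this cuts off from r, which
    meets an earlier component. *)
Lemma augmentation F r s : forest F -> nth r s 0 = r -> forall j col i (A : pred V) z,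
  (forall e, e \in F -> col e = None) -> (forall c, forest (blue col c)) ->
  legal col F r s j.+1 ->
  (forall e x y, e \in blue col i -> joins e x y -> A x -> A y) -> ~~ A r ->
  (forall m w, m < j -> conn F (nth r s m) w -> ~~ A w) ->
  A z -> conn F (nth r s j) z ->
  exists col' e0 j', [/\ j' <= j, e0 \in F,
     (exists2 x, x \in ends e0 & conn F (nth r s j') x) &
     forall c, forest (blue col' c)] /\
   [/\ legal col' F r s j'.+1,
     (forall e, (col' e == None) = (col e == None) && (e != e0)),
     (A (nth r s j) -> j' < j) &
     (~~ A (nth r s j) -> j' = j /\ ~~ conn (F :\ e0) (nth r s j) z)].
Proof.
move=> fF s0; elim/ltn_ind => j IH col i A z Fn fb leg noc nAr pre Az cz.
case Av: (A (nth r s j)); last first.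
  have [e0 [a [b [eF jab Aa nAb nc]]]] := forest_cross fF cz (negbT Av) Az.
  exists (recolor col e0 (Some i)), e0, j; split; first split=> //.
  - case: (conn_rem eF jab cz) => [h|[h _]|[h _]]; first by rewrite h in nc.
      exists a; first exact: joins_in jab.
      by apply: conn_sub h; exact: subsetDl.
    exists b; first by rewrite joins_sym in jab; exact: joins_in jab.
    by apply: conn_sub h; exact: subsetDl.
  - move=> c; case: (eqVneq c i) => [->|ne]; last first.
      rewrite blue_recolor_other; last by apply: contra ne => /eqP[->].
      by apply: forest_sub (fb c); exact: subsetDl.
    rewrite blue_recolor_same; apply: forest_add jab _ => //.
    apply/negP => h; move: nAb; rewrite -(@conn_inv _ _ A (blue col i) _ _ _ h) ?Aa //.
    move=> e x y ei jxy; apply/idP/idP; first exact: noc ei jxy.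
    by apply: noc ei _; rewrite joins_sym.
  split=> //; last first.
    move=> e; rewrite /recolor; case: (eqVneq e e0) => //= _; by rewrite ?andbF ?andbT.
  case: leg => l1 l2; split=> // l hl; have [c [u [m [lm cu ar]]]] := l1 l hl.
  exists c, u, m; split=> //; apply: darc_sub ar; apply/subsetP => e; rewrite !inE.
  by rewrite /recolor; case: (eqVneq e e0) => // ->; rewrite (Fn e0 eF).
have j0 : 0 < j by case: (posnP j) => // jz; rewrite jz s0 (negPf nAr) in Av.
have [c [u [m [lm cu [e [ec jue ce]]]]]] := leg.1 j (introT andP (conj j0 (ltnSn j))).
have nAu : ~~ A u := pre m u lm cu.
have ci : c != i.
  apply: contra nAu => /eqP ci; rewrite ci in ec.
  by apply: noc ec _ Av; rewrite joins_sym.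
(* e enters A and can move to colour i; the part of colour c behind e is the next A *)
pose A1 w := ~~ conn (blue col c :\ e) w r.
have fc := fb c.
have A1u : A1 u.
  apply/negP => h; case/negP: (fc e u _ ec jue).
  by apply: conn_trans h _; rewrite connC.
have nAuv : ~~ conn (blue col i) u (nth r s j).
  apply/negP => h; move: nAu; rewrite (@conn_inv _ _ A (blue col i) _ _ _ h) ?Av //.
  move=> f x y fi jxy; apply/idP/idP; first exact: noc fi jxy.
  by apply: noc fi _; rewrite joins_sym.
pose P m' := [exists w, A1 w && conn F (nth r s m') w].
have exP : exists m', P m' by exists m; apply/existsP; exists u; rewrite A1u cu.
case: (ex_minnP exP) => j1 /existsP[z1 /andP[A1z cz1]] min1.
have lt1 : j1 < j.
  apply: leq_ltn_trans lm; apply: min1; apply/existsP; exists u; by rewrite A1u cu.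
pose col1 := recolor col e (Some i).
have b1i : blue col1 i = e |: blue col i := blue_recolor_same col e i.
have b1c : blue col1 c = blue col c :\ e.
  by apply: blue_recolor_other; rewrite eq_sym; apply: contra ci => /eqP[->].
have b1 c' : c' != i -> c' != c -> blue col1 c' = blue col c'.
  move=> n1 n2; apply/setP => f; rewrite !inE /col1 /recolor.
  case: (eqVneq f e) => // ->; move: ec; rewrite inE => /eqP ->.
  by rewrite !(inj_eq Some_inj) ![_ == c']eq_sym (negPf n1) (negPf n2).
have eN : col e != None by move: ec; rewrite inE => /eqP ->.
have [||||||||col' [e0 [j' [[le' e0F ex0 fb'] [leg' red' fin1 fin2]]]]] :=
  IH j1 lt1 col1 c A1 z1.
- move=> f fF'; rewrite /col1 /recolor; case: (eqVneq f e) => [fe|_]; last exact: Fn.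
  by rewrite -fe (Fn f fF') in eN.
- move=> c'; case: (eqVneq c' i) => [->|n1].
    by rewrite b1i; apply: forest_add jue nAuv.
  case: (eqVneq c' c) => [->|n2]; last by rewrite b1.
  by rewrite b1c; apply: forest_sub fc; exact: subsetDl.
- have lej : j1.+1 <= j.+1 by rewrite ltnS ltnW.
  have [_ l2'] := legal_le lej leg; case: leg => l1 l2; split=> //.
  move=> l /andP[l0 ll]; have hl : 0 < l < j.+1 by nat_lia.
  have [c' [u' [m' [lm' cu' ar]]]] := l1 l hl.
  exists c', u', m'; split=> //.
  case: (eqVneq c' c) => [cc|n2]; last first.
    case: (eqVneq c' i) => [ii|n1]; last by rewrite b1.
    by rewrite ii in ar *; apply: darc_sub ar; rewrite b1i subsetUr.
  rewrite cc in ar *; case: ar => e' [ec' j' h']; exists e'.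
  have nA1u' : ~~ A1 u'.
    apply/negP => h; have : j1 <= m' by apply: min1; apply/existsP; exists u'; rewrite h.
    by nat_lia.
  have ne : e' != e.
    apply/eqP => ee; subst e'; case: (joins2 jue j') => -[h1 h2].
      have hh : l < j < j.+1 by nat_lia.
      by have := l2 l j hh; rewrite h2 conn0.
    have hh : m' < j < j.+1 by nat_lia.
    by have := l2 m' j hh; rewrite -h1 cu'.
  have e'b : e' \in blue col1 c by rewrite b1c !inE ne; move: ec'; rewrite inE.
  split=> //; rewrite b1c.
  have hv : conn (blue col c :\ e) (nth r s l) r.
    move: nA1u'; rewrite negbK; apply: conn_trans; rewrite connC.
    by apply: conn1 j'; rewrite -b1c.
  exact: forest_inter.
- move=> f x y; rewrite b1c => fi jxy; apply: contra => h.
  exact: conn_trans (conn1 fi jxy) h.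
- by rewrite negbK conn0.
- move=> m' w lt h; apply/negP => A1w.
  have : j1 <= m' by apply: min1; apply/existsP; exists w; rewrite A1w h.
  by nat_lia.
- by [].
- by [].
exists col', e0, j'; split; first by split=> //; nat_lia.
split=> //; last by nat_lia.
move=> f; rewrite red' /col1 /recolor; case: (eqVneq f e) => // ->.
by rewrite (negPf eN).
Qed.

(** In every colour each vertex of H but r has an arc to its parent inside H. *)
Lemma blue_count col r (H : {set V}) : (forall c, forest (blue col c)) -> r \in H ->
  (forall c w, w \in H -> conn (blue col c) w r) ->
  (forall c w v, w \in H -> darc (blue col c) r w v -> v \in H) ->
  n * (#|H| - 1) <= #|[set e | (col e != None) && (ends e \subset H)]|.
Proof.
move=> fb rH cn cl.
pose Ec c := [set e in blue col c | ends e \subset H].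
have le c : #|H| - 1 <= #|Ec c|.
  have [phi [tau [mu R]]] := rooting r (fb c).
  have [g inj] := rt_graph R.
  have -> : #|H| - 1 = #|H :\ r| by rewrite (cardsD1 r) rH; nat_lia.
  apply: leq_trans (subset_leq_card _) (leq_imset_card tau _).
  apply/subsetP => w; rewrite !inE => /andP[wr wH].
  have nw : phi w != w.
    by apply: contra wr => /eqP h; apply/eqP; apply: (rt_uniq R) h; exact: cn.
  have [e eX te] := rt_full R nw; apply/imsetP; exists e => //.
  have j := g e eX; rewrite te in j.
  rewrite inE eX (eqP j) subUset !sub1set wH /=.
  apply: (cl c w) => //; apply: (@pgraph_darc _ _ phi mu r (fun z => conn (blue col c) z r)) => //.
  - exact: rt_decr R.
  - move=> z cz nz; split; first exact: rooted_conn R cz nz.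
    exact: rt_edge R nz.
  - exact: rt_uniq R.
  - exact: cn.
have -> : n * (#|H| - 1) = \sum_(c < n) (#|H| - 1) by rewrite sum_nat_const card_ord.
apply: (@leq_trans (\sum_(c < n) #|Ec c|)); first by apply: leq_sum => c _; exact: le.
under eq_bigr => c _ do rewrite -sum1_card.
rewrite (exchange_big_dep predT) //= -sum1dep_card big_mkcond /=.
rewrite [leqRHS]big_mkcond /=; apply: leq_sum => e _.
case: (pickP [pred c | e \in Ec c]) => [c /= ec|no]; last by rewrite big_pred0.
rewrite (big_pred1 c) => [|c' /=].
  by move: ec; rewrite !inE => /andP[/eqP -> ->].
move: ec; rewrite !inE => /andP[/eqP -> ->].
by rewrite andbT (inj_eq Some_inj) eq_sym.
Qed.

Lemma legal_uniq col F r s : legal col F r s (size s) -> uniq s.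
Proof.
move=> [_ l2]; apply/(uniqP r) => i j; rewrite !inE => hi hj h.
case: (ltngtP i j) => // lt; exfalso.
  by have := l2 i j; rewrite h conn0 lt hj => /(_ isT).
by have := l2 j i; rewrite h conn0 lt hi => /(_ isT).
Qed.

Lemma legal_size col F r s : legal col F r s (size s) -> size s <= #|V|.
Proof. by move=> /legal_uniq/card_uniqP <-; exact: max_card. Qed.

(** An arc that leaves the explored components extends the exploration. *)
Lemma legal_rcons col F r s c m u v : legal col F r s (size s) -> m < size s ->
  conn F (nth r s m) u -> darc (blue col c) r u v ->
  (forall l, l < size s -> ~~ conn F (nth r s l) v) ->
  legal col F r (rcons s v) (size (rcons s v)).
Proof.
move=> [l1 l2] lm cu ar nv; rewrite size_rcons.
have nt l : l < size s -> nth r (rcons s v) l = nth r s l.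
  by move=> h; rewrite nth_rcons h.
have nl : nth r (rcons s v) (size s) = v by rewrite nth_rcons ltnn eqxx.
split=> [j|p j] /andP[h1 h2].
  case: (ltngtP j (size s)) => [lt|gt|->]; [|nat_lia|].
    have [c' [u' [m' [lm' cu' ar']]]] := l1 j (introT andP (conj h1 lt)).
    exists c', u', m'; rewrite !nt //; nat_lia.
  by exists c, u, m; rewrite nl nt.
case: (ltngtP j (size s)) => [lt|gt|e]; [|nat_lia|].
  rewrite !nt; [apply: (l2 p j)| |]; nat_lia.
by rewrite e nl nt; [apply: nv|]; nat_lia.
Qed.

End Hook.

(** * Nash-Williams' theorem *)

Section NashWilliams.
Variables (G : multigraph) (n : nat).
Notation V := (vertex G).
Notation E := (edge G).

(** In a largest family of n disjoint forests, an uncovered edge is taken as the only red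
    edge; the vertices explored from it span more than n(v-1) edges, unless an
    augmentation is possible. *)
Theorem forest_cover : (forall H : subgraph G, nb_edges H <= n * (nb_vertices H - 1)) ->
  exists col : E -> option 'I_n, (forall e, col e != None) /\
    forall c, forest (blue col c).
Proof.
move=> dens.
pose P N := exists col : E -> option 'I_n,
  (forall c, forest (blue col c)) /\ N = #|[set e | col e != None]|.
have [||N [[col [fb ->]] mx]] := @max_exists P #|E|.
- exists #|[set e : E | (fun _ => None : option 'I_n) e != None]|, (fun _ => None).
  by split=> // c e x y; rewrite inE.
- by move=> _ [col [_ ->]]; exact: max_card.
exists col; split=> // e0; apply/negP => /eqP e0N.
have [r [b jrb]] := joins_ex e0.
pose F := [set e0].
have fF : forest F.
  move=> e x y; rewrite inE => /eqP -> j; rewrite setDv; apply/negP => c.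
  have := joins_neq j; rewrite (@conn_inv _ _ id set0 _ _ _ c) ?eqxx //.
  by move=> f u v; rewrite inE.
pose Q N := exists s, [/\ nth r s 0 = r, 0 < size s, legal col F r s (size s) & N = size s].
have [||L [[s [s0 sp leg ->]] mxs]] := @max_exists Q #|V|.
- exists 1, [:: r]; split=> //; split=> [j|m j] /andP[] /=; nat_lia.
- by move=> _ [s [_ _ leg ->]]; exact: legal_size leg.
have noaug (col' : E -> option 'I_n) e : (forall c, forest (blue col' c)) -> e \in F ->
    (forall f, (col' f == None) = (col f == None) && (f != e)) -> False.
  rewrite inE => fb' /eqP -> red'.
  have : P #|[set e | col' e != None]| by exists col'.
  move=> /mx; rewrite leqNgt => /negP; apply; apply: proper_card; apply/properP; split.
    by apply/subsetP => f; rewrite !inE red' negb_and => ->.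
  by exists e0; rewrite !inE ?e0N // red' eqxx andbF.
pose inH w := has (fun v => conn F v w) s.
have stage_eq w : reflect (exists2 m, m < size s & conn F (nth r s m) w) (inH w).
  apply: (iffP (has_nthP r)) => -[m]; by exists m.
pose H := [set w | inH w].
have rH : r \in H by rewrite inE; apply/stage_eq; exists 0; rewrite // s0 conn0.
have Fn e : e \in F -> col e = None by rewrite inE => /eqP ->.
have cn c w : w \in H -> conn (blue col c) w r.
  rewrite inE => /stage_eq[m lm cm]; apply: contraT => nc; exfalso.
  pose A z := ~~ conn (blue col c) z r.
  pose R j := [exists z, A z && conn F (nth r s j) z].
  have exR : exists j, R j by exists m; apply/existsP; exists w; rewrite cm /A nc.
  case: (ex_minnP exR) => j /existsP[z /andP[Az cz]] mn.
  have lj : j <= m by apply: mn; apply/existsP; exists w; rewrite cm /A nc.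
  have [|e x y ei j'|||||col' [e [j' [[_ eF _ fb'] [_ red' _ _]]]]] :=
    augmentation fF s0 (j := j) (col := col) (i := c) (A := A) (z := z) Fn fb.
  - by apply: legal_le leg; nat_lia.
  - by apply: contra; apply: conn_trans (conn1 ei j').
  - by rewrite /A conn0.
  - move=> m' v lt h; apply/negP => Av.
    suff Rm : R m' by have := mn m' Rm; rewrite leqNgt lt.
    by apply/existsP; exists v; rewrite Av h.
  - by [].
  - by [].
  exact: noaug fb' eF red'.
have cl c w v : w \in H -> darc (blue col c) r w v -> v \in H.
  rewrite !inE => /stage_eq[m lm cm] ar; apply: contraT => nv; exfalso.
  have leg' : legal col F r (rcons s v) (size (rcons s v)).
    apply: legal_rcons leg lm cm ar _ => l ll; apply: contra nv => h.
    by apply/stage_eq; exists l.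
  have : Q (size (rcons s v)).
    exists (rcons s v); split=> //; last by rewrite size_rcons.
    by rewrite nth_rcons sp.
  by move=> /mxs; rewrite size_rcons ltnn.
have bH : b \in H.
  rewrite inE; apply/stage_eq; exists 0 => //; rewrite s0.
  by apply: conn1 jrb; rewrite inE.
have H0 : H != set0 by apply/set0Pn; exists r.
pose EH := e0 |: [set e | (col e != None) && (ends e \subset H)].
have EHe e : e \in EH -> ends e \subset H.
  rewrite !inE => /orP[/eqP ->|/andP[_ //]].
  by rewrite (eqP jrb) subUset !sub1set rH bH.
have e0n : e0 \notin [set e | (col e != None) && (ends e \subset H)].
  by rewrite !inE e0N.
have := dens (Subgraph H0 EHe); rewrite /nb_edges /nb_vertices /= cardsU1 e0n.
have := blue_count fb rH cn cl; nat_lia.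
Qed.

End NashWilliams.

(** * Attaching trees and moving leaves *)

Section RedMoves.
Variables (G : multigraph) (d : nat).
Notation V := (vertex G).
Notation E := (edge G).
Implicit Types (F X : {set E}) (e f g : E) (x y z a b p q r u v w : V) (ws : seq V).

Definition indep F ws := pairwise (fun x y => ~~ conn F x y) ws.

(** Joining components in disjoint pairs: each new edge only affects the two components
    that it joins. *)
Lemma attach (L : seq (V * V * E)) F ws : forest F ->
  (forall l, l \in L -> joins l.2 l.1.1 l.1.2) ->
  indep F (flatten [seq [:: l.1.1; l.1.2] | l <- L] ++ ws) ->
  [/\ forest (F :|: [set e in [seq l.2 | l <- L]]),
   excess d (F :|: [set e in [seq l.2 | l <- L]])
     + \sum_(l <- L) ((esz F l.1.1 - d) + (esz F l.1.2 - d))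
   = excess d F + \sum_(l <- L) ((esz F l.1.1 + esz F l.1.2).+1 - d) &
   forall w, w \in ws -> esz (F :|: [set e in [seq l.2 | l <- L]]) w = esz F w].
Proof.
elim: L F => [|[[x y] e] L IH] F fF jL /=.
  move=> _; have -> : F :|: [set e in [::]] = F.
    by apply/setP => e; rewrite !inE orbF.
  by rewrite !big_nil; split.
set rest := flatten _ ++ ws => /and3P[/andP[nxy ax] ay ind].
have j : joins e x y := jL _ (mem_head _ _).
have ag w : w \in rest -> agree F (e |: F) w.
  by move=> wr; apply: (add_agree j); [exact: (allP ax)|exact: (allP ay)].
have fF' := forest_add fF j nxy.
have -> : F :|: [set f in e :: [seq l.2 | l <- L]]
        = (e |: F) :|: [set f in [seq l.2 | l <- L]].
  by apply/setP => f; rewrite !inE orbCA orbA.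
have ind' : indep (e |: F) rest.
  apply/(pairwiseP x) => i k hi hk lt.
  rewrite (agree_conn _ (ag _ (mem_nth x hi))).
  by move/(pairwiseP x): ind; apply.
have jL' l : l \in L -> joins l.2 l.1.1 l.1.2.
  by move=> lL; apply: jL; rewrite inE lL orbT.
have [f1 e1 w1] := IH (e |: F) fF' jL' ind'.
have mem l : l \in L -> (l.1.1 \in rest) /\ (l.1.2 \in rest).
  move=> lL; rewrite !mem_cat; split; apply/orP; left; apply/flattenP;
    exists [:: l.1.1; l.1.2]; rewrite ?inE ?eqxx ?orbT //; exact: (map_f (fun l => [:: l.1.1; l.1.2])).
split=> //; last first.
  move=> w ww; rewrite w1 //; apply: agree_esz; apply: ag; by rewrite mem_cat ww orbT.
rewrite !big_cons /=; have e2 := excess_add d j nxy.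
have s1 : \sum_(l <- L) ((esz (e |: F) l.1.1 - d) + (esz (e |: F) l.1.2 - d))
        = \sum_(l <- L) ((esz F l.1.1 - d) + (esz F l.1.2 - d)).
  apply: eq_big_seq => l /mem[h1 h2].
  by rewrite (agree_esz (ag _ h1)) (agree_esz (ag _ h2)).
have s2 : \sum_(l <- L) ((esz (e |: F) l.1.1 + esz (e |: F) l.1.2).+1 - d)
        = \sum_(l <- L) ((esz F l.1.1 + esz F l.1.2).+1 - d).
  apply: eq_big_seq => l /mem[h1 h2].
  by rewrite (agree_esz (ag _ h1)) (agree_esz (ag _ h2)).
move: e1 e2; rewrite s1 s2.
move: (\sum_(l <- L) _) (\sum_(l <- L) _) (excess d _) (excess d (e |: F)) (excess d F).
move: (_.+1 - d) (esz F x - d) (esz F y - d) => u1 u2 u3 S1 S2 A B C e1 e2.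
nat_lia.
Qed.

(** The leaf q, with its red edge g to p, leaves its component and is joined by e to the
    isolated vertex y. *)
Record leaf_move := LeafMove { lmg : E; lmp : V; lmq : V; lmy : V; lme : E }.
Implicit Types (m : leaf_move) (ms : seq leaf_move).

Definition move_ok F m := [/\ lmg m \in F, joins (lmg m) (lmp m) (lmq m),
  (forall f, f \in F -> lmq m \in ends f -> f = lmg m),
  esz F (lmy m) = 0 & joins (lme m) (lmq m) (lmy m)].

Definition moved F m := lme m |: (F :\ lmg m).

Section OneMove.
Variables (F : {set E}) (m : leaf_move).
Hypotheses (fF : forest F) (ok : move_ok F m) (dpos : 0 < d)
  (qy : ~~ conn F (lmq m) (lmy m)).
Let q := lmq m.  Let y := lmy m.  Let p := lmp m.  Let g := lmg m.  Let e := lme m.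
Let F0 := F :\ g.

Let jg : joins g p q. Proof. by case: ok. Qed.
Let gF : g \in F. Proof. by case: ok. Qed.
Let leaf f : f \in F -> q \in ends f -> f = g. Proof. by case: ok => _ _ h _ _; apply: h. Qed.
Let je : joins e q y. Proof. by case: ok. Qed.
Let y0 : esz F y = 0. Proof. by case: ok. Qed.

Let esz_q0 : esz F0 q = 0.
Proof.
apply/eqP; rewrite cards_eq0; apply/eqP/setP => f; rewrite [RHS]inE.
have [a [b j]] := joins_ex f; rewrite (mem_cedges _ _ j); apply/negP => /andP[fF0 c].
case/connectP: c => -[_ /= qa|w pth] /=.
  move: fF0; rewrite !inE => /andP[ne fF']; case/eqP: ne; apply: leaf => //.
  by rewrite -qa; exact: joins_in j.
case/andP => /adjacentP[f' hf' j'] _ _; move: hf'; rewrite !inE => /andP[ne hf'].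
by case/eqP: ne; apply: leaf => //; exact: joins_in j'.
Qed.

Let sub0 x z : conn F0 x z -> conn F x z.
Proof. by apply: conn_sub; exact: subsetDl. Qed.

Let y0' : esz F0 y = 0.
Proof.
apply/eqP; rewrite -leqn0 -y0; apply: subset_leq_card; apply/subsetP => f.
have [a [b j]] := joins_ex f.
rewrite !(mem_cedges _ _ j) in_setD1 => /andP[/andP[_ ->]] /=.
exact: sub0.
Qed.

Let nqy : ~~ conn F0 q y. Proof. by apply: contra qy; exact: sub0. Qed.

Lemma moved_forest : forest (moved F m).
Proof. by apply: forest_add je nqy; apply: forest_sub fF; exact: subsetDl. Qed.

(** The bound keeps track of the change at x, since losing a leaf may lower the excess. *)
Lemma moved_excess x : x != q -> x != y ->
  excess d (moved F m) + (esz F x - d) <= excess d F + (esz (moved F m) x - d).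
Proof.
move=> xq xy; have fin : ~~ conn F0 p q := fF gF jg.
have := excess_add d jg fin; rewrite (setD1K gF).
have := excess_add d je nqy; rewrite -/(moved F m) esz_q0 y0'.
have le : esz F0 x <= esz (moved F m) x.
  apply: subset_leq_card; apply/subsetP => f; have [a [b j]] := joins_ex f.
  rewrite !(mem_cedges _ _ j) in_setU1 => /andP[-> c]; rewrite orbT /=.
  by apply: conn_sub c; exact: subsetUr.
have : esz F x = esz F0 x \/ esz F x = (esz F0 x).+1 /\ esz F0 x = esz F0 p.
  rewrite -{1 2}(setD1K gF); case: (boolP (conn F0 p x)) => cp.
    rewrite -(esz_conn cp); right; split=> //.
    by rewrite -(esz_conn (add_sub g cp)) (esz_add jg fin) esz_q0 addn0.
  left; apply: agree_esz; apply: (add_agree jg) => //.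
  by apply: contra xq => /(esz0_conn esz_q0) ->.
move: (excess d _) (excess d F0) (excess d F) le => A B C.
move: (esz _ x) (esz F0 x) (esz F x) (esz F0 p) => a b c f0 h [h1|[h1 h2]] e1 e2; nat_lia.
Qed.

Lemma moved_closed x z : conn (moved F m) x z ->
  ((x == q) || (x == y)) = ((z == q) || (z == y)).
Proof.
apply: (conn_inv (c := fun x => (x == q) || (x == y))) => f a b fin j.
suff main a' b' : joins f a' b' -> (a' == q) || (a' == y) -> (b' == q) || (b' == y).
  apply/idP/idP; first exact: main.
  by apply: main; rewrite joins_sym.
move=> {}j ha; move: fin; rewrite !inE => /orP[/eqP fe|/andP[ne fF']].
  by subst f; case: (joins2 je j) => -[_ ->]; rewrite eqxx ?orbT.
exfalso; case/orP: ha => /eqP ha; subst a'.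
  by case/eqP: ne; apply: leaf => //; exact: joins_in j.
by case: (esz_eq0 y0 fF' (joins_in j)).
Qed.

Lemma moved_conn_q z : conn (moved F m) q z -> z = q \/ z = y.
Proof. by move/moved_closed; rewrite eqxx /= => /esym/orP[]/eqP; [left|right]. Qed.

Lemma moved_conn x z : x != q -> x != y -> z != q -> z != y ->
  conn (moved F m) x z = conn F x z.
Proof.
move=> xq xy zq zy; apply/idP/idP.
  suff H a b : conn (moved F m) a b -> a != q -> a != y -> conn F a b by move/H; apply.
  move=> c; elim/(@conn_ind _ (moved F m)) : c => {a b} [a _ _|f a b w fin j _ IH aq ay].
    exact: conn0.
  have fF' : f \in F.
    move: fin; rewrite !inE => /orP[/eqP fe|/andP[]//]; subst f.
    by case: (joins2 je j) => -[h _]; rewrite h eqxx in aq ay.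
  have := moved_closed (conn1 fin j); rewrite (negPf aq) (negPf ay) => /esym/negbT.
  by rewrite negb_or => /andP[bq by'] ; apply: conn_trans (conn1 fF' j) (IH _ _).
(* a path through the leaf q only passes p, q, p: contract g *)
pose pi w := if w == q then p else w.
have pn : p != q := joins_neq jg.
suff H a b : conn F a b -> conn (moved F m) (pi a) (pi b).
  by move/H; rewrite /pi (negPf xq) (negPf zq).
move=> c; elim/(@conn_ind _ F) : c => {a b} [a|f a b w fin j _ IH]; first exact: conn0.
apply: conn_trans IH; rewrite /pi; case: (eqVneq f g) => [fg|fg].
  subst f; case: (joins2 jg j) => -[-> ->]; rewrite eqxx (negPf pn); exact: conn0.
have aq : a != q.
  by apply: contra fg => /eqP aq; apply/eqP; apply: leaf => //; rewrite -aq; exact: joins_in j.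
have bq : b != q.
  apply: contra fg => /eqP bq; apply/eqP; apply: leaf => //; rewrite -bq.
  by rewrite joins_sym in j; exact: joins_in j.
rewrite (negPf aq) (negPf bq); apply: conn1 j; by rewrite !inE fg fin orbT.
Qed.

Lemma moved_cedges x : x != q -> x != y ->
  component_edges (moved F m) x \subset component_edges F x :\ g.
Proof.
move=> xq xy; apply/subsetP => f; have [a [b j]] := joins_ex f.
rewrite (mem_cedges _ _ j) in_setD1 (mem_cedges _ _ j) => /andP[fin c].
have := moved_closed c; rewrite (negPf xq) (negPf xy) => /esym/negbT.
rewrite negb_or => /andP[aq ay].
move: fin; rewrite in_setU1 in_setD1 => /orP[/eqP fe|/andP[-> ->]] /=.
  by subst f; case: (joins2 je j) => -[h _]; rewrite h eqxx in aq ay.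
by rewrite -moved_conn.
Qed.

Lemma moved_esz x : x != q -> x != y -> esz (moved F m) x + conn F x q <= esz F x.
Proof.
move=> xq xy; have le := subset_leq_card (moved_cedges xq xy).
rewrite /esz (cardsD1 g (component_edges F x)).
have -> : (g \in component_edges F x) = conn F x q.
  rewrite (mem_cedges _ _ jg) gF /=; apply/idP/idP => h; apply: (conn_trans h).
    exact: conn1 jg.
  by apply: conn1 gF _; rewrite joins_sym.
by rewrite addnC leq_add2l.
Qed.

Lemma moved_esz_q : esz (moved F m) q <= 1.
Proof. by rewrite /moved (esz_add je nqy) esz_q0 y0'. Qed.

End OneMove.

Definition move_verts ms := flatten [seq [:: lmq m; lmy m] | m <- ms].

Definition all_moved F ms := foldl moved F ms.

Lemma all_movedE F ms :
  (forall e, e \in [seq lmg m | m <- ms] -> e \notin [seq lme m | m <- ms]) ->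
  all_moved F ms = (F :\: [set g in [seq lmg m | m <- ms]]) :|: [set e in [seq lme m | m <- ms]].
Proof.
rewrite /all_moved; elim: ms F => [|m ms IH] F /= H.
  by apply/setP => f; rewrite !inE orbF.
rewrite IH; last first.
  by move=> e h; have := H e; rewrite !inE h orbT negb_or => /(_ isT)/andP[].
apply/setP => f; rewrite !inE.
case: (eqVneq f (lme m)) => [->|nf] /=; last first.
  by case: (f == lmg m); case: (f \in [seq lmg m | m <- ms]).
rewrite andbT; case: (boolP (lme m \in [seq lmg m | m <- ms])) => /= h; last by rewrite orbT.
by have := H (lme m); rewrite !inE h eqxx orbT => /(_ isT).
Qed.

(** Moves of leaves of different components do not interfere; by induction, the effect of
    one move is repeated. *)
Lemma all_moved_spec F ms : 0 < d -> forest F ->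
  (forall m, List.In m ms -> move_ok F m) -> indep F (move_verts ms) ->
  [/\ forest (all_moved F ms),
   (forall x, x \notin move_verts ms -> excess d (all_moved F ms) + (esz F x - d)
     <= excess d F + (esz (all_moved F ms) x - d)),
   (forall x z, x \notin move_verts ms -> z \notin move_verts ms ->
     conn (all_moved F ms) x z = conn F x z),
   (forall x, x \notin move_verts ms -> esz (all_moved F ms) x <= esz F x) &
   [/\ forall m, List.In m ms -> conn (all_moved F ms) (lmq m) (lmy m),
     forall m x, List.In m ms -> x \notin move_verts ms -> conn F x (lmq m) ->
       esz (all_moved F ms) x < esz F x,
     forall m x, List.In m ms -> conn (all_moved F ms) (lmq m) x -> x = lmq m \/ x = lmy m &
     forall m, List.In m ms -> esz (all_moved F ms) (lmq m) <= 1]].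
Proof.
move=> dp; elim: ms F => [|m ms IH] F fF ok /=; first by split.
rewrite /all_moved /= -/(all_moved _ _) => /and3P[/andP[nqy aq] ay ind].
have okm : move_ok F m by apply: ok; left.
have fF' := moved_forest fF okm nqy.
set F' := moved F m in fF' *.
have vq v : v \in move_verts ms -> v != lmq m.
  by move=> /(allP aq); apply: contra => /eqP ->; rewrite conn0.
have vy v : v \in move_verts ms -> v != lmy m.
  by move=> /(allP ay); apply: contra => /eqP ->; rewrite conn0.
have mq m' : List.In m' ms -> lmq m' \in move_verts ms /\ lmy m' \in move_verts ms.
  elim: (ms) => [//|m1 ms1 IH1] /= [->|/IH1]; first by rewrite !inE !eqxx !orbT.
  by rewrite !inE => -[-> ->]; rewrite !orbT.
have ind' : indep F' (move_verts ms).
  apply/(pairwiseP (lmq m)) => i k hi hk lt.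
  have mi := mem_nth (lmq m) hi; have mk := mem_nth (lmq m) hk.
  rewrite (moved_conn okm) ?vq ?vy //; by move/(pairwiseP (lmq m)): ind; apply.
have ok' m' : List.In m' ms -> move_ok F' m'.
  move=> hm; have [h1 h2 h3 h4 h5] := ok m' (or_intror hm); have [mq1 mq2] := mq m' hm.
  have ng : lmg m' != lmg m.
    have [_ j _ _ _] := okm; apply/eqP => gg; rewrite gg in h2.
    have := allP aq _ mq1; case/negP; case: (joins2 j h2) => -[_ ->]; last first.
      have [gF _ _ _ _] := okm; apply: conn1 gF _; by rewrite joins_sym.
    by rewrite conn0.
  have [_ _ _ _ je] := okm.
  split=> //.
  - by rewrite !inE ng h1 orbT.
  - move=> f; rewrite !inE => /orP[/eqP ->|/andP[_ fF1]]; last exact: h3.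
    by rewrite (eqP je) !inE (negPf (vq _ mq1)) (negPf (vy _ mq1)).
  - apply/eqP; rewrite -leqn0 -h4.
    by apply: leq_trans (moved_esz okm (vq _ mq2) (vy _ mq2)); rewrite leq_addr.
have [f1 x1 c1 s1 [q3 s2 q1 q2]] := IH F' fF' ok' ind'.
have qn : lmq m \notin move_verts ms by apply/negP => /vq; rewrite eqxx.
have yn : lmy m \notin move_verts ms by apply/negP => /vy; rewrite eqxx.
split=> //.
- move=> x; rewrite !inE !negb_or => /and3P[xq xy xv].
  have := x1 x xv; have := moved_excess fF okm dp nqy xq xy; rewrite -/F'.
  move: (excess d _) (excess d F') (excess d F) (esz _ x) (esz F' x) (esz F x).
  by move=> A B C a b c h1 h2; nat_lia.
- move=> x z; rewrite !inE !negb_or => /and3P[xq xy xv] /and3P[zq zy zv].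
  by rewrite c1 // (moved_conn okm).
- move=> x; rewrite !inE !negb_or => /and3P[xq xy xv].
  apply: leq_trans (s1 x xv) _.
  by apply: leq_trans (moved_esz okm xq xy); rewrite leq_addr.
split.
- move=> m' [<-|hm]; last exact: q3.
  rewrite c1 //; apply: conn1 (setU11 _ _) _; by case: okm.
- move=> m' x [<-|hm]; rewrite !inE !negb_or => /and3P[xq xy xv] c.
    apply: leq_ltn_trans (s1 x xv) _.
    by have := moved_esz okm xq xy; rewrite c addn1.
  have [mq1 _] := mq m' hm.
  have lt : esz (all_moved F' ms) x < esz F' x.
    by apply: (s2 m') => //; rewrite (moved_conn okm) ?(vq _ mq1) ?(vy _ mq1).
  apply: leq_trans lt _.
  by apply: leq_trans (moved_esz okm xq xy); rewrite leq_addr.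
- move=> m' x [<-|hm]; last exact: q1.
  case: (boolP (x \in move_verts ms)) => [xv|xv]; last first.
    by rewrite c1 // => /(moved_conn_q okm).
  rewrite connC => c; exfalso.
  have : exists2 m1, List.In m1 ms & x = lmq m1 \/ x = lmy m1.
    elim: (ms) xv => [//|m1 ms1 IH1]; rewrite !inE => /or3P[/eqP ->|/eqP ->|/IH1[m2 h1 h2]].
    - by exists m1; [left|left].
    - by exists m1; [left|right].
    - by exists m2; [right|].
  case=> m1 hm1 hx; have [mq1 mq2] := mq m1 hm1.
  have c2 : conn (all_moved F' ms) (lmq m1) (lmq m).
    by case: hx c => -> // c; apply: conn_trans (q3 _ hm1) _.
  by case: (q1 m1 _ hm1 c2) => h; [have := vq _ mq1|have := vq _ mq2]; rewrite h eqxx.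
- move=> m' [<-|hm]; last exact: q2.
  by apply: leq_trans (s1 _ qn) (moved_esz_q okm nqy).
Qed.

End RedMoves.

(** * A lexicographic measure, and central vertices *)

(** Sequences of digits below B, compared lexicographically; a missing digit
    counts as B - 1, so that longer sequences are smaller. *)
Fixpoint code B N (l : seq nat) :=
  if N is N'.+1 then head B.-1 l * B ^ N' + code B N' (behead l) else 0.

Lemma code_lt B N l : 0 < B -> all (fun x => x < B) l -> code B N l < B ^ N.
Proof.
move=> B0; elim: N l => [|N IH] l al //=.
have h1 : head B.-1 l <= B.-1 by case: l al => [|x l] //= /andP[]; lia.
have h2 : code B N (behead l) < B ^ N.
  by apply: IH; case: l al {h1} => [|x l] //= /andP[].
rewrite expnS; apply: (@leq_trans (B.-1 * B ^ N + B ^ N)).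
  by rewrite -addnS leq_add // leq_mul2r h1 orbT.
by rewrite -mulSnr prednK.
Qed.

Lemma code_lex B N l l' j : 0 < B -> all (fun x => x < B) l' -> j < N ->
  j < size l -> j < size l' -> (forall m, m < j -> nth 0 l' m = nth 0 l m) ->
  nth 0 l' j < nth 0 l j -> code B N l' < code B N l.
Proof.
move=> B0; elim: j N l l' => [|j IH] [|N] [|x l] [|x' l'] //=.
  move=> /andP[_ al] _ _ _ _ lt; have h := code_lt N B0 al.
  apply: (@leq_trans (x' * B ^ N + B ^ N)); first by rewrite -addnS leq_add2l.
  by rewrite -mulSnr; apply: leq_trans (leq_addr _ _); rewrite leq_mul2r lt orbT.
move=> /andP[_ al] h1 h2 h3 e lt; have := e 0 isT => /= ->; rewrite ltn_add2l.
by apply: (IH N l l') => // m hm; exact: (e m.+1).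
Qed.

(** The new digit is smaller than the default B - 1 that it replaces. *)
Lemma code_rcons B N l x : 0 < B -> size l < N -> x < B.-1 ->
  code B N (rcons l x) < code B N l.
Proof.
move=> B0; elim: N l => [//|N IH] [|y l] /= h lt; last by rewrite ltn_add2l IH.
have := code_lt N B0 (isT : all (fun x => x < B) [::]).
have -> : code B N [::] = code B N (behead [::]) by [].
move=> _; rewrite ltn_add2r ltn_mul2r lt andbT expn_gt0 B0 //.
Qed.

Section Central.
Variables (G : multigraph) (d : nat).
Notation V := (vertex G).
Notation E := (edge G).
Implicit Types (F X : {set E}) (e f g : E) (x y z a b p q r u v w : V).

Lemma excess0_le F x : excess d F = 0 -> esz F x <= d.
Proof.
move/eqP; rewrite /excess sum_nat_eq0 => /forallP/(_ (component F x))/implyP.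
rewrite imset_f // => /(_ isT); by rewrite subn_eq0.
Qed.

Lemma excess_gt0 F : 0 < excess d F -> exists x, d < esz F x.
Proof.
move=> h; apply: NNPP => no; move: h; rewrite lt0n => /eqP; apply.
rewrite /excess big1 // => C /imsetP[x _ ->]; apply/eqP; rewrite subn_eq0 leqNgt.
by apply/negP => lt; apply: no; exists x.
Qed.

(** An exchange at the root component removes one of its edges and attaches a small tree
    to the part without r. The excess then goes down if the part that keeps r has more
    edges than the small tree, which has at most one edge, and none unless d >= 3. *)
Definition central F r := forall e x, e \in F -> x \in ends e -> conn F r x ->
  (if d < 3 then 1 else 2) <= esz (F :\ e) r.

Lemma esz_ge2 F e f x : e != f -> e \in component_edges F x ->
  f \in component_edges F x -> 1 < esz F x.
Proof.
move=> ne h1 h2; have <- : #|[set e; f]| = 2 by rewrite cards2 ne.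
by apply: subset_leq_card; apply/subsetP => z; rewrite !inE => /orP[]/eqP ->;
  rewrite -?(in_set (fun e => (e \in F) && (ends e \subset component F x))).
Qed.

Lemma conn_first F x y : conn F x y -> x != y -> exists f w, f \in F /\ joins f x w.
Proof.
case/connectP => -[|w p] /=; first by move=> _ ->; rewrite eqxx.
by case/andP => /adjacentP[f fF j] _ _ _; exists f, w.
Qed.

Lemma esz_edge F x : 0 < esz F x -> exists f w, f \in F /\ joins f x w.
Proof.
rewrite card_gt0 => /set0Pn[f hf]; have [a [b j]] := joins_ex f.
move: hf; rewrite (mem_cedges _ _ j) => /andP[fF c].
case: (eqVneq x a) => [->|ne]; first by exists f, b.
exact: conn_first c ne.
Qed.

(** If x is cut off by e with too few edges, try the other end of e, and so on. Two cuts
    with few edges on the near sides cannot face each other in a component with more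
    than d edges; since the pieces have at most one edge, three attempts are enough. *)
Lemma central_ex F x : 0 < d -> forest F -> d < esz F x ->
  exists r, conn F x r /\ central F r.
Proof.
move=> d0 fF big; apply: NNPP => no.
pose k := if d < 3 then 1 else 2.
have Ebig : 2 * k <= esz F x by rewrite /k; case: ifP; lia.
have k12 : k = 1 \/ k = 2 by rewrite /k; case: ifP; [left|right].
(* every vertex of the component is cut off with too few edges *)
have bad r : conn F x r -> exists e a b, [/\ e \in F, joins e a b, conn F x a,
    conn (F :\ e) r a & esz (F :\ e) a < k].
  move=> c; apply: NNPP => nb; apply: no; exists r; split=> // e y eF ye cy.
  rewrite leqNgt; apply/negP => lt; apply: nb.
  have [z j] := ends_joins ye.
  suff [a [b [jab ca cra]]] : exists a b, [/\ joins e a b, conn F x a & conn (F :\ e) r a].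
    by exists e, a, b; split=> //; rewrite -(esz_conn cra).
  have cxy := conn_trans c cy.
  case: (conn_rem eF j cy) => [h|[h _]|[h _]].
  - by exists y, z.
  - by exists y, z.
  - exists z, y; split=> //; first by rewrite joins_sym.
    exact: conn_trans cxy (conn1 eF j).
have cut e a b : e \in F -> joins e a b -> conn F x a ->
    esz F x = (esz (F :\ e) a + esz (F :\ e) b).+1.
  move=> eF j c; rewrite (esz_conn c); apply: cut_esz => //; first exact: conn1 eF j.
  exact: fF eF j.
have [e [a [b [eF j ca _ lt]]]] := bad x (conn0 _ _).
have cb : conn F x b := conn_trans ca (conn1 eF j).
have Eab := cut e a b eF j ca.
have jba : joins e b a by rewrite joins_sym.
have [e' [a' [b' [eF' j' ca' cba lt']]]] := bad b cb.
case: (eqVneq e' e) => [ee|ne].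
  by subst e'; rewrite -(esz_conn cba) in lt'; nat_lia.
have een : e != e' by rewrite eq_sym.
have eF1 : e \in F :\ e' by rewrite !inE een.
have b1 : 0 < esz (F :\ e') b := esz_gt0 eF1 (joins_in jba).
rewrite -(esz_conn cba) in lt'.
have k2 : k = 2 by case: k12 => // k1; rewrite k1 in lt'; nat_lia.
rewrite k2 in lt lt' Ebig.
have ein : e \in component_edges (F :\ e') b by rewrite (mem_cedges _ _ jba) eF1 conn0.
have only f w : f \in F -> f != e' -> joins f b w -> f = e.
  move=> fF1 fe' jf; apply/eqP; apply: contraLR lt' => fe; rewrite -leqNgt.
  by apply: (esz_ge2 fe) => //; rewrite (mem_cedges _ _ jf) !inE fe' fF1 conn0.
have Eab' := cut e' a' b' eF' j' ca'.
case: (eqVneq a' b) => [ab|nab].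
  subst a'; have cb' : conn F x b' := conn_trans ca' (conn1 eF' j').
  have jb' : joins e' b' b by rewrite joins_sym.
  have [e2 [a2 [b2 [eF2 j2 _ cb2 lt2]]]] := bad b' cb'.
  rewrite -(esz_conn cb2) k2 in lt2.
  case: (eqVneq e2 e') => [ee|ne1]; first by rewrite ee in lt2; nat_lia.
  case: (eqVneq e2 e) => [ee|ne2].
    rewrite ee in lt2.
    have c : conn (F :\ e) b' b by apply: conn1 jb'; rewrite !inE ne.
    by rewrite (esz_conn c) in lt2; nat_lia.
  suff : 1 < esz (F :\ e2) b' by rewrite ltnNge -ltnS lt2.
  have in1 : e' \in F :\ e2 by rewrite !inE eq_sym ne1.
  apply: (esz_ge2 ne); first by rewrite (mem_cedges _ _ jb') in1 conn0.
  rewrite (mem_cedges _ _ jba) !inE eq_sym ne2 eF /=; exact: conn1 in1 jb'.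
have aa : a' = a.
  rewrite connC in cba; have [f [w [fin jf]]] := conn_first cba nab.
  have fe : f = e.
    apply/eqP; apply: contraLR lt' => fe; rewrite -leqNgt.
    by apply: (esz_ge2 fe) => //; rewrite (mem_cedges _ _ jf) fin connC.
  subst f; case: (joins2 j jf) => -[h _] //; by rewrite h eqxx in nab.
subst a'.
have b0 : esz (F :\ e) b = 0.
  apply/eqP; rewrite -leqn0 leqNgt; apply/negP => /esz_edge[f [w [fin jf]]].
  move: fin; rewrite !inE => /andP[fe fF1].
  case: (eqVneq f e') => [ff|nf]; last by rewrite (only f w) ?eqxx in fe.
  subst f; case: (joins2 j' jf) => -[h1 h2]; first by have := joins_neq j; rewrite h1 eqxx.
  case/negP: (fF e a b eF j); apply: conn1 (_ : e' \in _) _; first by rewrite !inE ne.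
  by rewrite h1.
by nat_lia.
Qed.

End Central.

(** * Minimal colourings *)

Section States.
Variables (G : multigraph) (k d : nat).
Notation V := (vertex G).
Notation E := (edge G).
Implicit Types (F X : {set E}) (e f g : E) (x y z a b p q r u v w : V).
Implicit Types (col : E -> option 'I_k) (i c : 'I_k) (s : seq V).

Definition state_ok col r s :=
  [/\ forall c, forest (blue col c), forest (red col), d < esz (red col) r,
    central d (red col) r &
    [/\ nth r s 0 = r, 0 < size s & legal col (red col) r s (size s)]].

Definition base := #|E|.+3.

(** The excess weighs more than any exploration. *)
Definition meas col s :=
  excess d (red col) * base ^ #|V| + code base #|V| [seq esz (red col) v | v <- s].

Lemma esz_base F x : esz F x < base.
Proof. by rewrite /base ltnS; apply: leq_trans (max_card _) _; rewrite -addn2 leq_addr. Qed.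

Lemma all_base F s : all (fun m => m < base) [seq esz F v | v <- s].
Proof. by apply/allP => n /mapP[v _ ->]; exact: esz_base. Qed.

Lemma legal_ext col F r s s' J : (forall m, m < J -> nth r s m = nth r s' m) ->
  legal col F r s J -> legal col F r s' J.
Proof.
move=> h [l1 l2]; split=> [j|m j] /andP[h1 h2].
  have [c [u [m [lm cu ar]]]] := l1 j (introT andP (conj h1 h2)).
  exists c, u, m; rewrite -!h //; exact: ltn_trans lm h2.
rewrite -!h //; last exact: ltn_trans h1 h2.
by apply: l2; rewrite h1.
Qed.

Lemma legal1 col F r s : legal col F r s 1.
Proof. by split=> [j|m j] /andP[] /=; lia. Qed.

Lemma excess_rem F e a b : forest F -> e \in F -> joins e a b ->
  excess d (F :\ e) <= excess d F /\
  (d < esz F a -> excess d (F :\ e) < excess d F).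
Proof.
move=> fF eF j; have nc := fF e a b eF j; have c := conn1 eF j.
have := cut_excess d fF eF c nc; have := cut_esz fF eF c nc.
move: (excess d _) (excess d F) (esz _ a) (esz _ b) (esz F a) => A B na nb n h1 h2.
by split=> [|h]; nat_lia.
Qed.

Lemma esz_rem F e a b x : e \in F -> joins e a b -> conn F x a ->
  esz (F :\ e) x < esz F x.
Proof.
move=> eF j c; apply: proper_card; apply/properP; split.
  apply/subsetP => f; have [y [z jf]] := joins_ex f.
  rewrite !(mem_cedges _ _ jf) in_setD1 => /andP[/andP[_ ->]] /=.
  by apply: conn_sub; exact: subsetDl.
by exists e; rewrite (mem_cedges _ _ j) ?eF ?in_setD1 ?eqxx.
Qed.

Lemma agree_trans F1 F2 F3 x : agree F1 F2 x -> agree F2 F3 x -> agree F1 F3 x.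
Proof.
move=> h1 h2 e y c ye; rewrite (h2 e y) //; first exact: h1 c ye.
by rewrite (agree_conn _ h1).
Qed.

Lemma agree_rem F e x y : y \in ends e -> e \in F -> ~~ conn F x y -> agree F (F :\ e) x.
Proof.
move=> ye eF nc f z c zf; rewrite in_setD1; case: (eqVneq f e) => //= fe; subst f.
exfalso; case/negP: nc; apply: conn_trans c _.
have [w j] := ends_joins ye; rewrite (eqP j) !inE in zf.
by case/orP: zf => /eqP ->; [exact: conn0|rewrite connC; exact: conn1 eF j].
Qed.

Lemma agree_D1 F F' e x : agree F F' x -> agree (F :\ e) (F' :\ e) x.
Proof.
move=> h f y c yf; rewrite !in_setD1 (h f y) //.
by apply: conn_sub c; exact: subsetDl.
Qed.

Lemma agree_central F F' r : agree F F' r -> central d F r -> central d F' r.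
Proof.
move=> h cn e x eF xe c; rewrite (agree_esz (@agree_D1 _ _ e _ h)).
rewrite (agree_conn _ h) in c; apply: (cn e x) => //.
by rewrite -(h e x).
Qed.

Section Minimal.
Variables (col : E -> option 'I_k) (r : V) (s : seq V).
Let F := red col.
Hypotheses (d0 : 0 < d) (ok : state_ok col r s).
Hypothesis nogood : forall col', (forall c, forest (blue col' c)) -> forest (red col') ->
  0 < excess d (red col').
Hypothesis minimal : forall col' r' s', state_ok col' r' s' -> meas col s <= meas col' s'.

Lemma ok_blue c : forest (blue col c). Proof. by case: ok. Qed.
Lemma ok_red : forest F. Proof. by case: ok. Qed.
Lemma ok_root : nth r s 0 = r. Proof. by case: ok => _ _ _ _ []. Qed.
Lemma ok_pos : 0 < size s. Proof. by case: ok => _ _ _ _ []. Qed.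
Lemma ok_legal : legal col F r s (size s). Proof. by case: ok => _ _ _ _ []. Qed.
Lemma ok_big : d < esz F r. Proof. by case: ok. Qed.
Lemma ok_central : central d F r. Proof. by case: ok. Qed.

(** A smaller excess would allow to start again from any root. *)
Lemma improve_excess col' : (forall c, forest (blue col' c)) -> forest (red col') ->
  excess d F <= excess d (red col').
Proof.
move=> fB' fF'; rewrite leqNgt; apply/negP => lt.
have [x xbig] := excess_gt0 (nogood fB' fF').
have [r' [cr cen]] := central_ex d0 fF' xbig.
have ok' : state_ok col' r' [:: r'].
  by split=> //; [rewrite -(esz_conn cr)|split=> //; exact: legal1].
have := minimal ok'; rewrite leqNgt => /negP; apply.
have cl := code_lt #|V| (isT : 0 < base) (all_base (red col') [:: r']).
apply: (@leq_trans ((excess d (red col')).+1 * base ^ #|V|)).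
  by rewrite mulSnr /meas ltn_add2l.
by apply: leq_trans (leq_addr _ _); rewrite leq_mul2r lt orbT.
Qed.

(** If the components before the j-th are kept and the j-th gets smaller, cutting the
    exploration off after it gives a smaller state. *)
Lemma improve_lex col' j : (forall c, forest (blue col' c)) -> forest (red col') ->
  0 < j < size s -> legal col' (red col') r s j.+1 ->
  excess d (red col') <= excess d F ->
  (forall m, m < j -> agree F (red col') (nth r s m)) ->
  esz F (nth r s j) <= esz (red col') (nth r s j).
Proof.
move=> fB' fF' /andP[j0 js] leg le ag; rewrite leqNgt; apply/negP => lt.
have agr : agree F (red col') r by rewrite -ok_root; apply: ag.
have st : size (take j.+1 s) = j.+1 by rewrite size_takel.
have nt m : m <= j -> nth r (take j.+1 s) m = nth r s m.
  by move=> h; rewrite nth_take.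
have ok' : state_ok col' r (take j.+1 s).
  split=> //; first by rewrite (agree_esz agr) ok_big.
    exact: agree_central agr ok_central.
  split; rewrite ?st ?nt ?ok_root //.
  by apply: legal_ext leg => m h; rewrite nt.
have := minimal ok'; rewrite leqNgt => /negP; apply; rewrite /meas -addnS.
apply: leq_add; first by rewrite leq_mul2r le orbT.
apply: (@code_lex _ _ _ _ j) => //.
- exact: all_base.
- exact: leq_trans js (legal_size ok_legal).
- by rewrite size_map.
- by rewrite size_map st.
- move=> m mj; rewrite !(nth_map r) ?st ?(ltn_trans mj js) ?(ltn_trans mj) //.
  by rewrite nt ?(ltnW mj) // (agree_esz (ag m mj)).
- by rewrite !(nth_map r) ?st // nt.
Qed.

Lemma s_sep m j w : m < j < size s -> conn F (nth r s m) w -> ~~ conn F (nth r s j) w.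
Proof.
move=> h c; apply: contra (ok_legal.2 m j h) => c'.
by apply: conn_trans c _; rewrite connC.
Qed.

(** An augmentation removes a red edge from the first component meeting A or from an
    earlier one, which makes the state smaller. Hence none is possible, even after a change
    of colours that does not increase the excess and keeps the earlier components. *)
Lemma no_augment col1 i j (A : pred V) z :
  (forall c, forest (blue col1 c)) -> forest (red col1) ->
  excess d (red col1) <= excess d F -> j < size s ->
  legal col1 (red col1) r s j.+1 ->
  (forall e x y, e \in blue col1 i -> joins e x y -> A x -> A y) -> ~~ A r ->
  (forall m w, m < j -> conn (red col1) (nth r s m) w -> ~~ A w) ->
  A z -> conn (red col1) (nth r s j) z ->
  (forall m, m < j -> agree F (red col1) (nth r s m)) ->
  A (nth r s j) \/ agree F (red col1) (nth r s j) -> False.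
Proof.
set F1 := red col1; move=> fB1 fF1 le js leg noc nAr pre Az cz ag agj.
have F1n e : e \in F1 -> col1 e = None by rewrite inE => /eqP.
have [col' [e0 [j' [[lej eF [x xe cx] fB'] [leg' red' h1 h2]]]]] :=
  augmentation fF1 ok_root F1n fB1 leg noc nAr pre Az cz.
have agj' : agree F F1 (nth r s j').
  case: agj => [Aj|agj]; first by apply: ag; exact: h1.
  by case: (ltngtP j' j) lej => [lt|//|->] // _; exact: ag.
have F'E : red col' = F1 :\ e0.
  by apply/setP => e; rewrite !inE red' andbC.
have fF' : forest (red col') by rewrite F'E; apply: forest_sub fF1; exact: subsetDl.
have [y jxy] := ends_joins xe.
have [ex1 ex2] := excess_rem fF1 eF jxy.
have js' : j' < size s by exact: leq_ltn_trans lej js.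
case: (posnP j') => [z0|pos].
  have := improve_excess fB' fF'; rewrite leqNgt F'E => /negP; apply.
  apply: leq_trans le; apply: ex2; rewrite -(esz_conn cx) (agree_esz agj') z0 ok_root.
  exact: ok_big.
have agm m : m < j' -> agree F (red col') (nth r s m).
  move=> mj; have agm : agree F F1 (nth r s m).
    by apply: ag; exact: leq_trans mj lej.
  apply: (agree_trans agm); rewrite F'E; apply: (agree_rem xe eF).
  rewrite (agree_conn _ agm); apply/negP => c.
  rewrite (agree_conn _ agj') in cx.
  have h : m < j' < size s by rewrite mj.
  by have := s_sep h c; rewrite cx.
have leg2 : legal col' (red col') r s j'.+1.
  case: leg' => l1 l2; split=> [l hl|m l hl].
    have [c [u [m [lm cu ar]]]] := l1 l hl; exists c, u, m; split=> //.
    have mj : m < j' by case/andP: hl => _ hl; rewrite ltnS in hl; exact: leq_trans lm hl.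
    have agF : agree F F1 (nth r s m) by apply: ag; exact: leq_trans mj lej.
    by rewrite (agree_conn _ (agm m mj)) -(agree_conn _ agF).
  apply: contra (l2 m l hl); rewrite F'E; apply: conn_sub; exact: subsetDl.
have ex3 : excess d (red col') <= excess d F by rewrite F'E; exact: leq_trans ex1 le.
have := improve_lex fB' fF' (introT andP (conj pos js')) leg2 ex3 agm.
rewrite leqNgt => /negP; apply; rewrite F'E.
by apply: leq_trans (esz_rem eF jxy cx) _; rewrite (agree_esz agj').
Qed.

(** The index of the explored component of z, or the size of s. *)
Definition stage_of z := find (fun v => conn F v z) s.
Definition explored_in z := stage_of z < size s.

Lemma stage_eq z m : m < size s -> conn F (nth r s m) z -> stage_of z = m.
Proof.
move=> hm c; have le : stage_of z <= m.
  by rewrite leqNgt; apply/negP => /(before_find r); rewrite c.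
have hz : explored_in z := leq_ltn_trans le hm.
have cz : conn F (nth r s (stage_of z)) z.
  by move: hz; rewrite /explored_in -has_find => /(nth_find r).
case: (ltngtP (stage_of z) m) le => // lt _.
by have := s_sep (introT andP (conj lt hm)) cz; rewrite c.
Qed.

Lemma stage_conn z : explored_in z -> conn F (nth r s (stage_of z)) z.
Proof. by rewrite /explored_in -has_find => /(nth_find r). Qed.

Lemma conn_stage x z : conn F x z -> stage_of x = stage_of z.
Proof.
move=> c; apply: eq_find => v; apply/idP/idP => h; first exact: conn_trans h c.
by apply: conn_trans h _; rewrite connC.
Qed.

Lemma stage_nth m : m < size s -> stage_of (nth r s m) = m.
Proof. by move=> h; apply: stage_eq => //; exact: conn0. Qed.

Lemma stage_root : stage_of r = 0.
Proof. by rewrite -{1}ok_root stage_nth // ok_pos. Qed.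

Lemma same_stage x z : explored_in x -> stage_of x = stage_of z -> conn F x z.
Proof.
move=> hx e; have hz : explored_in z by rewrite /explored_in -e.
apply: (conn_trans (y := nth r s (stage_of x))); first by rewrite connC; exact: stage_conn.
by rewrite e; exact: stage_conn.
Qed.

(** Otherwise A, the set of vertices that the i-th forest does not join to r, could be
    used for an augmentation. *)
Lemma explored_conn i z : explored_in z -> conn (blue col i) z r.
Proof.
move=> hz; apply: contraT => nc; exfalso.
pose A w := ~~ conn (blue col i) w r.
pose R j := [exists w, A w && (explored_in w && (stage_of w == j))].
have exR : exists j, R j by exists (stage_of z); apply/existsP; exists z; rewrite /A nc hz eqxx.
case: (ex_minnP exR) => j /existsP[w /and3P[Aw hw /eqP ej]] mn.
have js : j < size s by rewrite -ej.
apply: (@no_augment col i j A w) => //.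
- exact: ok_blue.
- exact: ok_red.
- exact: legal_le js ok_legal.
- by move=> e x y ei j'; apply: contra; apply: conn_trans (conn1 ei j').
- by rewrite /A conn0.
- move=> m v mj c; apply/negP => Av.
  have hm : m < size s := ltn_trans mj js.
  have := mn m; rewrite leqNgt mj => H; suff Rm : R m by have := H Rm.
  by apply/existsP; exists v; rewrite Av /explored_in (stage_eq hm c) hm eqxx.
- by rewrite -ej; exact: stage_conn.
- by right=> e y.
Qed.

(** Otherwise the exploration could be extended, which makes the state smaller. *)
Lemma explored_closed i u v : explored_in u -> darc (blue col i) r u v -> explored_in v.
Proof.
move=> hu ar; apply: contraT => nv; exfalso.
have leg := legal_rcons ok_legal hu (stage_conn hu) ar.
have h : forall l, l < size s -> ~~ conn F (nth r s l) v.
  by move=> l hl; apply: contra nv => c; rewrite /explored_in (stage_eq hl c).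
have {leg h} leg := leg h.
have ok' : state_ok col r (rcons s v).
  split; [exact: ok_blue|exact: ok_red|exact: ok_big|exact: ok_central|split=> //].
    by rewrite nth_rcons ok_pos ok_root.
  by rewrite size_rcons.
have := minimal ok'; rewrite leqNgt => /negP; apply.
rewrite /meas map_rcons ltn_add2l; apply: code_rcons => //.
  by rewrite size_map -ltnS -(size_rcons s v) ltnS; apply: leq_trans (legal_size leg); rewrite size_rcons.
rewrite /base /= ltnS; apply: leq_trans (max_card _) _; exact: leqnSn.
Qed.

End Minimal.
End States.

(** * Exchanging small components *)

(** The items exchanged below are records without a boolean equality; membership in
    a list of them is [List.In]. *)
Lemma mem_mapP (A : Type) (B : eqType) (f : A -> B) (l : seq A) y :
  y \in [seq f a | a <- l] <-> exists a, List.In a l /\ y = f a.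
Proof.
elim: l => [|a l IH] /=; first by split=> // -[a []].
rewrite inE; split=> [/orP[/eqP->|/IH[b [h1 h2]]]|[b [[<-|h1] e]]].
- by exists a; split=> //; left.
- by exists b; split=> //; right.
- by rewrite e eqxx.
- by apply/orP; right; apply/IH; exists b.
Qed.

Lemma hasInP (A : Type) (P : pred A) (l : seq A) : has P l <-> exists a, List.In a l /\ P a.
Proof.
elim: l => [|a l IH] /=; first by split=> // -[a []].
split=> [/orP[h|/IH[b [h1 h2]]]|[b [[<-|h1] h2]]].
- by exists a; split=> //; left.
- by exists b; split=> //; right.
- by rewrite h2.
- by apply/orP; right; apply/IH; exists b.
Qed.

Lemma count_ltIn (A : Type) (P Q : pred A) (l : seq A) a :
  (forall b, List.In b l -> P b -> Q b) -> List.In a l -> Q a -> ~~ P a ->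
  count P l < count Q l.
Proof.
have le (l' : seq A) : (forall b, List.In b l' -> P b -> Q b) -> count P l' <= count Q l'.
  elim: l' => [//|b l' IH] /= h; apply: leq_add; last by apply: IH => c hc; apply: h; right.
  by case p: (P b) => //; rewrite (h b) //; left.
elim: l => [//|b l IH] /= h [<-|ha] qa npa.
  rewrite qa (negPf npa) add0n add1n ltnS; apply: le => c hc; apply: h; by right.
rewrite -addnS; apply: leq_add; last by apply: IH => // c hc; apply: h; right.
by case p: (P b) => //; rewrite (h b) //; left.
Qed.

Lemma count_leIn (A : Type) (P Q : pred A) (l : seq A) :
  (forall b, List.In b l -> P b -> Q b) -> count P l <= count Q l.
Proof.
elim: l => [//|b l IH] /= h; apply: leq_add; last by apply: IH => c hc; apply: h; right.
by case p: (P b) => //; rewrite (h b) //; left.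
Qed.

Lemma allIn (A : Type) (P : pred A) (l : seq A) a : all P l -> List.In a l -> P a.
Proof. by elim: l => [//|b l IH] /= /andP[pb al] [<-|/(IH al)]. Qed.

Lemma pairwiseIn (A : Type) (P : rel A) (l : seq A) a b : pairwise P l ->
  List.In a l -> List.In b l -> [\/ a = b, P a b | P b a].
Proof.
elim: l => [//|c l IH] /= /andP[al pl] [<-|ha] [<-|hb]; first by constructor 1.
- by constructor 2; exact: allIn al hb.
- by constructor 3; exact: allIn al ha.
- exact: IH.
Qed.

(** Each truncated difference doubles the work of [lia], and the identities on the
    excess are linear in them: they are made unknowns. *)
Ltac abstract_subn := repeat match goal with
  |- context [subn ?a ?b] => move: (subn a b) => ? end.

Lemma blob_arith d E b b' : 0 < d -> b' <= b -> b <= 1 ->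
  b' - d = 0 /\ (E + b').+1 - d <= (E + b).+1 - d.
Proof. by move=> *; split; nat_lia. Qed.

(** Here h vertices span q red and b blue edges, e0 is the size of the root component, S
    the total size of the t others; the conclusion is that the sparsity of the spanned
    subgraph is violated, by exactly 1 in the extremal case. *)
Lemma density_arith k d S e0 h m b q t : k * (h - 1) <= b -> e0 + S <= q ->
  h = e0 + S + t.+1 -> b + q = m -> d < e0 -> t * d <= (k + 1) * S ->
  (k + 1) * (k + d) * h < (k + d + 1) * m + k ^ 2.
Proof.
move=> h1 h2 h3 h4 h5 h6.
have h8 : k * (e0 + S + t) + (e0 + S) <= m.
  by rewrite -h4 leq_add //; apply: leq_trans h1; rewrite h3 leq_mul2l; nat_lia.
apply: (@leq_trans ((k + d + 1) * (k * (e0 + S + t) + (e0 + S)) + k ^ 2)); last first.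
  by rewrite leq_add2r leq_mul2l h8 orbT.
by rewrite h3 -mulnn; clear - h5 h6; nia.
Qed.

Section Items.
Variables (G : multigraph) (k d : nat).
Notation V := (vertex G).
Notation E := (edge G).
Implicit Types (X : {set E}) (e f g : E) (x y z a b p q u v w : V).

Variables (col : E -> option 'I_k) (r : V) (s : seq V).
Let F := red col.
Hypotheses (d0 : 0 < d) (ok : state_ok d col r s).
Hypothesis nogood : forall col' : E -> option 'I_k,
  (forall c, forest (blue col' c)) -> forest (red col') -> 0 < excess d (red col').
Hypothesis minimal : forall (col' : E -> option 'I_k) r' s',
  state_ok d col' r' s' -> meas d col s <= meas d col' s'.
Variables (ph : 'I_k -> V -> V) (ta : 'I_k -> E -> V) (mu : 'I_k -> V -> nat).
Hypothesis rt : forall i, rooted (blue col i) r (ph i) (ta i) (mu i).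

Notation stage := (stage_of col s).
Notation explored := (explored_in col s).

Let fF := ok_red ok.
Let fB := ok_blue ok.
Let s_root := ok_root ok.
Let s_pos := ok_pos ok.
Let s_legal := ok_legal ok.
Let Hc := explored_conn d0 ok nogood minimal.

Definition desc i z x := fconnect (ph i) z x.

Lemma desc_step i z x : desc i z x -> z = x \/ desc i (ph i z) x.
Proof.
case/connectP => -[|w t] /=; first by move=> _ ->; left.
by case/andP=> /eqP <- pp ->; right; apply/connectP; exists t.
Qed.

Lemma desc_le i z x : desc i z x -> mu i x <= mu i z.
Proof.
case/connectP => t; elim: t z => [|w t IH] z /=; first by move=> _ ->.
case/andP=> /eqP <- pp e; apply: leq_trans (IH _ pp e) _.
by case: (eqVneq (ph i z) z) => [->//|/(rt_decr (rt i))/ltnW].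
Qed.

Lemma desc_parent i z x : ph i z = x -> desc i z x.
Proof. by move=> <-; exact: fconnect1. Qed.

Lemma desc_trans i y x z : desc i x y -> desc i y z -> desc i x z.
Proof. exact: connect_trans. Qed.

Lemma desc_r i x : desc i r x -> x = r.
Proof.
case/connectP => t; elim: t => [|w t IH] /=; first by move=> _ ->.
by case/andP=> /eqP; rewrite (rt_root (rt i)) => <-.
Qed.

Lemma explored_fix i z : explored z -> ph i z = z -> z = r.
Proof. by move=> hz; apply: (rt_uniq (rt i)); exact: Hc. Qed.

Lemma explored_parent i z : explored z -> explored (ph i z).
Proof.
move=> hz; case: (eqVneq (ph i z) z) => [->//|nz].
apply: (explored_closed ok minimal (i := i) hz).
apply: (@pgraph_darc _ _ (ph i) (mu i) r (fun z => conn (blue col i) z r)) => //.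
- exact: rt_decr (rt i).
- move=> w cw nw; split; first exact: rooted_conn (rt i) cw nw.
  exact: rt_edge (rt i) nw.
- exact: rt_uniq (rt i).
- exact: Hc.
Qed.

(** Entry arcs survive a modification of the i-th blue forest as long as, from the
    tails of these arcs, the parent pointers still lead to r. *)
Lemma legal_keep i (phi1 : V -> V) (mu1 : V -> nat) X1 col1 (W : pred V) J :
  J < size s -> decr phi1 mu1 ->
  (forall z, W z -> phi1 z != z -> W (phi1 z) /\ exists2 e, e \in X1 & joins e z (phi1 z)) ->
  (forall z, W z -> phi1 z = z -> z = r) ->
  (forall u l, l <= J -> explored u -> stage u < J -> ph i u = nth r s l -> W u /\ phi1 u = ph i u) ->
  X1 \subset blue col1 i -> (forall c, c != i -> blue col1 c = blue col c) ->
  (forall m, m < J -> agree F (red col1) (nth r s m)) ->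
  legal col1 (red col1) r s J.+1.
Proof.
move=> Js D cl fx keep sub oth ag; split=> [l hl|m l hl]; last first.
  have mJ : m < J by nat_lia.
  rewrite (agree_conn _ (ag m mJ)); apply: s_legal.2; nat_lia.
have ls : 0 < l < size s by nat_lia.
have [c [u [m [lm cu ar]]]] := s_legal.1 l ls.
have mJ : m < J by nat_lia.
have ms : m < size s by nat_lia.
exists c, u, m; split=> //; first by rewrite (agree_conn _ (ag m mJ)).
case: (eqVneq c i) => [ci|ci]; last by rewrite oth.
subst c; have pu := darc_parent (@fB i) (rt i) ar.
have iu : stage u = m := stage_eq ok ms cu.
have lJ : l <= J by nat_lia.
have [Wu e] : W u /\ phi1 u = ph i u.
  by apply: (keep u l); rewrite /explored_in ?iu.
apply: (darc_sub sub); rewrite -pu -e.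
apply: (pgraph_darc D cl fx Wu); rewrite e pu.
have [e0 [_ j _]] := ar; rewrite eq_sym; exact: joins_neq j.
Qed.

(** An item is one way of enlarging a red component at [src] by a small
    blob: the blue edge [via] from [src] to its parent [tgt] becomes red. Either
    [tgt] lies in a small component, or [tgt] is a leaf that first leaves its own
    component by a leaf move; the red edge of that leaf becomes blue. *)
Record item := Item { src : V; tgt : V; via : E; move_of : option (leaf_move G) }.
Implicit Types (Z : seq item).

(** In the virtual case, the last clause holds because the arc from the leaf to its
    isolated child is itself an item, whose exchange has to be early. It will imply that
    the cut-off part meets another component before that of the leaf, or contains the
    entry vertex of the latter. *)
Definition item_ok i (t : item) :=
  [/\ explored (src t), src t != r, ph i (src t) = tgt t, via t \in blue col i & ta i (via t) = src t] /\
  match move_of t with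
  | None => esz F (tgt t) <= 1 /\ stage (src t) < stage (tgt t)
  | Some m => [/\ lmq m = tgt t, move_ok F m, lme m \in blue col i,
      ta i (lme m) = tgt t & ph i (tgt t) = lmy m] /\
      [/\ desc i (lmp m) (src t), stage (tgt t) < stage (lmy m) &
        (forall z, explored z -> desc i z (tgt t) -> stage (tgt t) <= stage z) ->
        desc i (nth r s (stage (tgt t))) (tgt t)]
  end.

(** The vertex whose descendants the item cuts off from r. *)
Definition top t := if move_of t is Some _ then tgt t else src t.

Section Exchange.
Variables (i : 'I_k) (Z : seq item) (K : nat).
Hypothesis Zok : forall t, List.In t Z -> item_ok i t.
Hypothesis Zsrc : forall t t', List.In t Z -> List.In t' Z -> move_of t' ->
  src t != tgt t'.
Hypothesis ZK : forall t, List.In t Z -> stage (src t) = K.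

Definition moves := pmap move_of Z.
Definition cut_off z := has (fun t => desc i z (top t)) Z.
Definition outs := [seq via t | t <- Z] ++ [seq lme m | m <- moves].
Definition ins := [seq lmg m | m <- moves].

(** The sources become roots and every moved leaf points to its red neighbour. *)
Definition new_parent z := if z \in [seq src t | t <- Z] then z else
  if ohead [seq m <- moves | lmq m == z] is Some m then lmp m else ph i z.
Definition new_tail e :=
  if ohead [seq m <- moves | lmg m == e] is Some m then lmq m else ta i e.

Lemma movesP m : List.In m moves <-> exists t, List.In t Z /\ move_of t = Some m.
Proof.
rewrite /moves; elim: Z => [|t Z' IH] /=; first by split=> // -[t []].
case et: (move_of t) => [m'|] /=; rewrite IH.
  split=> [[<-|[t' [h1 h2]]]|[t' [[<-|h1] h2]]].
  - by exists t; split=> //; left.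
  - by exists t'; split=> //; right.
  - by left; rewrite h2 in et; case: et.
  - by right; exists t'.
split=> [[t' [h1 h2]]|[t' [[<-|h1] h2]]]; first by exists t'; split=> //; right.
  by rewrite h2 in et.
by exists t'.
Qed.

Lemma move_item m : List.In m moves -> exists t, [/\ List.In t Z, move_of t = Some m,
  lmq m = tgt t, move_ok F m &
  [/\ lme m \in blue col i, ta i (lme m) = lmq m, ph i (lmq m) = lmy m,
    desc i (lmp m) (src t) & ph i (src t) = lmq m]].
Proof.
case/movesP => t [h1 h2]; exists t; have [[a1 a2 a3 a4 a5]] := Zok h1.
by rewrite h2 => -[[b1 b2 b3 b4 b5] [b6 b7 b8]]; split=> //; split=> //; rewrite ?b1.
Qed.

Lemma ohead_moves (P : pred (leaf_move G)) m : ohead [seq m <- moves | P m] = Some m ->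
  List.In m moves /\ P m.
Proof.
elim: moves => [//|m' l IH] /=; case p: (P m') => /=.
  by case=> <-; split=> //; left.
by move/IH => [h1 h2]; split=> //; right.
Qed.

Lemma ohead_none (P : pred (leaf_move G)) m : ohead [seq m <- moves | P m] = None ->
  List.In m moves -> ~~ P m.
Proof.
elim: moves => [//|m' l IH] /=; case p: (P m') => //= h [<-|]; first by rewrite p.
exact: IH.
Qed.

Lemma move_same m m' : List.In m moves -> List.In m' moves -> lmq m = lmq m' ->
  lmg m = lmg m' /\ lmp m = lmp m'.
Proof.
move=> /move_item[t [_ _ _ [a1 a2 a3 _ _] _]] /move_item[t' [_ _ _ [b1 b2 b3 _ _] _]] e.
have eg : lmg m' = lmg m.
  by apply: a3 => //; rewrite e; rewrite joins_sym in b2; exact: joins_in b2.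
split=> //; rewrite eg -e in b2; rewrite !(joins_sym _ _ (lmq m)) in a2 b2.
exact: joins_inj a2 b2.
Qed.

Lemma new_parent_src t : List.In t Z -> new_parent (src t) = src t.
Proof.
move=> h; rewrite /new_parent.
have -> : src t \in [seq src t | t <- Z] by apply/mem_mapP; exists t.
by [].
Qed.

Lemma new_parent_leaf m : List.In m moves -> new_parent (lmq m) = lmp m.
Proof.
move=> hm; have [t [ht et qt _ _]] := move_item hm.
rewrite /new_parent; case: ifP => [/mem_mapP[t' [ht' e]]|_].
  have ist : move_of t by rewrite et.
  by have := Zsrc ht' ht ist; rewrite -e qt eqxx.
case eo: (ohead _) => [m'|]; last by have := ohead_none eo hm; rewrite eqxx.
by have [h1 /eqP h2] := ohead_moves eo; have [_ ->] := move_same h1 hm h2.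
Qed.

Lemma new_parent_other z : (forall t, List.In t Z -> z != src t) ->
  (forall m, List.In m moves -> z != lmq m) -> new_parent z = ph i z.
Proof.
move=> h1 h2; rewrite /new_parent; case: ifP => [/mem_mapP[t [ht e]]|_].
  by have := h1 t ht; rewrite e eqxx.
case eo: (ohead _) => [m'|] //.
by have [h3 /eqP h4] := ohead_moves eo; have := h2 m' h3; rewrite h4 eqxx.
Qed.

Lemma new_parent_cases z : [\/ exists t, List.In t Z /\ z = src t,
  exists m, List.In m moves /\ z = lmq m |
  [/\ forall t, List.In t Z -> z != src t, forall m, List.In m moves -> z != lmq m
    & new_parent z = ph i z]].
Proof.
case: (boolP (z \in [seq src t | t <- Z])) => [/mem_mapP h|h1]; first by constructor 1.
case: (classic (exists m, List.In m moves /\ z = lmq m)) => h2; first by constructor 2.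
have n1 t : List.In t Z -> z != src t.
  by move=> ht; apply: contra h1 => /eqP e; apply/mem_mapP; exists t.
have n2 m : List.In m moves -> z != lmq m.
  by move=> hm; apply/negP => /eqP e; apply: h2; exists m.
by constructor 3; split=> //; exact: new_parent_other.
Qed.

Lemma cut_offP z : reflect (exists t, List.In t Z /\ desc i z (top t)) (cut_off z).
Proof. by apply: (iffP idP) => /hasInP. Qed.

Lemma top_src t : List.In t Z -> desc i (src t) (top t).
Proof.
move=> ht; have [[_ _ e _ _] _] := Zok ht; rewrite /top.
by case: (move_of t) => [m|]; [exact: desc_parent|exact: connect0].
Qed.

Lemma cut_off_src t : List.In t Z -> cut_off (src t).
Proof. by move=> ht; apply/cut_offP; exists t; split=> //; exact: top_src. Qed.

Lemma cut_off_leaf m : List.In m moves -> cut_off (lmq m).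
Proof.
move=> hm; have [t [ht et qt _ _]] := move_item hm; apply/cut_offP; exists t; split=> //.
by rewrite /top et qt; exact: connect0.
Qed.

Lemma cut_off_closed z : cut_off z -> cut_off (new_parent z).
Proof.
move=> hz; case: (new_parent_cases z) => [[t [ht ->]]|[m [hm ->]]|[n1 n2 ->]].
- by rewrite new_parent_src // cut_off_src.
- rewrite new_parent_leaf //; have [t [ht _ _ _ [_ _ _ h _]]] := move_item hm.
  by apply/cut_offP; exists t; split=> //; apply: desc_trans h _; exact: top_src.
case/cut_offP: hz => t [ht h]; apply/cut_offP; exists t; split=> //.
case: (desc_step h) => // e; move: (n1 t ht) n2; rewrite /top in e.
case et: (move_of t) e => [m|] -> ; last by rewrite eqxx.
have hm : List.In m moves by apply/movesP; exists t.
have [[_ _ _ _ _] h'] := Zok ht; rewrite et in h'; case: h' => -[q _ _ _ _] _.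
by move=> _ /(_ m hm); rewrite q eqxx.
Qed.

Lemma q_neq_r m : List.In m moves -> lmq m != r.
Proof.
move=> hm; have [t [_ _ _ _ [e1 e2 e3 _ _]]] := move_item hm.
have := (rt_graph (rt i)).1 _ e1; rewrite e2 => j.
by apply: contraTneq j => ->; rewrite (rt_root (rt i)); apply/negP => /joins_neq; rewrite eqxx.
Qed.

Lemma cut_off_root : ~~ cut_off r.
Proof.
apply/negP => /cut_offP[t [ht /desc_r]]; have [[_ n _ _ _] h] := Zok ht.
rewrite /top; case et: (move_of t) h => [m|] h e; last by rewrite e eqxx in n.
have hm : List.In m moves by apply/movesP; exists t.
by have := q_neq_r hm; case: h => -[-> _ _ _ _] _; rewrite e eqxx.
Qed.

(** The new pointers still lead to roots: either the old rank decreases, or a moved leaf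
    is passed to a descendant of the source below it, which can happen only once for
    each source, as the sources are roots now. *)
Definition jump z := count (fun t => move_of t && ~~ desc i z (src t)) Z.
Definition new_rank z := jump z * (\max_(w : V) mu i w).+1 + mu i z.

Lemma new_parent_decr : decr new_parent new_rank.
Proof.
set M := (\max_(w : V) mu i w).+1.
have muM w : mu i w < M by rewrite ltnS; apply: leq_bigmax.
move=> z; case: (new_parent_cases z) => [[t [ht ->]]|[m [hm ->]]|[n1 n2 ->]].
- by rewrite new_parent_src // eqxx.
- rewrite new_parent_leaf // => _; have [t [ht et _ _ [_ _ _ h p1]]] := move_item hm.
  suff lt : jump (lmp m) < jump (lmq m).
    have := muM (lmp m); rewrite /new_rank -/M => h2.
    apply: (@leq_trans ((jump (lmp m)).+1 * M)); first by rewrite mulSnr ltn_add2l.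
    by apply: leq_trans (leq_addr _ _); rewrite leq_mul2r lt orbT.
  apply: (@count_ltIn _ _ _ _ t) => //.
  + move=> t' ht' /andP[-> nd]; apply: contra nd => h'.
    exact: desc_trans h (desc_trans (desc_parent p1) h').
  + rewrite et /=; apply/negP => /desc_le.
    have nz : ph i (src t) != src t.
      have [[a1 a2 _ _ _] _] := Zok ht.
      by apply: contra a2 => /eqP/(explored_fix a1) ->.
    by have := rt_decr (rt i) nz; rewrite p1; nat_lia.
  + by rewrite et /= h.
- move=> nz; have lt := rt_decr (rt i) nz.
  rewrite /new_rank -/M -addnS; apply: leq_add; last exact: lt.
  rewrite leq_mul2r; apply/orP; right; apply: count_leIn => t ht /andP[-> nd] /=.
  apply: contra nd => h; case: (desc_step h) => // e.
  by have := n1 t ht; rewrite e eqxx.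
Qed.

Definition new_blue := (blue col i :\: [set e in outs]) :|: [set e in ins].

Lemma in_outs e : e \in outs <-> (exists t, List.In t Z /\ e = via t) \/
  (exists m, List.In m moves /\ e = lme m).
Proof.
rewrite mem_cat; split.
  by case/orP => /mem_mapP h; [left|right].
by case=> h; apply/orP; [left|right]; apply/mem_mapP.
Qed.

Lemma outs_blue e : e \in outs -> e \in blue col i.
Proof.
case/in_outs => [[t [ht ->]]|[m [hm ->]]]; first by have [[_ _ _ h _] _] := Zok ht.
by have [t [_ _ _ _ [h _ _ _ _]]] := move_item hm.
Qed.

Lemma ins_red e : e \in ins -> e \in F.
Proof. by case/mem_mapP => m [hm ->]; have [t [_ _ _ [h _ _ _ _] _]] := move_item hm. Qed.

Lemma red_blue e c : e \in F -> e \in blue col c -> False.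
Proof. by rewrite !inE => /eqP ->. Qed.

(** In particular the ends of a moved red edge are not both moved leaves. *)
Lemma mu_pq m : List.In m moves -> mu i (lmq m) < mu i (lmp m).
Proof.
move=> hm; have [t [ht _ _ _ [_ _ _ h p1]]] := move_item hm.
apply: leq_trans (desc_le h); rewrite -p1; apply: (rt_decr (rt i)).
by have [[a1 a2 _ _ _] _] := Zok ht; apply: contra a2 => /eqP/(explored_fix a1) ->.
Qed.

Lemma new_tail_ins m : List.In m moves -> new_tail (lmg m) = lmq m.
Proof.
move=> hm; have [t [ht _ _ [_ b2 b3 _ _] _]] := move_item hm.
rewrite /new_tail; case eo: (ohead _) => [m'|]; last by have := ohead_none eo hm; rewrite eqxx.
have [hm' /eqP e] := ohead_moves eo.
have [t' [_ _ _ [a1 a2 a3 _ _] _]] := move_item hm'.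
rewrite e in a2; case: (joins2 b2 a2) => -[h1 h2] //.
by have := mu_pq hm; have := mu_pq hm'; rewrite h1 h2; nat_lia.
Qed.

Lemma new_blueE e : e \in new_blue -> (exists m, List.In m moves /\ e = lmg m) \/
  (e \in blue col i /\ e \notin outs).
Proof.
rewrite in_setU in_setD !in_set => /orP[/andP[h1 h2]|/mem_mapP h]; last by left.
by right; split=> //; rewrite in_set.
Qed.

Lemma new_tail_old e : e \in blue col i -> new_tail e = ta i e.
Proof.
move=> eb; rewrite /new_tail; case eo: (ohead _) => [m|] //.
have [hm /eqP h] := ohead_moves eo; exfalso; apply: (red_blue (e := e) _ eb).
by apply: ins_red; apply/mem_mapP; exists m.
Qed.

Lemma ta_inj e e' : e \in blue col i -> e' \in blue col i -> ta i e = ta i e' -> e = e'.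
Proof. exact: (rt_graph (rt i)).2. Qed.

Lemma new_blue_graph : pgraph new_blue new_parent new_tail.
Proof.
have old e : e \in blue col i -> e \notin outs ->
    (forall t, List.In t Z -> ta i e != src t) /\ (forall m, List.In m moves -> ta i e != lmq m).
  move=> eb no; split=> [t ht|m hm]; apply: contra no => /eqP h; apply/in_outs.
    left; exists t; split=> //; have [[_ _ _ h1 h2] _] := Zok ht.
    by apply: ta_inj => //; rewrite h2.
  right; exists m; split=> //; have [t [_ _ _ _ [h1 h2 _ _ _]]] := move_item hm.
  by apply: ta_inj => //; rewrite h2.
split.
  move=> e /new_blueE[[m [hm ->]]|[eb no]].
    rewrite new_tail_ins // new_parent_leaf // joins_sym.
    by have [t [_ _ _ [_ j _ _ _] _]] := move_item hm.
  have [n1 n2] := old e eb no; rewrite new_tail_old // new_parent_other //.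
  exact: (rt_graph (rt i)).1.
move=> e e' /new_blueE[[m [hm ->]]|[eb no]] /new_blueE[[m' [hm' ->]]|[eb' no']].
- by rewrite !new_tail_ins // => /(move_same hm hm')[].
- rewrite new_tail_ins // new_tail_old // => h; have [_ n2] := old e' eb' no'.
  by have := n2 m hm; rewrite h eqxx.
- rewrite new_tail_ins // new_tail_old // => h; have [_ n2] := old e eb no.
  by have := n2 m' hm'; rewrite h eqxx.
- by rewrite !new_tail_old //; exact: ta_inj.
Qed.

Lemma out_walk z : explored z && ~~ cut_off z -> new_parent z = ph i z /\ (new_parent z != z ->
  explored (new_parent z) && ~~ cut_off (new_parent z) /\ exists2 e, e \in new_blue & joins e z (new_parent z)).
Proof.
move=> /andP[hz nz].
have n1 t : List.In t Z -> z != src t by move=> ht; apply: contraNneq nz => ->; exact: cut_off_src.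
have n2 m : List.In m moves -> z != lmq m by move=> hm; apply: contraNneq nz => ->; exact: cut_off_leaf.
have e := new_parent_other n1 n2; split=> //; rewrite e => ne; split.
  rewrite explored_parent //=; apply: contra nz => /cut_offP[t [ht h]].
  by apply/cut_offP; exists t; split=> //; apply: desc_trans h; exact: desc_parent.
have [e0 eb te] := rt_full (rt i) ne; exists e0; last first.
  by have := (rt_graph (rt i)).1 e0 eb; rewrite te.
rewrite in_setU in_setD eb andbT; apply/orP; left; rewrite in_set; apply/negP => /in_outs[].
  case=> t [ht h]; have [[_ _ _ _ h2] _] := Zok ht.
  by have := n1 t ht; rewrite -te h h2 eqxx.
case=> m [hm h]; have [t [_ _ _ _ [_ h2 _ _ _]]] := move_item hm.
by have := n2 m hm; rewrite -te h h2 eqxx.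
Qed.

Definition new_root := label new_parent new_rank.

(** From outside the cut-off part, the old pointers lead to r, and none was changed. *)
Lemma new_root_out z : explored z -> ~~ cut_off z -> new_root z = r /\ conn new_blue z r.
Proof.
move=> hz nz; have Wz : explored z && ~~ cut_off z by rewrite hz.
have c := @label_conn G new_parent new_rank new_blue (fun z => explored z && ~~ cut_off z)
  (fun w Ww nw => (out_walk Ww).2 nw) z Wz.
have Wl := @label_inv G new_parent new_rank (fun z => explored z && ~~ cut_off z)
  (fun w Ww nw => ((out_walk Ww).2 nw).1) z Wz.
have e : new_root z = r.
  have := label_fixed z new_parent_decr; rewrite (out_walk Wl).1.
  by apply: explored_fix; case/andP: Wl.
by split=> //; rewrite -e.
Qed.

Lemma new_root_in z : cut_off z -> new_root z != r.
Proof.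
move=> hz; have := @label_inv G new_parent new_rank cut_off (fun w h _ => cut_off_closed h) z hz; rewrite -/(new_root z).
by apply: contraTneq => ->; exact: cut_off_root.
Qed.

Lemma new_root_src t : List.In t Z -> new_root (src t) = src t.
Proof. by move=> ht; apply: label_id; exact: new_parent_src. Qed.

Lemma new_root_conn x y : conn new_blue x y -> new_root x = new_root y.
Proof. exact: pgraph_sep new_parent_decr new_blue_graph. Qed.

Lemma new_root_r : new_root r = r.
Proof. by apply: (new_root_out _ cut_off_root).1; rewrite /explored_in (stage_root ok) s_pos. Qed.

(** The full exchange: moreover the red edges fs become blue. *)
Definition new_col fs e := if e \in outs then None else
  if e \in ins ++ fs then Some i else col e.
Definition new_red fs := (F :\: [set e in ins ++ fs]) :|: [set e in outs].

Lemma blue_new_col fs : {subset fs <= F} -> blue (new_col fs) i = new_blue :|: [set f in fs].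
Proof.
move=> hfs; apply/setP => e; rewrite in_set /new_col in_setU in_setU in_setD !in_set (mem_cat e ins fs).
case: (boolP (e \in outs)) => [ho|no] /=.
  have nr : e \notin F by apply/negP => h; exact: red_blue h (outs_blue ho).
  have n1 : (e \in ins) = false by apply/negP => h; move/negP: nr; apply; exact: ins_red h.
  have n2 : (e \in fs) = false by apply/negP => h; move/negP: nr; apply; exact: hfs h.
  by rewrite n1 n2.
by case: (e \in ins); case: (e \in fs); rewrite ?eqxx ?orbT ?orbF.
Qed.

Lemma blue_new_col_other fs c : {subset fs <= F} -> c != i -> blue (new_col fs) c = blue col c.
Proof.
move=> hfs ci; apply/setP => e; rewrite !in_set /new_col.
case: ifP => [/outs_blue|_]; first by rewrite in_set => /eqP ->; rewrite (inj_eq Some_inj) [i == c]eq_sym (negPf ci).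
case: ifP => //; rewrite mem_cat => h.
have : e \in F by case/orP: h; [exact: ins_red|exact: hfs].
by rewrite in_set => /eqP ->; rewrite (inj_eq Some_inj) [i == c]eq_sym (negPf ci).
Qed.

Lemma red_new_col fs : red (new_col fs) = new_red fs.
Proof.
apply/setP => e; rewrite in_set /new_col in_setU in_setD !in_set.
by case: (e \in outs); rewrite ?orbT ?orbF //; case: (e \in ins ++ fs).
Qed.

Lemma via_joins t : List.In t Z -> joins (via t) (src t) (tgt t).
Proof.
move=> ht; have [[_ _ h1 h2 h3] _] := Zok ht.
by have := (rt_graph (rt i)).1 _ h2; rewrite h3 h1.
Qed.

Lemma agree_new_red fs w : explored w -> stage w != K -> (forall t, List.In t Z -> stage w != stage (tgt t)) ->
  (forall m, List.In m moves -> stage w != stage (lmy m)) ->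
  (forall f x, f \in fs -> x \in ends f -> stage x = K) -> agree F (new_red fs) w.
Proof.
move=> hw nK nt ny hfs e y c ye; have ey : stage w = stage y := conn_stage s c.
have en a b : joins e a b -> y = a \/ y = b.
  by move=> j; move: ye; rewrite (eqP j) !inE => /orP[]/eqP; [left|right].
rewrite in_setU in_setD !in_set (mem_cat e ins fs).
have -> : (e \in outs) = false.
  apply/negP => /in_outs[[t [ht h]]|[m [hm h]]]; subst e.
    case: (en _ _ (via_joins ht)) => h; subst y; first by rewrite ey ZK ?eqxx in nK.
    by have := nt t ht; rewrite ey eqxx.
  have [t [ht _ qt [_ _ _ _ j] _]] := move_item hm.
  case: (en _ _ j) => h; subst y; last by have := ny m hm; rewrite ey eqxx.
  by have := nt t ht; rewrite ey qt eqxx.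
have -> : (e \in ins) = false.
  apply/negP => /mem_mapP[m [hm h]]; subst e.
  have [t [ht _ qt [gF j _ _ _] _]] := move_item hm; have := nt t ht; rewrite ey -qt.
  case: (en _ _ j) => h; subst y; last by rewrite eqxx.
  by rewrite (conn_stage s (conn1 gF j)) eqxx.
have -> : (e \in fs) = false.
  by apply/negP => h; move: nK; rewrite ey (hfs e y) ?eqxx.
by rewrite orbF.
Qed.

(** In this case an augmentation can start from the cut-off part. Otherwise K itself has to
    become smaller, so that its entry vertex has to be separated from the sources. *)
Definition early := cut_off (nth r s K) || [exists z, [&& explored z, stage z < K & cut_off z]].

Hypothesis Ks : K < size s.

Lemma early_pos : early -> 0 < K.
Proof.
rewrite lt0n; apply: contraTneq => K0; rewrite /early K0 s_root (negPf cut_off_root) /=.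
by apply/negP => /existsP[z]; rewrite andbF.
Qed.

(** The entry arcs before the first component met by the cut-off part are unaffected. *)
Lemma legal_before fs J : {subset fs <= F} -> J <= K ->
  (forall z, explored z -> stage z < J -> ~~ cut_off z) ->
  (forall m, m < J -> agree F (new_red fs) (nth r s m)) ->
  legal (new_col fs) (red (new_col fs)) r s J.+1.
Proof.
move=> hfs JK out ag.
apply: (@legal_keep i new_parent new_rank new_blue _ (fun z => explored z && ~~ cut_off z)).
- exact: leq_ltn_trans JK Ks.
- exact: new_parent_decr.
- by move=> z Wz; exact: (out_walk Wz).2.
- by move=> z Wz; rewrite (out_walk Wz).1; apply: explored_fix; case/andP: Wz.
- move=> u l _ hu uJ _; have Wu : explored u && ~~ cut_off u by rewrite hu out.
  by rewrite (out_walk Wu).1.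
- by rewrite blue_new_col // subsetUl.
- by move=> c ci; rewrite blue_new_col_other.
- by move=> m mJ; rewrite red_new_col; exact: ag.
Qed.

Lemma agree_before fs J : (forall f x, f \in fs -> x \in ends f -> stage x = K) ->
  J <= K -> (forall z, explored z -> stage z < J -> ~~ cut_off z) ->
  forall m, m < J -> agree F (new_red fs) (nth r s m).
Proof.
move=> hfs JK out m mJ; have ms : m < size s by nat_lia.
have im := stage_nth ok ms.
have qJ t : List.In t Z -> move_of t -> J <= stage (tgt t).
  move=> ht; case et: (move_of t) => [m'|] // _; rewrite leqNgt; apply/negP => lt.
  have [[h1 _ h2 _ _] h] := Zok ht; rewrite et in h; case: h => -[q _ _ _ _] _.
  have hm : List.In m' moves by apply/movesP; exists t.
  by have := out (tgt t); rewrite -{3}q cut_off_leaf // -h2 explored_parent // h2 lt => /(_ isT isT).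
apply: agree_new_red => //.
- by rewrite /explored_in im.
- by rewrite im; nat_lia.
- move=> t ht; rewrite im; case et: (move_of t) => [m'|].
    by have := qJ t ht; rewrite et => /(_ isT); nat_lia.
  have [_] := Zok ht; rewrite et ZK // => -[_]; nat_lia.
- move=> m' hm; have [t [ht et _ _ _]] := move_item hm.
  have [_] := Zok ht; rewrite im et => -[_ [_ lt _]].
  by have := qJ t ht; rewrite et => /(_ isT); nat_lia.
Qed.

Lemma blue_new_col_forest c0 fs : (forall x y, conn new_blue x y -> c0 x = c0 y) -> {subset fs <= F} ->
  chain_ok c0 fs -> forall c, forest (blue (new_col fs) c).
Proof.
move=> h0 hfs ch c; case: (eqVneq c i) => [->|ci]; last by rewrite blue_new_col_other.
rewrite blue_new_col //; apply: chain_forest h0 ch; exact: pgraph_forest new_parent_decr new_blue_graph.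
Qed.

(** The red edges of K that may be made blue, c0 being constant on the components of the
    new blue forest. *)
Definition cuts (c0 : V -> V) fs := [/\ {subset fs <= F}, chain_ok c0 fs &
  forall f x, f \in fs -> x \in ends f -> stage x = K].

(** Let j be the first component met by the cut-off part, at g, where g is its entry
    vertex if possible. The map c0 merges the label of g with r: the edges fs then do not
    join g to r, and the blue component of g is a set A for the augmentation step. *)
Lemma early_no : early -> exists c0 : V -> V,
  (forall t, List.In t Z -> c0 (src t) = src t) /\
  forall fs, cuts c0 fs -> forest (new_red fs) -> excess d (new_red fs) <= excess d F -> False.
Proof.
move=> ea; pose R j := [exists z, [&& explored z, stage z == j & cut_off z]].
have exR : exists j, R j && (j <= K).
  case/orP: ea => [h|/existsP[z /and3P[h1 h2 h3]]].
    exists K; rewrite leqnn andbT; apply/existsP; exists (nth r s K).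
    by rewrite /explored_in (stage_nth ok Ks) Ks eqxx h.
  by exists (stage z); rewrite (ltnW h2) andbT; apply/existsP; exists z; rewrite h1 eqxx h3.
case: (ex_minnP exR) => j /andP[/existsP[z /and3P[hz /eqP ez Uz]] jK] mn.
have out w : explored w -> stage w < j -> ~~ cut_off w.
  move=> hw lt; apply/negP => Uw; suff le : j <= stage w by nat_lia.
  apply: mn; rewrite (leq_trans (ltnW lt) jK) andbT.
  by apply/existsP; exists w; rewrite hw eqxx Uw.
have js : j < size s by exact: leq_ltn_trans jK Ks.
pose g := if cut_off (nth r s j) then nth r s j else z.
have Ug : cut_off g by rewrite /g; case: ifP.
pose c0 w := if new_root w == r then new_root g else new_root w.
have c0c x y : conn new_blue x y -> c0 x = c0 y by rewrite /c0 => /new_root_conn ->.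
exists c0; split.
  move=> t ht; rewrite /c0 new_root_src //; have [[_ n _ _ _] _] := Zok ht.
  by rewrite (negPf n).
move=> fs [hfs ch hK] fF1 le.
have ag := agree_before hK jK out.
have nXg : ~~ conn new_blue g r.
  by apply: contra (new_root_in Ug) => /new_root_conn ->; rewrite new_root_r.
have c0g : c0 g = c0 r by rewrite /c0 new_root_r eqxx (negPf (new_root_in Ug)).
have nc := chain_sep c0c ch c0g nXg.
have agj : ~~ cut_off (nth r s j) -> agree F (new_red fs) (nth r s j).
  move=> nU.
  have jK' : j < K.
    rewrite ltn_neqAle jK andbT; apply/negP => /eqP eK; case/orP: ea.
      by rewrite -eK (negPf nU).
    by move=> /existsP[w /and3P[h1 h2 h3]]; have := out w h1; rewrite eK h2 h3 => /(_ isT).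
  have qj t : List.In t Z -> move_of t -> j < stage (tgt t).
    move=> ht; case et: (move_of t) => [m|] // _.
    have [[h1 _ h2 _ _] h] := Zok ht; rewrite et in h; case: h => -[q _ _ _ _] [_ _ fst].
    have hq : explored (tgt t) by rewrite -h2 explored_parent.
    have Ut w : desc i w (tgt t) -> cut_off w.
      by move=> h; apply/cut_offP; exists t; rewrite /top et.
    rewrite ltnNge; apply/negP => leq; case/negP: nU.
    have eq : stage (tgt t) = j.
      apply/eqP; rewrite eqn_leq leq leqNgt; apply/negP => lt.
      by have := out _ hq lt; rewrite Ut //; exact: connect0.
    apply: (Ut _); rewrite -{1}eq; apply: fst => w hw dw; rewrite eq leqNgt.
    by apply/negP => lt; have := out w hw lt; rewrite Ut.
  have im := stage_nth ok js.
  apply: agree_new_red => //.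
  - by rewrite /explored_in im.
  - by rewrite im; nat_lia.
  - move=> t ht; rewrite im; case et: (move_of t) => [m'|].
      by have := qj t ht; rewrite et => /(_ isT); nat_lia.
    have [_] := Zok ht; rewrite et ZK // => -[_]; nat_lia.
  - move=> m' hm; have [t [ht et _ _ _]] := move_item hm.
    have [_] := Zok ht; rewrite im et => -[_ [_ lt _]].
    by have := qj t ht; rewrite et => /(_ isT); nat_lia.
apply: (no_augment d0 ok nogood minimal (col1 := new_col fs) (i := i) (j := j)
  (A := fun w => conn (blue (new_col fs) i) w g) (z := g)); rewrite ?red_new_col //.
- exact: blue_new_col_forest c0c hfs ch.
- by rewrite -red_new_col; exact: legal_before.
- by move=> e x y ei jxy; apply: conn_trans; rewrite connC; exact: conn1 ei jxy.
- by rewrite blue_new_col // connC.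
- move=> m w mj; have ms : m < size s := ltn_trans mj js.
  rewrite (agree_conn _ (ag m mj)) => cw; have iw := stage_eq ok ms cw.
  have hw : explored w by rewrite /explored_in iw.
  have Uw : ~~ cut_off w by apply: out; rewrite ?iw.
  rewrite blue_new_col //; apply: contra nc; rewrite connC => h; apply: conn_trans h _.
  by apply: conn_sub (new_root_out hw Uw).2; exact: subsetUl.
- exact: conn0.
- rewrite /g; case: (boolP (cut_off (nth r s j))) => [|/agj ag']; first by move=> _; exact: conn0.
  by rewrite (agree_conn _ ag') -ez; exact: (stage_conn r hz).
- rewrite /g; case: (boolP (cut_off (nth r s j))) => [_|/agj]; [left; exact: conn0|by right].
Qed.

(** All components before K, and the entry arc of K, are kept. *)
Lemma late_no : ~~ early ->
  [/\ forall t, List.In t Z -> new_root (src t) = src t, new_root (nth r s K) = r,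
     forall t, List.In t Z -> move_of t -> stage (tgt t) != K &
  forall fs, cuts new_root fs -> forest (new_red fs) ->
    excess d F <= excess d (new_red fs) /\
    (0 < K -> excess d (new_red fs) <= excess d F -> esz F (nth r s K) <= esz (new_red fs) (nth r s K))].
Proof.
rewrite negb_or => /andP[nK /existsPn nlt].
have out w : explored w -> stage w < K -> ~~ cut_off w.
  by move=> hw lt; have := nlt w; rewrite hw lt.
have hK : explored (nth r s K) by rewrite /explored_in (stage_nth ok Ks).
split.
- by move=> t; exact: new_root_src.
- exact: (new_root_out hK nK).1.
- move=> t ht; case et: (move_of t) => [m|] // _.
  have [_ h] := Zok ht; rewrite et in h; case: h => _ [_ _ fst].
  apply/negP => /eqP eq; case/negP: nK; apply/cut_offP; exists t; split=> //.
  rewrite /top et -eq; apply: fst => w hw dw; rewrite eq leqNgt.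
  apply/negP => lt; case/negP: (out w hw lt); apply/cut_offP; exists t.
  by rewrite /top et.
move=> fs [hfs ch hfK] fF1.
have fB1 := blue_new_col_forest new_root_conn hfs ch.
split; first by have := improve_excess d0 nogood minimal fB1; rewrite red_new_col; exact.
move=> K0 le; rewrite -red_new_col; apply: (improve_lex ok minimal fB1); rewrite ?red_new_col ?K0 //.
  by rewrite -red_new_col; apply: legal_before => //; exact: agree_before.
exact: agree_before.
Qed.

End Exchange.

(** * The red side of an exchange *)

(** The red components that the item modifies, apart from the one at its source. *)
Definition touched t := match move_of t with
  None => [:: tgt t] | Some m => [:: tgt t; lmy m] end.
Definition apart t t' :=
  all (fun w => all (fun w' => stage w != stage w') (touched t')) (touched t).

(** A bound on the number of edges of the tree attached at the source. *)
Definition blob t := if move_of t then 1 else esz F (tgt t).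

Definition good i K t := [/\ item_ok i t, stage (src t) = K &
  forall m, move_of t = Some m -> stage (lmy m) != K].
Definition ortho t t' := [&& apart t t', move_of t' ==> (src t != tgt t')
  & move_of t ==> (src t' != tgt t)].

(** Items at K that can be realised together. *)
Definition family i K Z := (forall t, List.In t Z -> good i K t) /\ pairwise ortho Z.

Lemma src_tgt i K t : good i K t -> src t != tgt t.
Proof.
move=> [[[h1 h2 h3 _ _] _] _ _]; apply: contra h2 => /eqP e; apply/eqP.
by apply: (explored_fix (i := i)) => //; rewrite h3.
Qed.

Lemma good_K i K t : good i K t -> K < size s.
Proof. by move=> [[[h _ _ _ _] _] <- _]. Qed.

Lemma blob_good i K t : good i K t -> blob t <= 1.
Proof. by move=> [[_ h] _ _]; rewrite /blob; case: (move_of t) h => // -[]. Qed.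

Section RedSide.
Variables (i : 'I_k) (Z : seq item) (K : nat).
Hypotheses (fam : family i K Z) (Ks : K < size s).

Lemma family_ok t : List.In t Z -> item_ok i t.
Proof. by case/fam.1. Qed.

Lemma family_src t t' : List.In t Z -> List.In t' Z -> move_of t' -> src t != tgt t'.
Proof.
move=> ht ht' v; case: (pairwiseIn fam.2 ht ht') => [->|/and3P[_ /implyP h _]|/and3P[_ _ /implyP h]].
- exact: src_tgt (fam.1 _ ht').
- exact: h.
- exact: h.
Qed.

Lemma family_K t : List.In t Z -> stage (src t) = K.
Proof. by case/fam.1. Qed.

Lemma family_apart : pairwise apart Z.
Proof. by apply: (sub_pairwise _ fam.2) => t t' /and3P[]. Qed.

Lemma family_child t m : List.In t Z -> move_of t = Some m -> stage (lmy m) != K.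
Proof. by case/fam.1 => _ _; apply. Qed.

Let Zok := family_ok.
Let Zsrc := family_src.
Let ZK := family_K.
Let Zap := family_apart.
Let Zy := family_child.
Let mv := move_verts (moves Z).
Let Fb := all_moved F (moves Z).

Lemma apart_sym t t' : apart t t' -> apart t' t.
Proof.
move=> h; apply/allP => w hw; apply/allP => w' hw'; rewrite eq_sym.
exact: (allP (allP h w' hw') w hw).
Qed.

Lemma move_vertsP Z' w : w \in move_verts (moves Z') ->
  (forall t, List.In t Z' -> item_ok i t) ->
  exists t m, [/\ List.In t Z', move_of t = Some m, w \in touched t & w = tgt t \/ w = lmy m].
Proof.
elim: Z' => [//|t Z' IH] h ok'.
have rec : w \in move_verts (moves Z') -> exists t0 m, [/\ List.In t0 (t :: Z'),
    move_of t0 = Some m, w \in touched t0 & w = tgt t0 \/ w = lmy m].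
  move=> h'; have [|t' [m [h1 h2 h3 h4]]] := IH h'; first by move=> t' ht'; apply: ok'; right.
  by exists t', m; split=> //; right.
move: h; rewrite /moves /=; case et: (move_of t) => [m|] /=; last exact: rec.
have [_] := ok' t (or_introl erefl); rewrite et => -[[q _ _ _ _] _].
rewrite !inE q => /or3P[/eqP e|/eqP e|]; [| |exact: rec]; exists t, m; split=> //.
- by left.
- by rewrite /touched et e inE eqxx.
- by left.
- by left.
- by rewrite /touched et e !inE eqxx orbT.
- by right.
Qed.

Lemma mv_indep : indep F mv.
Proof.
rewrite /mv; elim: Z Zok Zap => [//|t Z' IH] Zok' /= /andP[al ap].
have ok' t' : List.In t' Z' -> item_ok i t' by move=> h; apply: Zok'; right.
rewrite /moves /=; case et: (move_of t) => [m|] /=; last exact: IH.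
have [_] := Zok' t (or_introl erefl); rewrite et => -[[q _ _ _ _] [_ lt _]].
have sep w w' : w \in touched t -> w' \in move_verts (moves Z') -> ~~ conn F w w'.
  move=> hw /move_vertsP/(_ ok')[t' [m' [ht' _ hw' _]]].
  have := allP (allP (allIn al ht') w hw) w' hw'; apply: contra => c.
  by rewrite (conn_stage s c).
have hq : lmq m \in touched t by rewrite /touched et q inE eqxx.
have hy : lmy m \in touched t by rewrite /touched et !inE eqxx orbT.
apply/andP; split; last first.
  apply/andP; split; last exact: IH.
  by apply/allP => w hw; exact: sep.
apply/andP; split; last by apply/allP => w hw; exact: sep.
by rewrite q; apply/negP => c; rewrite (conn_stage s c) ltnn in lt.
Qed.

Lemma mem_mv m u : List.In m (moves Z) -> u = lmq m \/ u = lmy m -> u \in mv.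
Proof.
move=> hm hu; rewrite /mv; elim: (moves Z) hm => [//|m' l IH] /= [->|/IH h].
  by rewrite !inE; case: hu => ->; rewrite eqxx ?orbT.
by rewrite !inE h !orbT.
Qed.

Lemma moves_ok m : List.In m (moves Z) -> move_ok F m.
Proof. by move/(move_item Zok) => [t []]. Qed.

Let spec := all_moved_spec d0 fF moves_ok mv_indep.

Lemma Fb_forest : forest Fb.
Proof. by case: spec. Qed.

Lemma src_out t : List.In t Z -> src t \notin mv.
Proof.
move=> ht; apply/negP => /move_vertsP/(_ Zok)[t' [m [ht' et _ [e|e]]]].
  by have := @Zsrc t t' ht ht'; rewrite et e eqxx => /(_ isT).
by have := Zy ht' et; rewrite -e ZK ?eqxx.
Qed.

Lemma K_conn w x : w \notin mv -> conn Fb w x -> x \notin mv /\ conn F w x.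
Proof.
move=> nw c; have [_ _ c1 _ [q3 _ q1 _]] := spec.
have nx : x \notin mv.
  apply/negP => hx; have [t [m [ht et _ hx']]] := move_vertsP hx Zok.
  have hm : List.In m (moves Z) by apply/movesP; exists t.
  have [_] := Zok ht; rewrite et => -[[q _ _ _ _] _].
  have cq : conn Fb (lmq m) w.
    rewrite connC; apply: (conn_trans c).
    by case: hx' => ->; [rewrite -q; exact: conn0|rewrite connC; exact: q3].
  by rewrite (mem_mv hm) // in nw; exact: q1 cq.
by split=> //; rewrite -c1.
Qed.

Lemma moved_set : Fb = (F :\: [set e in ins Z]) :|: [set e in [seq lme m | m <- moves Z]].
Proof.
apply: all_movedE => e /mem_mapP[m [hm ->]]; apply/negP => /mem_mapP[m' [hm' e']].
have [_ [_ _ _ [h1 _ _ _ _] _]] := move_item Zok hm.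
have [_ [_ _ _ _ [h2 _ _ _ _]]] := move_item Zok hm'.
by apply: red_blue h1 _; rewrite e'; exact: h2.
Qed.

Lemma K_edge f w x : f \in Fb -> w \notin mv -> x \in ends f -> conn Fb w x -> f \in F.
Proof.
move=> fb nw xe c; move: fb.
rewrite moved_set in_setU in_setD !in_set => /orP[/andP[_]|/mem_mapP[m [hm e]]].
  by rewrite -in_set.
exfalso.
have [t [ht et q [_ _ _ _ j] _]] := move_item Zok hm.
have [nx _] := K_conn nw c.
by case/negP: nx; apply: (mem_mv hm); move: xe; rewrite e (eqP j) !inE => /orP[]/eqP; [left|right].
Qed.

(** The exchange in the red forest amounts to the leaf moves, the removal of fs, and the
    attachment of one small tree to each source. *)
Lemma final_red fs ws : {subset fs <= F} ->
  indep (Fb :\: [set f in fs]) (flatten [seq [:: src t; tgt t] | t <- Z] ++ ws) ->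
  let F' := Fb :\: [set f in fs] in
  [/\ forest (new_red Z fs),
   excess d (new_red Z fs) + \sum_(t <- Z) ((esz F' (src t) - d) + (esz F' (tgt t) - d))
   = excess d F' + \sum_(t <- Z) ((esz F' (src t) + esz F' (tgt t)).+1 - d) &
   forall w, w \in ws -> esz (new_red Z fs) w = esz F' w].
Proof.
move=> hfs ind F'.
have fF' : forest F' by apply: forest_sub Fb_forest; exact: subsetDl.
pose L := [seq (src t, tgt t, via t) | t <- Z].
have F1E : new_red Z fs = F' :|: [set e in [seq l.2 | l <- L]].
  have -> : [seq l.2 | l <- L] = [seq via t | t <- Z] by rewrite -map_comp.
  apply/setP => e; rewrite /F' moved_set /new_red !in_setU !in_setD !in_setU !in_setD !in_set.
  rewrite (mem_cat e (ins Z) fs) (mem_cat e [seq via t | t <- Z]).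
  have : e \in [seq lme m | m <- moves Z] -> e \notin fs.
    case/mem_mapP => m [hm ->]; apply/negP => /hfs h.
    have [_ [_ _ _ _ [h2 _ _ _ _]]] := move_item Zok hm; exact: red_blue h h2.
  case: (e \in [seq lme m | m <- moves Z]) => [/(_ isT)/negPf ->|_]; rewrite ?orbT ?orbF //=.
  by case: (e \in ins Z); case: (e \in fs); case: (e \in F); case: (e \in map _ _).
rewrite F1E.
have jL l : l \in L -> joins l.2 l.1.1 l.1.2.
  by case/mem_mapP => t [ht ->] /=; exact: via_joins Zok _ ht.
have [|h1 h2 h3] := @attach _ d L F' ws fF' jL.
  by rewrite /L -map_comp.
by rewrite !big_map in h2; split.
Qed.

Lemma tgt_apart t t' : List.In t Z -> List.In t' Z -> apart t t' ->
  ~~ conn Fb (tgt t) (tgt t').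
Proof.
have [_ _ c1 _ [_ _ q1 _]] := spec.
have vt t0 : tgt t0 \in touched t0.
  by rewrite /touched; case: (move_of t0) => [m|]; rewrite inE eqxx.
have movable t1 t2 m : List.In t1 Z -> move_of t1 = Some m -> apart t1 t2 ->
    ~~ conn Fb (tgt t1) (tgt t2).
  move=> h1 e1 ap; have hm : List.In m (moves Z) by apply/movesP; exists t1.
  have [_] := Zok h1; rewrite e1 => -[[q _ _ _ _] _]; rewrite -q.
  apply/negP => /(q1 _ _ hm) hx; have : tgt t2 \in touched t1.
    by rewrite /touched e1 -q !inE; case: hx => ->; rewrite eqxx ?orbT.
  by move=> h; have := allP (allP ap _ h) _ (vt t2); rewrite eqxx.
move=> ht ht' ap.
case et: (move_of t) => [m|]; first exact: movable et ap.
case et': (move_of t') => [m|]; first by rewrite connC; apply: movable et' (apart_sym ap).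
have real t1 : List.In t1 Z -> move_of t1 = None -> tgt t1 \notin mv.
  move=> h1 e1; apply/negP => /move_vertsP/(_ Zok)[t2 [m2 [h2 e2 h3 _]]].
  case: (pairwiseIn Zap h1 h2) => [e|ap'|ap'].
  - by rewrite e e2 in e1.
  - by have := allP (allP ap' _ (vt t1)) _ h3; rewrite eqxx.
  - by have := allP (allP ap' _ h3) _ (vt t1); rewrite eqxx.
rewrite c1 ?real //; apply/negP => c.
by have := allP (allP ap _ (vt t)) _ (vt t'); rewrite (conn_stage s c) eqxx.
Qed.

Lemma tgt_real t : List.In t Z -> move_of t = None -> tgt t \notin mv.
Proof.
move=> h1 e1; apply/negP => /move_vertsP/(_ Zok)[t2 [m2 [h2 e2 h3 _]]].
have vt : tgt t \in touched t by rewrite /touched e1 inE.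
case: (pairwiseIn Zap h1 h2) => [e|ap'|ap'].
- by rewrite e e2 in e1.
- by have := allP (allP ap' _ vt) _ h3; rewrite eqxx.
- by have := allP (allP ap' _ h3) _ vt; rewrite eqxx.
Qed.

Lemma tgt_K t w : List.In t Z -> stage w = K -> w \notin mv -> ~~ conn Fb w (tgt t).
Proof.
move=> ht iw nw; apply/negP => /(K_conn nw)[nt c]; have := conn_stage s c.
rewrite iw -(ZK ht); have [_] := Zok ht; case et: (move_of t) => [m|].
  move=> _ _; case/negP: nt; rewrite /mv.
  have hm : List.In m (moves Z) by apply/movesP; exists t.
  have [_] := Zok ht; rewrite et => -[[q _ _ _ _] _]; rewrite -q.
  by apply: (mem_mv hm); left.
by move=> [_ lt] e; rewrite e ltnn in lt.
Qed.

(** Beyond the separation of the sources from each other, all trees are automatically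
    disjoint. *)
Lemma all_indep (F' : {set E}) ws : F' \subset Fb -> indep F' ([seq src t | t <- Z] ++ ws) ->
  (forall w, w \in ws -> stage w = K /\ w \notin mv) ->
  indep F' (flatten [seq [:: src t; tgt t] | t <- Z] ++ ws).
Proof.
move=> sF ind hws; have sc := conn_sub sF.
suff H Z' : (forall t, List.In t Z' -> List.In t Z) -> pairwise apart Z' ->
    indep F' ([seq src t | t <- Z'] ++ ws) ->
    indep F' (flatten [seq [:: src t; tgt t] | t <- Z'] ++ ws) by exact: H.
elim: Z' => [//|t Z' IH] hZ /= /andP[al ap] /andP[as_ ind'].
have ht : List.In t Z by apply: hZ; left.
have hZ' t' : List.In t' Z' -> List.In t' Z by move=> h; apply: hZ; right.
have mem w : w \in flatten [seq [:: src t; tgt t] | t <- Z'] ++ ws ->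
    w \in [seq src t | t <- Z'] ++ ws \/ exists t', List.In t' Z' /\ w = tgt t'.
  rewrite !mem_cat; elim: (Z') => [|t1 Z1 IH1] /=; first by move=> ->; left.
  rewrite !inE => /orP[/or3P[->|/eqP ->|h]|h]; first by left.
  - by right; exists t1; split=> //; left.
  - have [|h'|[t' [h1 h2]]] := IH1; first by rewrite h.
      by left; case/orP: h' => ->; rewrite !orbT.
    by right; exists t'; split=> //; right.
  - by left; rewrite h orbT.
have at_K w : w \in [seq src t | t <- Z'] ++ ws -> stage w = K /\ w \notin mv.
  rewrite mem_cat => /orP[/mem_mapP[t' [h ->]]|/hws //].
  by split; [exact: ZK (hZ' _ h)|exact: src_out (hZ' _ h)].
apply/and3P; split; last exact: IH.
  apply/andP; split; first by apply: contra (tgt_K ht (ZK ht) (src_out ht)); exact: sc.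
  apply/allP => w /mem[h|[t' [h ->]]]; first exact: allP as_ w h.
  by apply: contra (tgt_K (hZ' _ h) (ZK ht) (src_out ht)); exact: sc.
apply/allP => w /mem[/at_K[h1 h2]|[t' [h ->]]].
  by apply: contra (tgt_K ht h1 h2) => c; rewrite connC; exact: sc c.
apply: contra (tgt_apart ht (hZ' _ h) (allIn al h)); exact: sc.
Qed.

Lemma blob_le (F' : {set E}) t : F' \subset Fb -> List.In t Z -> esz F' (tgt t) <= blob t.
Proof.
move=> sF ht; apply: leq_trans (esz_mono _ sF) _; have [_ _ _ s1 [_ _ _ q2]] := spec.
rewrite /blob; case et: (move_of t) => [m|]; last exact: s1 (tgt_real ht et).
have hm : List.In m (moves Z) by apply/movesP; exists t.
have [_] := Zok ht; rewrite et => -[[q _ _ _ _] _]; rewrite -q; exact: q2.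
Qed.

Lemma blob1 t : List.In t Z -> blob t <= 1.
Proof. by move/fam.1/blob_good. Qed.

(** The moves can only take leaves away from K, and the excess falls accordingly. *)
Lemma K_size t : List.In t Z -> esz Fb (src t) <= esz F (src t) /\
  excess d Fb + (esz F (src t) - d) <= excess d F + (esz Fb (src t) - d).
Proof.
move=> ht; have [_ x1 _ s1 _] := spec; have n := src_out ht.
by split; [exact: s1|exact: x1].
Qed.

Lemma K_self t t' : List.In t Z -> List.In t' Z -> move_of t' -> stage (tgt t') = K ->
  esz Fb (src t) < esz F (src t).
Proof.
move=> ht ht'; case et: (move_of t') => [m|] // _ it.
have [_ _ _ _ [_ s2 _ _]] := spec.
have hm : List.In m (moves Z) by apply/movesP; exists t'.
apply: (s2 m) => //; first exact: src_out.
have [_] := Zok ht'; rewrite et => -[[-> _ _ _ _] _].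
by apply: (same_stage r (s := s)); [have [[]] := Zok ht|rewrite it ZK].
Qed.

Let v := nth r s K.

Lemma src_conn t : List.In t Z -> conn F v (src t).
Proof. by move=> ht; rewrite /v -(ZK ht); apply: stage_conn; have [[]] := Zok ht. Qed.

Lemma srcs_conn t t' : List.In t Z -> List.In t' Z -> conn Fb (src t) (src t').
Proof.
move=> ht ht'; have [_ _ c1 _ _] := spec; rewrite c1 ?src_out //.
by apply: conn_trans (src_conn ht'); rewrite connC; exact: src_conn.
Qed.

Lemma src_neq t t' : List.In t Z -> List.In t' Z -> apart t t' -> src t != src t'.
Proof.
move=> ht ht' ap; apply/negP => /eqP e.
have [[_ _ h1 _ _] _] := Zok ht; have [[_ _ h2 _ _] _] := Zok ht'.
have vt t0 : tgt t0 \in touched t0.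
  by rewrite /touched; case: (move_of t0) => [m|]; rewrite inE eqxx.
have h := allP (allP ap _ (vt t)) _ (vt t').
by rewrite -h1 -h2 e eqxx in h.
Qed.

Lemma K_piece f t x : List.In t Z -> f \in Fb -> (forall y, y \in ends f -> conn Fb (src t) y) ->
  x \in ends f -> f \in F /\ stage x = K.
Proof.
move=> ht fin h xe; have c := h x xe; split; first exact: K_edge fin (src_out ht) xe c.
by rewrite -(ZK ht) -(conn_stage s (K_conn (src_out ht) c).2).
Qed.

Lemma v_out : ~~ early i Z K -> v \notin mv.
Proof.
move=> la; have [_ _ nq _] := late_no Zok Zsrc ZK Ks la.
apply/negP => /move_vertsP/(_ Zok)[t [m [ht et _ [e|e]]]].
  by have := nq t ht; rewrite et -e (stage_nth ok Ks) eqxx => /(_ isT).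
by have := Zy ht et; rewrite -e (stage_nth ok Ks) eqxx.
Qed.

Lemma v_conn t : ~~ early i Z K -> List.In t Z -> conn Fb (src t) v.
Proof.
move=> la ht; have [_ _ c1 _ _] := spec; rewrite c1 ?src_out ?v_out // connC.
exact: src_conn.
Qed.

Lemma v_size t : List.In t Z -> esz F (src t) = esz F v.
Proof. by move=> ht; rewrite -(esz_conn (src_conn ht)). Qed.

Lemma cut_nil (X : {set E}) : X :\: [set f in [::]] = X.
Proof. by apply/setP => f; rewrite !inE. Qed.

Lemma cut_one (X : {set E}) f : X :\: [set g in [:: f]] = X :\ f.
Proof. by apply/setP => g; rewrite !inE. Qed.

Lemma cut_two (X : {set E}) f1 f2 : X :\: [set g in [:: f1; f2]] = X :\ f1 :\ f2.
Proof. by apply/setP => g; rewrite !inE negb_or andbCA andbA. Qed.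

(** One edge of K, or two of them, can be made blue so as to separate two, or three,
    vertices of K that lie in different pieces of the new blue forest. *)
Lemma cut_pair c0 t w : List.In t Z -> conn Fb (src t) w -> c0 (src t) != c0 w ->
  let F' f := Fb :\ f in exists f, [/\ cuts K c0 [:: f], ~~ conn (F' f) (src t) w,
    esz Fb (src t) = (esz (F' f) (src t) + esz (F' f) w).+1,
    excess d Fb + (esz (F' f) (src t) - d) + (esz (F' f) w - d)
      = excess d (F' f) + (esz Fb (src t) - d) &
    exists b, [/\ f \in Fb, b \in ends f & conn (F' f) w b]].
Proof.
move=> ht cw nc0 F'.
have [f [fin nc ch]] := separate2 Fb_forest cw nc0.
have [a [b [j _ ca cb]]] := cut_conn Fb_forest fin cw nc.
have sub := @conn_sub _ (Fb :\ f) Fb (subsetDl _ _).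
have fe y : y \in ends f -> conn Fb (src t) y.
  rewrite (eqP j) !inE => /orP[]/eqP ->; first exact: sub.
  by apply: conn_trans cw _; exact: sub.
exists f; split=> //.
- split=> // [g|g x]; rewrite inE => /eqP ->.
    by have [] := K_piece ht fin fe (joins_in j).
  by move=> xe; have [] := K_piece ht fin fe xe.
- exact: cut_esz Fb_forest fin cw nc.
- exact: cut_excess Fb_forest fin cw nc.
- by exists b; split=> //; rewrite (eqP j) !inE eqxx orbT.
Qed.

Lemma cut_triple c0 t w1 w2 : List.In t Z -> conn Fb (src t) w1 -> conn Fb (src t) w2 ->
  c0 (src t) != c0 w1 -> c0 (src t) != c0 w2 -> c0 w1 != c0 w2 ->
  exists f1 f2, let F' := Fb :\ f1 :\ f2 in [/\ cuts K c0 [:: f1; f2],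
    F' \subset Fb, [/\ ~~ conn F' (src t) w1, ~~ conn F' (src t) w2 & ~~ conn F' w1 w2],
    esz Fb (src t) = esz F' (src t) + esz F' w1 + esz F' w2 + 2 &
    excess d Fb + (esz F' (src t) - d) + (esz F' w1 - d) + (esz F' w2 - d)
      = excess d F' + (esz Fb (src t) - d)].
Proof.
move=> ht c1 c2 n1 n2 n12.
have [f1 [f2 [in1 in2 ch [m1 m2 m12]]]] := separate3 Fb_forest c1 c2 n1 n2 n12.
have [e2 e3 k1 k2] := cut3 d Fb_forest in1 in2 c1 c2 m1 m2 m12.
have in2' : f2 \in Fb by move: in2; rewrite inE => /andP[].
have fs_K g x : g \in [:: f1; f2] -> x \in ends g -> g \in F /\ stage x = K.
  move=> gi xe; have [e|e] : g = f1 \/ g = f2.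
  - by move: gi; rewrite !inE => /orP[]/eqP; [left|right].
  - by rewrite e in xe *; exact: K_piece ht in1 k1 xe.
  - by rewrite e in xe *; exact: K_piece ht in2' k2 xe.
exists f1, f2; split=> //; last by rewrite -cut_two; exact: subsetDl.
split=> // [g gi|g x gi xe]; last by have [] := fs_K g x gi xe.
by have [a [b j]] := joins_ex g; have [] := fs_K g a gi (joins_in j).
Qed.

(** The next lemmas spell out minimality for up to three items: the exchange has to
    increase the excess, or at least not to lower it if K is the root component. The
    pieces into which K is cut have sizes E1, E2, E3, or Ea, if they contain a source, and
    Ev if they contain the entry vertex. *)
Lemma exch1_early t : Z = [:: t] -> early i Z K ->
  esz F v - d < (esz F v + blob t).+1 - d.
Proof.
move=> eZ ea; have ht : List.In t Z by rewrite eZ; left.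
have [c0 [_ H]] := early_no Zok Zsrc ZK Ks ea.
have ind : indep (Fb :\: [set f in [::]]) (flatten [seq [:: src t; tgt t] | t <- Z] ++ [::]).
  by apply: all_indep => //; [exact: subsetDl|rewrite eZ].
have [|f1 e1 _] := @final_red [::] [::] _ ind; first by [].
rewrite ltnNge; apply/negP => le; apply: (H [::]) => //.
move: e1; rewrite cut_nil eZ !big_cons !big_nil -eZ.
have [h1 h2] := K_size ht; rewrite v_size // in h1 h2.
have h3 := blob_le (subxx Fb) ht; have h4 := blob1 ht.
have [z1 y1] := blob_arith (esz Fb (src t)) d0 h3 h4.
have y2 : (esz Fb (src t) + blob t).+1 - d <= (esz F v + blob t).+1 - d.
  by clear - h1; nat_lia.
rewrite z1 => e1; clear z1 h1 h3 h4; move: e1 h2 y1 y2 le; abstract_subn; nat_lia.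
Qed.

Lemma exch1_late t : Z = [:: t] -> ~~ early i Z K -> exists Ea Ev,
  [/\ Ea + Ev < esz F v, K = 0 -> (if d < 3 then 1 else 2) <= Ev,
   esz F v - d <= ((Ea + blob t).+1 - d) + (Ev - d) &
   0 < K -> esz F v - d < ((Ea + blob t).+1 - d) + (Ev - d)].
Proof.
move=> eZ la; have ht : List.In t Z by rewrite eZ; left.
have [ls lv nq H] := late_no Zok Zsrc ZK Ks la.
have cv := v_conn la ht; have vo := v_out la.
have [|f [cf nc e2 e3 [b [fin jb cb]]]] := cut_pair (c0 := new_root i Z) ht cv.
  by rewrite ls // lv; have [[]] := Zok ht.
have sub := @conn_sub _ (Fb :\ f) Fb (subsetDl _ _).
have fs_F : {subset [:: f] <= F} by case: cf.
have ind : indep (Fb :\: [set g in [:: f]])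
    (flatten [seq [:: src t; tgt t] | t <- Z] ++ [:: v]).
  apply: all_indep; rewrite ?cut_one; first exact: subsetDl.
    by rewrite eZ /= nc.
  by move=> w; rewrite inE => /eqP ->; rewrite (stage_nth ok Ks).
have [f1 e1 w1] := final_red fs_F ind.
have [x1 x2] := H [:: f] cf f1.
have vs := w1 v (mem_head _ _); rewrite cut_one in vs.
move: e1; rewrite cut_one eZ !big_cons !big_nil -eZ.
have [h1 h2] := K_size ht; rewrite v_size // in h1 h2.
have h3 := blob_le (subsetDl Fb [set f]) ht; have h4 := blob1 ht.
have [z1 y1] := blob_arith (esz (Fb :\ f) (src t)) d0 h3 h4.
rewrite z1 => e1; exists (esz (Fb :\ f) (src t)), (esz (Fb :\ f) v); split.
- by clear - e2 h1; nat_lia.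
- move=> K0; have vr : v = r by rewrite /v K0 s_root.
  have agr : agree F Fb r.
    move=> e y c ye; rewrite moved_set in_setU in_setD !in_set.
    have y0 : stage y = K by rewrite K0 -(conn_stage s c) (stage_root ok).
    have nqm m : List.In m (moves Z) -> stage (lmq m) != K.
      move=> hm; have [t' [ht' et' q _ _]] := move_item Zok hm.
      by rewrite q; apply: nq => //; rewrite et'.
    have -> : (e \in [seq lme m | m <- moves Z]) = false.
      apply/negP => /mem_mapP[m [hm ee]]; subst e.
      have [t' [ht' et' q [_ _ _ _ jm] _]] := move_item Zok hm.
      move: ye; rewrite (eqP jm) !inE => /orP[]/eqP ey; subst y.
        by have := nqm m hm; rewrite y0 eqxx.
      by have := Zy ht' et'; rewrite y0 eqxx.
    have -> : (e \in ins Z) = false.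
      apply/negP => /mem_mapP[m [hm ee]]; subst e.
      have [t' [ht' et' q [gF jm _ _ _] _]] := move_item Zok hm.
      have := nqm m hm; move: ye; rewrite (eqP jm) !inE => /orP[]/eqP ey; subst y.
        by rewrite -(conn_stage s (conn1 gF jm)) y0 eqxx.
      by rewrite y0 eqxx.
    by rewrite orbF.
  have cen := agree_central agr (ok_central ok).
  rewrite vr; by apply: (cen f b fin jb); rewrite -vr; exact: sub.
- by clear - e1 e3 h2 x1 y1; move: e1 e3 h2 x1 y1; abstract_subn; nat_lia.
- move=> K0; rewrite ltnNge; apply/negP => le.
  have lt : esz (Fb :\ f) v < esz F v by clear - e2 h1; nat_lia.
  have := x2 K0; rewrite -/v vs => x3; move: lt; rewrite ltnNge => /negP; apply; apply: x3.
  by clear - e1 e3 h2 le y1; move: e1 e3 h2 le y1; abstract_subn; nat_lia.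
Qed.

(** If the second source is alone in its piece, it was a leaf. The sum of the pieces is
    smaller by one if the leaf of a virtual item came from K. *)
Lemma exch2_early t1 t2 : Z = [:: t1; t2] -> early i Z K -> exists E1 E2,
  [/\ E1 + E2 < esz F v,
    esz F v - d < ((E1 + blob t1).+1 - d) + ((E2 + blob t2).+1 - d),
    (exists t, [/\ List.In t Z, move_of t & stage (tgt t) = K]) -> (E1 + E2).+1 < esz F v &
    E2 = 0 -> exists f, [/\ f \in F, src t2 \in ends f & forall g, g \in F ->
      src t2 \in ends g -> g = f \/ exists m, List.In m (moves Z) /\ g = lmg m]].
Proof.
move=> eZ ea; have ht1 : List.In t1 Z by rewrite eZ; left.
have ht2 : List.In t2 Z by rewrite eZ; right; left.
have ap : apart t1 t2 by move: Zap; rewrite eZ /= !andbT.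
have [c0 [c0s H]] := early_no Zok Zsrc ZK Ks ea.
have cc := srcs_conn ht1 ht2.
have [|f [cf nc e2 e3 [b [fin jb cb]]]] := cut_pair (c0 := c0) ht1 cc.
  by rewrite !c0s // src_neq.
have fs_F : {subset [:: f] <= F} by case: cf.
have ind : indep (Fb :\: [set g in [:: f]])
    (flatten [seq [:: src t; tgt t] | t <- Z] ++ [::]).
  apply: all_indep; rewrite ?cut_one //; first exact: subsetDl.
  by rewrite eZ /= nc.
have [f1 e1 _] := final_red fs_F ind.
have x1 : excess d (new_red Z [:: f]) <= excess d F -> False by exact: H.
move: e1; rewrite cut_one eZ !big_cons !big_nil -eZ.
have [h1 h2] := K_size ht1; rewrite v_size // in h1 h2.
have h3 := blob_le (subsetDl Fb [set f]) ht1; have h4 := blob1 ht1.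
have h5 := blob_le (subsetDl Fb [set f]) ht2; have h6 := blob1 ht2.
have [z1 y1] := blob_arith (esz (Fb :\ f) (src t1)) d0 h3 h4.
have [z2 y2] := blob_arith (esz (Fb :\ f) (src t2)) d0 h5 h6.
rewrite z1 z2 => e1.
exists (esz (Fb :\ f) (src t1)), (esz (Fb :\ f) (src t2)); split.
- by clear - e2 h1; nat_lia.
- rewrite ltnNge; apply/negP => le; apply: x1.
  by clear - e1 e3 h2 le y1 y2; move: e1 e3 h2 le y1 y2; abstract_subn; nat_lia.
- move=> [t [ht vt it]]; have h7 := K_self ht1 ht vt it.
  by rewrite v_size // in h7; clear - e2 h7; nat_lia.
move=> E0; exists f; split; first by apply: fs_F; rewrite inE.
  by rewrite -(esz0_conn E0 cb).
move=> g gF ge; case: (boolP (g \in ins Z)) => [/mem_mapP|ng]; first by right.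
left; apply/eqP; apply: contraT => gf; exfalso; apply: (esz_eq0 E0 _ ge).
by rewrite in_setD1 gf moved_set in_setU in_setD gF andbT in_set ng.
Qed.

Lemma exch2_late t1 t2 : Z = [:: t1; t2] -> ~~ early i Z K -> 0 < K -> exists E1 E2 Ev,
  E1 + E2 + Ev + 2 <= esz F v /\
  esz F v - d < ((E1 + blob t1).+1 - d) + ((E2 + blob t2).+1 - d) + (Ev - d).
Proof.
move=> eZ la K0; have ht1 : List.In t1 Z by rewrite eZ; left.
have ht2 : List.In t2 Z by rewrite eZ; right; left.
have ap : apart t1 t2 by move: Zap; rewrite eZ /= !andbT.
have [ls lv nq H] := late_no Zok Zsrc ZK Ks la.
have cc := srcs_conn ht1 ht2; have cv := v_conn la ht1; have vo := v_out la.
have [|||f1 [f2 [cf sF [n12 n13 n23] e2 e3]]] := cut_triple (c0 := new_root i Z) ht1 cc cv.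
- by rewrite !ls // src_neq.
- by rewrite ls // lv; have [[]] := Zok ht1.
- by rewrite ls // lv; have [[]] := Zok ht2.
have fs_F : {subset [:: f1; f2] <= F} by case: cf.
have ind : indep (Fb :\: [set f in [:: f1; f2]])
    (flatten [seq [:: src t; tgt t] | t <- Z] ++ [:: v]).
  apply: all_indep; rewrite ?cut_two //; first by rewrite eZ /= n12 n13 n23.
  by move=> w; rewrite inE => /eqP ->; rewrite (stage_nth ok Ks).
have [g1 e1 w1] := final_red fs_F ind.
have [x1 x2] := H [:: f1; f2] cf g1.
have vs := w1 v (mem_head _ _); rewrite cut_two in vs.
move: e1; rewrite cut_two eZ !big_cons !big_nil -eZ.
have [h1 h2] := K_size ht1; rewrite v_size // in h1 h2.
have h3 := blob_le sF ht1; have h4 := blob1 ht1.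
have h5 := blob_le sF ht2; have h6 := blob1 ht2.
have [z1 y1] := blob_arith (esz (Fb :\ f1 :\ f2) (src t1)) d0 h3 h4.
have [z2 y2] := blob_arith (esz (Fb :\ f1 :\ f2) (src t2)) d0 h5 h6.
rewrite z1 z2 => e1.
exists (esz (Fb :\ f1 :\ f2) (src t1)), (esz (Fb :\ f1 :\ f2) (src t2)),
  (esz (Fb :\ f1 :\ f2) v); split; first by clear - e2 h1; nat_lia.
rewrite ltnNge; apply/negP => le.
have lt : esz (Fb :\ f1 :\ f2) v < esz F v by clear - e2 h1; nat_lia.
have := x2 K0; rewrite -/v vs => x3; move: lt; rewrite ltnNge => /negP; apply; apply: x3.
by clear - e1 e3 h2 le y1 y2; move: e1 e3 h2 le y1 y2; abstract_subn; nat_lia.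
Qed.

Lemma exch3_early t1 t2 t3 : Z = [:: t1; t2; t3] -> early i Z K -> exists E1 E2 E3,
  E1 + E2 + E3 + 2 <= esz F v /\ esz F v - d < ((E1 + blob t1).+1 - d)
    + ((E2 + blob t2).+1 - d) + ((E3 + blob t3).+1 - d).
Proof.
move=> eZ ea; have ht1 : List.In t1 Z by rewrite eZ; left.
have ht2 : List.In t2 Z by rewrite eZ; right; left.
have ht3 : List.In t3 Z by rewrite eZ; right; right; left.
have [a12 a13 a23] : [/\ apart t1 t2, apart t1 t3 & apart t2 t3].
  by move: Zap; rewrite eZ /= !andbT => /andP[/andP[? ?] ?].
have [c0 [c0s H]] := early_no Zok Zsrc ZK Ks ea.
have cc := srcs_conn ht1 ht2; have cv := srcs_conn ht1 ht3.
have [|||f1 [f2 [cf sF [n12 n13 n23] e2 e3]]] := cut_triple (c0 := c0) ht1 cc cv.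
- by rewrite !c0s // src_neq.
- by rewrite !c0s // src_neq.
- by rewrite !c0s // src_neq.
have fs_F : {subset [:: f1; f2] <= F} by case: cf.
have ind : indep (Fb :\: [set f in [:: f1; f2]])
    (flatten [seq [:: src t; tgt t] | t <- Z] ++ [::]).
  by apply: all_indep; rewrite ?cut_two //; rewrite eZ /= n12 n13 n23.
have [g1 e1 _] := final_red fs_F ind.
have x1 : excess d (new_red Z [:: f1; f2]) <= excess d F -> False by exact: H.
move: e1; rewrite cut_two eZ !big_cons !big_nil -eZ.
have [h1 h2] := K_size ht1; rewrite v_size // in h1 h2.
have h3 := blob_le sF ht1; have h4 := blob1 ht1.
have h5 := blob_le sF ht2; have h6 := blob1 ht2.
have h7 := blob_le sF ht3; have h8 := blob1 ht3.
have [z1 y1] := blob_arith (esz (Fb :\ f1 :\ f2) (src t1)) d0 h3 h4.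
have [z2 y2] := blob_arith (esz (Fb :\ f1 :\ f2) (src t2)) d0 h5 h6.
have [z3 y3] := blob_arith (esz (Fb :\ f1 :\ f2) (src t3)) d0 h7 h8.
rewrite z1 z2 z3 => e1.
exists (esz (Fb :\ f1 :\ f2) (src t1)), (esz (Fb :\ f1 :\ f2) (src t2)),
  (esz (Fb :\ f1 :\ f2) (src t3)); split; first by clear - e2 h1; nat_lia.
rewrite ltnNge; apply/negP => le; apply: x1.
by clear - e1 e3 h2 le y1 y2 y3; move: e1 e3 h2 le y1 y2 y3; abstract_subn; nat_lia.
Qed.

End RedSide.

Lemma early_sub i Z Z' K : (forall t, List.In t Z -> List.In t Z') ->
  early i Z K -> early i Z' K.
Proof.
move=> sZ; have sU z : cut_off i Z z -> cut_off i Z' z.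
  by case/cut_offP => t [ht h]; apply/cut_offP; exists t; split=> //; exact: sZ.
case/orP => [/sU h|/existsP[z /and3P[h1 h2 /sU h3]]]; first by rewrite /early h.
by apply/orP; right; apply/existsP; exists z; rewrite h1 h2 h3.
Qed.

(** * Configurations excluded by minimality *)

Section Families.
Variables (i : 'I_k) (K : nat).
Let R := esz F (nth r s K).

(** If K and the attached tree together had less than d edges, the exchange would create
    no excess. At the root component, the part that is cut off has, together with the
    attached tree, fewer edges than K had, by centrality of r: the excess goes down. *)
Lemma one_item t : good i K t -> (d < 3 -> blob t = 0) -> 0 < K /\ d <= R + blob t.
Proof.
move=> gt small; have Ks := good_K gt; have b1 := blob_good gt.
have fam : family i K [:: t] by split=> // t0; case=> [<-|[]].
case: (boolP (early i [:: t] K)) => [ea|la].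
  have K0 := early_pos (family_ok fam) ea.
  have := exch1_early fam Ks erefl ea; rewrite -/R.
  by clear - K0; split=> //; nat_lia.
have [Ea [Ev [h1 h2 h3 h4]]] := exch1_late fam Ks erefl la.
rewrite -/R in h1 h3 h4; case: (posnP K) => [K0|K0]; last first.
  by split=> //; have := h4 K0; clear - h1 b1 d0; nat_lia.
exfalso; have big : d < R by rewrite /R K0 s_root; exact: ok_big ok.
have := h2 K0; case: ifP => d3 h5.
  have b0 := small d3; rewrite b0 in h3.
  by clear - h1 h3 h5 big d0; nat_lia.
have d3' : 3 <= d by rewrite leqNgt d3.
by clear - h1 h3 h5 big b1 d3'; nat_lia.
Qed.

(** In the late case an isolated vertex costs nothing, because the cut edge compensates
    for the new one. *)
Lemma isolated_early t : good i K t -> blob t = 0 -> early i [:: t] K.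
Proof.
move=> gt b0; have Ks := good_K gt; have [K0 _] := one_item gt (fun _ => b0).
have fam : family i K [:: t] by split=> // t0; case=> [<-|[]].
apply: contraT => la.
have [Ea [Ev [h1 _ _ h4]]] := exch1_late fam Ks erefl la.
by have := h4 K0; rewrite b0; clear - h1 d0; nat_lia.
Qed.

(** In the late case two edges of K are removed, and the excess of the three new trees is
    at most that of K. Hence the exchange is early, with one cut only. *)
Lemma two_items t1 t2 : good i K t1 -> good i K t2 -> ortho t1 t2 -> 0 < K ->
  blob t1 + blob t2 <= d -> early i [:: t1; t2] K /\ exists E1 E2,
  [/\ E1 + E2 < R, R - d < ((E1 + blob t1).+1 - d) + ((E2 + blob t2).+1 - d),
    (move_of t1 -> stage (tgt t1) = K -> (E1 + E2).+1 < R) &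
    (move_of t1 -> stage (tgt t1) != K) -> move_of t2 = None -> E2 = 0 ->
      exists f, [/\ f \in F, src t2 \in ends f &
        forall g, g \in F -> src t2 \in ends g -> g = f]].
Proof.
move=> g1 g2 o K0 bd; have Ks := good_K g1.
have fam : family i K [:: t1; t2].
  by split; [move=> t; case=> [<-|[<-|[]]]|rewrite /= o].
case: (boolP (early i [:: t1; t2] K)) => [ea|la]; last first.
  have [E1 [E2 [Ev [h1 h2]]]] := exch2_late fam Ks erefl la K0.
  have b1 := blob_good g1; have b2 := blob_good g2; rewrite -/R in h1 h2.
  by exfalso; clear - h1 h2 d0 bd b1 b2; nat_lia.
split=> //.
have [E1 [E2 [h1 h2 h3 h4]]] := exch2_early fam Ks erefl ea.
exists E1, E2; split=> //.
  by move=> v1 i1; apply: h3; exists t1; split=> //; left.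
move=> n1 v2 e2; have [f [fF' fe H]] := h4 e2; exists f; split=> // g gF ge.
case: (H g gF ge) => // -[m [hm gm]]; exfalso.
have [t [ht et q [lF j _ _ _] _]] := move_item (family_ok fam) hm.
case: ht et q => [<-|[<-|[]]]; last by rewrite v2.
move=> et q; have := n1; rewrite et => /(_ isT)/negP; apply; apply/eqP.
have [_ <- _] := g2; rewrite -q; move: ge; rewrite gm (eqP j) !inE => /orP[]/eqP -> //.
by rewrite (conn_stage s (conn1 lF j)).
Qed.

Lemma two_isolated t1 t2 : good i K t1 -> good i K t2 -> ortho t1 t2 ->
  blob t1 = 0 -> blob t2 = 0 -> False.
Proof.
move=> g1 g2 o b1 b2; have [K0 _] := one_item g1 (fun _ => b1).
have [|_ [E1 [E2 [h1 h2 _ _]]]] := two_items g1 g2 o K0; first by rewrite b1 b2.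
by rewrite b1 b2 in h2; clear - h1 h2 d0; nat_lia.
Qed.

Lemma two_small t1 t2 : good i K t1 -> good i K t2 -> ortho t1 t2 -> 0 < K -> 2 < d ->
  d <= R.
Proof.
move=> g1 g2 o K0 d3; have b1 := blob_good g1; have b2 := blob_good g2.
have [|_ [E1 [E2 [h1 h2 _ _]]]] := two_items g1 g2 o K0; first by clear - b1 b2 d3; nat_lia.
by rewrite leqNgt; apply/negP => lt; clear - h1 h2 lt b1 b2; nat_lia.
Qed.

Lemma isolated_leaf t1 t2 : good i K t1 -> good i K t2 -> ortho t1 t2 -> 0 < K -> 2 < d ->
  blob t2 = 0 -> move_of t2 = None -> (move_of t1 -> stage (tgt t1) != K) ->
  exists f, [/\ f \in F, src t2 \in ends f &
    forall g, g \in F -> src t2 \in ends g -> g = f].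
Proof.
move=> g1 g2 o K0 d3 b2 n2 n1; have b1 := blob_good g1.
have [|_ [E1 [E2 [h1 h2 _ h4]]]] := two_items g1 g2 o K0; first by clear - b1 b2 d3; nat_lia.
by apply: h4 => //; rewrite b2 in h2; clear - h1 h2 b1 d3; nat_lia.
Qed.

Lemma two_self t1 t2 : good i K t1 -> good i K t2 -> ortho t1 t2 -> 0 < K -> 2 < d ->
  move_of t1 -> stage (tgt t1) = K -> False.
Proof.
move=> g1 g2 o K0 d3 v1 i1; have b1 := blob_good g1; have b2 := blob_good g2.
have [|_ [E1 [E2 [_ h2 h3 _]]]] := two_items g1 g2 o K0; first by clear - b1 b2 d3; nat_lia.
by have := h3 v1 i1; clear - h2 b1 b2 d3; nat_lia.
Qed.

(** The exchange is early, already for two of the items, and the excess of the three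
    trees made out of K and the items is at most that of K. *)
Lemma three_items t1 t2 t3 : good i K t1 -> good i K t2 -> good i K t3 -> ortho t1 t2 ->
  ortho t1 t3 -> ortho t2 t3 -> 0 < K -> 2 < d -> False.
Proof.
move=> g1 g2 g3 o12 o13 o23 K0 d3; have Ks := good_K g1.
have b1 := blob_good g1; have b2 := blob_good g2; have b3 := blob_good g3.
have [|ea _] := two_items g1 g2 o12 K0; first by clear - b1 b2 d3; nat_lia.
have fam : family i K [:: t1; t2; t3].
  by split; [move=> t; case=> [<-|[<-|[<-|[]]]]|rewrite /= o12 o13 o23].
have ea3 : early i [:: t1; t2; t3] K.
  by apply: early_sub ea => t; case=> [<-|[<-|[]]]; [left|right; left].
have [E1 [E2 [E3 [h1 h2]]]] := exch3_early fam Ks erefl ea3.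
rewrite -/R in h1 h2; by clear - h1 h2 b1 b2 b3 d3; nat_lia.
Qed.

End Families.

Lemma desc_explored i z x : explored z -> desc i z x -> explored x.
Proof.
move=> hz /connectP[t]; elim: t z hz => [|w t IH] z hz /=; first by move=> _ ->.
by case/andP=> /eqP <- pp e; apply: IH pp e; exact: explored_parent.
Qed.

(** The last vertex before x on the path of ancestors from z to x. *)
Lemma desc_last i z x : desc i z x -> z = x \/ exists h, [/\ desc i z h, ph i h = x & h != x].
Proof.
case/connectP => t; elim: t z => [|w t IH] z /=; first by move=> _ ->; left.
case/andP=> /eqP zw pp e; case: (eqVneq z x) => [->|zx]; first by left.
right; case: (IH w pp e) => [wx|[h [h1 h2 h3]]].
  by exists z; split; [exact: connect0|rewrite zw|].
by exists h; split=> //; apply: desc_trans h1; exact: desc_parent.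
Qed.

(** If the red neighbour p of the leaf x were not a descendant of x, then x could trade
    its red edge to p against the blue edge to its isolated child, and its component
    would get smaller. *)
Lemma leaf_desc i K t g p : good i K t -> move_of t = None -> esz F (tgt t) = 0 ->
  1 < esz F (nth r s K) -> g \in F -> joins g p (src t) ->
  (forall f, f \in F -> src t \in ends f -> f = g) -> desc i p (src t).
Proof.
move=> gt nt e0 big gF jg leaf; apply: contraT => nd; exfalso.
have Ks := good_K gt; have b0 : blob t = 0 by rewrite /blob nt.
have [K0 _] := one_item gt (fun _ => b0).
case: gt => -[[hx xr px vb tv]]; rewrite nt => -[_ lt] xK _.
set x := src t in jg leaf nd hx xr px tv lt xK; set y := tgt t in e0 px lt.
have jv : joins (via t) x y by have := (rt_graph (rt i)).1 _ vb; rewrite tv px.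
pose m := LeafMove g p x y (via t).
have mok : move_ok F m by split.
have nxy : ~~ conn F x y by apply/negP => c; rewrite (conn_stage s c) ltnn in lt.
pose cl e := if e == via t then None else if e == g then Some i else col e.
have gv : g != via t by apply/negP => /eqP e; apply: (red_blue gF (c := i)); rewrite e.
have redE : red cl = moved F m.
  apply/setP => e; rewrite in_set in_setU1 in_setD1 in_set /cl.
  case: (eqVneq e (via t)) => //= nv; by case: (eqVneq e g).
pose X1 := g |: (blue col i :\ via t).
have blueE : blue cl i = X1.
  apply/setP => e; rewrite in_set in_setU1 in_setD1 in_set /cl.
  case: (eqVneq e (via t)) => [->|nv] /=; first by rewrite [via t == g]eq_sym (negPf gv).
  by case: (eqVneq e g) => //=; rewrite eqxx.
have blueO c : c != i -> blue cl c = blue col c.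
  move=> ci; apply/setP => e; rewrite !in_set /cl.
  case: (eqVneq e (via t)) => [->|nv].
    by move: vb; rewrite in_set => /eqP ->; rewrite (inj_eq Some_inj) [i == c]eq_sym (negPf ci).
  case: (eqVneq e g) => [->|//].
  by move: gF; rewrite in_set => /eqP ->; rewrite (inj_eq Some_inj) [i == c]eq_sym (negPf ci).
pose phi1 z := if z == x then p else ph i z.
pose M := (\max_(w : V) mu i w).+1.
pose mu1 z := (if desc i z x then M else 0) + mu i z.
have D1 : decr phi1 mu1.
  move=> z; rewrite /phi1 /mu1; case: (eqVneq z x) => [->|zx] nz.
    rewrite (negPf nd) [desc i x x]connect0 add0n.
    by apply: leq_trans (leq_addr _ _); rewrite ltnS; apply: leq_bigmax.
  have l1 := rt_decr (rt i) nz; rewrite -addnS; apply: leq_add => //.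
  case: ifP => // h; case: ifP => // /negP[].
  by apply: desc_trans h; exact: desc_parent.
pose ta1 e := if e == g then x else ta i e.
have gr : pgraph X1 phi1 ta1.
  have old e : e \in blue col i :\ via t -> e != g /\ ta i e != x.
    rewrite in_setD1 => /andP[nv eb]; split.
      by apply/negP => /eqP ee; apply: (red_blue gF (c := i)); rewrite -ee.
    apply: contra nv => /eqP h; apply/eqP; apply: ta_inj eb vb _; by rewrite tv.
  split=> [e|e e']; rewrite !in_setU1.
    case/orP => [/eqP ->|h]; first by rewrite /ta1 /phi1 !eqxx joins_sym.
    have [h1 h2] := old e h; rewrite /ta1 /phi1 (negPf h1) (negPf h2).
    by apply: (rt_graph (rt i)).1; move: h; rewrite in_setD1 => /andP[].
  rewrite /ta1; case/orP => [/eqP ->|h]; case/orP => [/eqP ->|h'] //.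
  - by have [h1 h2] := old e' h'; rewrite eqxx (negPf h1) => e1; rewrite -e1 eqxx in h2.
  - by have [h1 h2] := old e h; rewrite eqxx (negPf h1) => e1; rewrite e1 eqxx in h2.
  have [h1 _] := old e h; have [h2 _] := old e' h'; rewrite (negPf h1) (negPf h2).
  by move: h h'; rewrite !in_setD1 => /andP[_ h] /andP[_ h']; exact: ta_inj.
have fB1 c : forest (blue cl c).
  case: (eqVneq c i) => [->|ci]; last by rewrite blueO.
  by rewrite blueE; exact: pgraph_forest D1 gr.
have fF1 : forest (red cl) by rewrite redE; exact: moved_forest fF mok nxy.
have xp : p != x := joins_neq jg.
have cpx : conn F p x := conn1 gF jg.
have hp : explored p by rewrite /explored_in (conn_stage s cpx).
have py : p != y by apply: contra nxy => /eqP <-; rewrite connC.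
have yK l : l <= K -> l < stage y by rewrite -xK => h; exact: leq_ltn_trans h lt.
have ag l : l < K -> agree F (red cl) (nth r s l).
  move=> lK e z c ze; have ls : l < size s := ltn_trans lK Ks.
  have iz := stage_eq ok ls c; rewrite redE in_setU1 in_setD1.
  have -> : (e == via t) = false.
    apply/negP => /eqP ee; subst e; move: ze; rewrite (eqP jv) !inE => /orP[]/eqP h.
      by move: lK; rewrite -iz h xK ltnn.
    by have := yK l (ltnW lK); rewrite -iz h ltnn.
  case: (eqVneq e g) => //= ee; subst e; exfalso.
  move: ze; rewrite (eqP jg) !inE => /orP[]/eqP h; move: lK; rewrite -iz h ?(conn_stage s cpx) xK ltnn //.
have leg : legal cl (red cl) r s K.+1.
  apply: (@legal_keep i phi1 mu1 X1 cl (fun z => explored z)) => //.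
  - move=> z hz; rewrite /phi1; case: (eqVneq z x) => [->|zx] nz.
      split=> //; exists g; first exact: setU11.
      by rewrite joins_sym.
    split; first exact: explored_parent.
    have [e eb te] := rt_full (rt i) nz; exists e.
      rewrite in_setU1 in_setD1 eb andbT; apply/orP; right.
      by apply: contra zx => /eqP h; rewrite -te h tv.
    by have := (rt_graph (rt i)).1 e eb; rewrite te.
  - move=> z hz; rewrite /phi1; case: (eqVneq z x) => [ez h|_]; last exact: explored_fix.
    by rewrite h ez eqxx in xp.
  - move=> u l lK hu uK pu; split=> //; rewrite /phi1; case: (eqVneq u x) => // ux.
    have := yK l lK; rewrite -px -ux pu (stage_nth ok) ?ltnn //.
    exact: leq_ltn_trans lK Ks.
  - by rewrite blueE.
have ex1 : excess d (red cl) <= excess d F.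
  have := moved_excess fF mok d0 nxy xp py; have := moved_esz mok xp py.
  by rewrite redE; move: (conn F p _) => b h1; rewrite -/F => h2; clear - h1 h2; nat_lia.
have := improve_lex ok minimal fB1 fF1 (introT andP (conj K0 Ks)) leg ex1 ag.
rewrite leqNgt => /negP; apply; rewrite redE.
case: (eqVneq (nth r s K) x) => [vx|vx].
  rewrite vx in big *; apply: leq_ltn_trans big; exact: (moved_esz_q mok nxy).
have vy : nth r s K != y.
  by apply/negP => /eqP h; have := yK K (leqnn _); rewrite -h (stage_nth ok) ?ltnn.
have := moved_esz mok vx vy.
have -> : conn F (nth r s K) (lmq m).
  by rewrite -xK; exact: stage_conn hx.
by rewrite addn1.
Qed.

(** The virtual item hangs from the last vertex h before the leaf x on the blue path from
    p to x; the edge from h to x becomes red together with the edge from x to its isolated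
    child, and the edge px becomes blue. *)
Lemma virtual_item i K t : good i K t -> move_of t = None -> esz F (tgt t) = 0 ->
  1 < esz F (nth r s K) -> (exists f, [/\ f \in F, src t \in ends f &
    forall g, g \in F -> src t \in ends g -> g = f]) ->
  exists t' m, [/\ item_ok i t', move_of t' = Some m, tgt t' = src t, lmy m = tgt t &
    stage (tgt t) != stage (src t')].
Proof.
move=> gt nt e0 big [g [gF xg leaf]].
have Ks := good_K gt; have b0 : blob t = 0 by rewrite /blob nt.
have [p jg] := ends_joins xg; rewrite joins_sym in jg.
have dp := leaf_desc gt nt e0 big gF jg leaf.
case: (desc_last dp) => [px|[h [dh phx hx]]]; first by have := joins_neq jg; rewrite px eqxx.
have ea := isolated_early gt b0.
case: (gt) => -[[ix xr px vb tv]]; rewrite nt => -[_ lt] xK _.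
have hp : explored p by rewrite /explored_in (conn_stage s (conn1 gF jg)).
have nh : ph i h != h by rewrite phx eq_sym.
have [eh ehb eht] := rt_full (rt i) nh.
have jv : joins (via t) (src t) (tgt t).
  by have := (rt_graph (rt i)).1 _ vb; rewrite tv px.
pose m := LeafMove g p (src t) (tgt t) (via t).
exists (Item h (src t) eh (Some m)), m; split=> //=; last first.
  apply/negP => /eqP e; have h0 : h = tgt t.
    apply: (esz0_conn e0); apply: (same_stage r (s := s)) => //.
    by rewrite -px; exact: explored_parent.
  have := rt_decr (rt i) nh; have nx : ph i (src t) != src t by rewrite px -h0.
  by have := rt_decr (rt i) nx; rewrite phx px h0; clear; nat_lia.
split; first split=> //=.
- exact: desc_explored hp dh.
- by apply: contra xr => /eqP hr; rewrite -phx hr (rt_root (rt i)).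
split; first by split.
split=> //= out; case/orP: ea => [/cut_offP[t0 [[<-|[]]]]|/existsP[z /and3P[hz zK /cut_offP[t0 [[<-|[]]]]]]].
  by rewrite /top nt xK.
rewrite /top nt => dz; exfalso; have := out z hz dz; rewrite xK leqNgt zK.
by [].
Qed.

(** * Counting small components *)

Section Counting.
Hypothesis k0 : 0 < k.
Hypothesis dk : d <= 2 * (k + 1).
(** Components are numbered from 0, the root component being left out. *)
Let N := (size s).-1.
Let ez (l : nat) := esz F (nth r s l.+1).
(** How much a component with one edge falls short; 0 if it is large enough. *)
Let delta := d - k.+1.

Lemma lN (l : 'I_N) : l.+1 < size s.
Proof. by rewrite -(prednK s_pos) ltnS. Qed.

Lemma ez_stage w (l : nat) : explored w -> stage w = l.+1 -> esz F w = ez l.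
Proof. by move=> hw e; rewrite /ez -e -(esz_conn (stage_conn r hw)). Qed.

Definition arc_item (i : 'I_k) (l : nat) t := [/\ tgt t = nth r s l.+1, move_of t = None,
  stage (src t) < l.+1 & [/\ explored (src t), src t != r, ph i (src t) = tgt t,
  via t \in blue col i & ta i (via t) = src t]].

(** Choosing one entry arc for each component avoids counting a small component twice,
    and keeps the components touched by different items apart. *)
Lemma entry_arcs : exists (c : 'I_N -> 'I_k) (R : 'I_N -> item), forall l, arc_item (c l) l (R l).
Proof.
have ex (l : 'I_N) : exists cR : 'I_k * item, arc_item cR.1 l cR.2.
  have [c [u [m [lm cu ar]]]] := s_legal.1 l.+1 (lN l).
  have pu := darc_parent (@fB c) (rt c) ar.
  have iu : stage u = m by apply: (stage_eq ok _ cu); exact: ltn_trans lm (lN l).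
  have nu : ph c u != u by rewrite pu; have [e [_ j _]] := ar; rewrite eq_sym; exact: joins_neq j.
  have [e eb te] := rt_full (rt c) nu.
  exists (c, Item u (nth r s l.+1) e None); split; rewrite /= ?iu //; split=> //.
    by rewrite /explored_in iu; exact: ltn_trans lm (lN l).
  by apply: contra nu => /eqP ->; rewrite (rt_root (rt c)).
have [f hf] := fin_all_exists ex.
by exists (fun l => (f l).1), (fun l => (f l).2).
Qed.

Section Arcs.
Variables (c : 'I_N -> 'I_k) (A : 'I_N -> item).
Implicit Types l : 'I_N.
Hypothesis Aok : forall l, arc_item (c l) l (A l).

Let par l := stage (src (A l)).

Lemma A_stage l : stage (tgt (A l)) = l.+1.
Proof. by have [-> _ _ _] := Aok l; rewrite (stage_nth ok) // lN. Qed.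

Lemma A_ez l : esz F (tgt (A l)) = ez l.
Proof. by have [-> _ _ _] := Aok l. Qed.

Lemma A_good l : ez l <= 1 -> good (c l) (par l) (A l).
Proof.
move=> small; have [e1 e2 e3 e4] := Aok l; split=> //; last by move=> m; rewrite e2.
by split=> //; rewrite e2 A_ez A_stage.
Qed.

Definition leafb x := [exists f in F, (x \in ends f) &&
  [forall g in F, (x \in ends g) ==> (g == f)]].

Lemma leafP x : reflect (exists f, [/\ f \in F, x \in ends f &
  forall g, g \in F -> x \in ends g -> g = f]) (leafb x).
Proof.
apply: (iffP existsP) => [[f /and3P[h1 h2 /forallP h3]]|[f [h1 h2 h3]]]; exists f.
  by split=> // g gF xg; apply/eqP; have := h3 g; rewrite gF xg.
by rewrite h1 h2; apply/forallP => g; apply/implyP => gF; apply/implyP => /(h3 g gF) ->.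
Qed.

Definition isolated i l := (c l == i) && (ez l == 0).
Definition single i l := (c l == i) && (ez l == 1).
(** The isolated children that give rise to a virtual item. *)
Definition movable i l := [&& isolated i l, 1 < esz F (nth r s (par l)) & leafb (src (A l))].

Lemma virtual_items : exists W : 'I_N -> item, forall i l, movable i l ->
  exists m, [/\ item_ok i (W l), move_of (W l) = Some m, tgt (W l) = src (A l),
    lmy m = tgt (A l) & stage (tgt (A l)) != stage (src (W l))].
Proof.
have ex (l : 'I_N) : exists t, forall i, movable i l ->
    exists m, [/\ item_ok i t, move_of t = Some m, tgt t = src (A l),
      lmy m = tgt (A l) & stage (tgt (A l)) != stage (src t)].
  case: (boolP (movable (c l) l)) => [/and3P[/andP[_ /eqP e0] big /leafP lf]|nv]; last first.
    by exists (A l) => i vi; case/negP: nv; have [/andP[/eqP -> _] _ _] := and3P vi.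
  have gA : good (c l) (par l) (A l) by apply: A_good; rewrite e0.
  have [_ nA _ _] := Aok l.
  have [|t [m h]] := virtual_item gA nA _ big lf; first by rewrite A_ez.
  by exists t => i /and3P[/andP[/eqP <- _] _ _]; exists m.
have [W hW] := fin_all_exists ex.
by exists W => i l; exact: hW.
Qed.

Section Colour.
Variables (W : 'I_N -> item) (i : 'I_k).
Hypothesis Wok : forall l, movable i l ->
  exists m, [/\ item_ok i (W l), move_of (W l) = Some m, tgt (W l) = src (A l),
    lmy m = tgt (A l) & stage (tgt (A l)) != stage (src (W l))].

(** The items of colour i that attach one edge, real ones and virtual ones, and the
    component where each of them lands. *)
Let T l := if ez l == 0 then W l else A l.
Let J l := single i l || movable i l.
Let land l := stage (src (T l)).

Lemma isolated_good l : isolated i l -> good i (par l) (A l) /\ blob (A l) = 0.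
Proof.
case/andP=> /eqP ci /eqP e0; rewrite -ci; split; first by apply: A_good; rewrite e0.
by have [_ nA _ _] := Aok l; rewrite /blob nA A_ez.
Qed.

Lemma isolated_ortho l l' : isolated i l -> isolated i l' -> l != l' -> ortho (A l) (A l').
Proof.
move=> _ _ ne; have [_ n1 _ _] := Aok l; have [_ n2 _ _] := Aok l'.
rewrite /ortho n1 n2 !andbT /apart /touched n1 n2 /= !A_stage eqSS !andbT.
exact: ne.
Qed.

Lemma isolated_uniq l l' : isolated i l -> isolated i l' -> par l = par l' -> l = l'.
Proof.
move=> h h' e; apply/eqP; apply: contraT => ne; exfalso.
have [g b] := isolated_good h; have [g' b'] := isolated_good h'; rewrite -e in g'.
exact: two_isolated g g' (isolated_ortho h h' ne) b b'.
Qed.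

Lemma T_real l : single i l -> T l = A l.
Proof. by case/andP=> _ /eqP e; rewrite /T e. Qed.

Lemma T_virt l : movable i l -> T l = W l.
Proof. by case/and3P=> /andP[_ e] _ _; rewrite /T e. Qed.

Lemma T_good l : J l -> good i (land l) (T l).
Proof.
case/orP => [h|h].
  rewrite /land T_real //; case/andP: h => /eqP <- /eqP e1; apply: A_good; by rewrite e1.
have [m [h1 h2 h3 h4 h5]] := Wok h; rewrite /land T_virt //; split=> // m'.
by rewrite h2 => -[<-]; rewrite h4.
Qed.

Lemma T_touched l w : J l -> w \in touched (T l) ->
  stage w = l.+1 /\ esz F w <= 1 \/ [/\ movable i l, w = src (A l) & 1 < esz F w].
Proof.
case/orP => [h|h].
  rewrite T_real // /touched; have [_ -> _ _] := Aok l; rewrite inE => /eqP ->.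
  by left; rewrite A_stage A_ez; case/andP: h => _ /eqP ->.
have [m [h1 h2 h3 h4 h5]] := Wok h; rewrite T_virt // /touched h2 !inE h3 h4.
case/orP => /eqP ->; last first.
  by left; rewrite A_stage A_ez; case/and3P: h => /andP[_ /eqP ->].
right; split=> //; case/and3P: h => _ h _.
have [_ _ _ [hs _ _ _ _]] := Aok l.
by rewrite -(esz_conn (stage_conn r hs)).
Qed.

Lemma T_apart l l' : J l -> J l' -> l != l' -> apart (T l) (T l').
Proof.
move=> hl hl' ne; apply/allP => w hw; apply/allP => w' hw'; apply/negP => /eqP e.
have inW l0 w0 : J l0 -> w0 \in touched (T l0) -> explored w0.
  move=> h0; have [_ _ _ [h1 h2 h3 h4 h5]] := Aok l0.
  case/(T_touched h0) => [[e0 _]|[_ -> _ //]].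
  by rewrite /explored_in e0 lN.
have ce := esz_conn (same_stage r (inW _ _ hl hw) e).
case: (T_touched hl hw) => [[i1 s1]|[v1 w1 s1]];
  case: (T_touched hl' hw') => [[i2 s2]|[v2 w2 s2]].
- by rewrite i1 i2 in e; case: e ne => e; rewrite (ord_inj e) eqxx.
- by rewrite ce leqNgt s2 in s1.
- by rewrite ce ltnNge s2 in s1.
- move: ne; rewrite (@isolated_uniq l l') ?eqxx //; first by case/and3P: v1.
    by case/and3P: v2.
  by rewrite /par -w1 -w2.
Qed.

Lemma AT_apart l0 l : isolated i l0 -> J l -> l0 != l -> apart (A l0) (T l).
Proof.
move=> h0 hl ne; have [_ nA _ _] := Aok l0.
apply/allP => w; rewrite /touched nA inE => /eqP ->.
apply/allP => w' hw'; apply/negP => /eqP e.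
have hA : explored (tgt (A l0)) by rewrite /explored_in A_stage lN.
have ce := esz_conn (same_stage r hA e).
case: (T_touched hl hw') => [[i2 s2]|[v2 w2 s2]].
  by rewrite A_stage i2 in e; case: e ne => e; rewrite (ord_inj e) eqxx.
by move: s2; rewrite -ce A_ez; case/andP: h0 => _ /eqP ->.
Qed.

(** Sources of different items differ, since their targets do. *)
Lemma src_T l t : J l -> (forall w, w \in touched t -> stage w != l.+1) -> tgt t \in touched t ->
  ph i (src t) = tgt t -> move_of (T l) -> src t != tgt (T l).
Proof.
case/orP => [h|h] nt tt pt.
  by rewrite T_real //; have [_ -> _ _] := Aok l.
have [m [_ h2 h3 _ _]] := Wok h; rewrite T_virt // h2 h3 => _.
have ci : c l = i by case/and3P: h => /andP[/eqP].
have [_ _ _ [_ _ h6 _ _]] := Aok l; rewrite ci in h6.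
by apply: contra (nt _ tt) => /eqP e; rewrite -pt e h6 A_stage.
Qed.

Lemma tgt_touched t : tgt t \in touched t.
Proof. by rewrite /touched; case: (move_of t) => [m|]; rewrite inE eqxx. Qed.

Lemma T_neq_stage l l' w : J l -> l != l' -> ez l' <= 1 -> w \in touched (T l) -> stage w != l'.+1.
Proof.
move=> hl ne small hw; case: (T_touched hl hw) => [[-> _]|[v1 -> s1]].
  by rewrite eqSS; exact: ne.
have [_ _ _ [hs _ _ _ _]] := Aok l.
by apply/negP => /eqP e; rewrite (ez_stage hs e) ltnNge small in s1.
Qed.

Lemma J_small l : J l -> ez l <= 1.
Proof. by case/orP => [/andP[_ /eqP ->]|/and3P[/andP[_ /eqP ->]]]. Qed.

Lemma T_ph l : J l -> ph i (src (T l)) = tgt (T l).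
Proof. by move=> h; have [[[_ _ -> _ _] _] _ _] := T_good h. Qed.

Lemma T_ortho l l' : J l -> J l' -> l != l' -> ortho (T l) (T l').
Proof.
move=> h h' ne; apply/and3P; split; [exact: T_apart|apply/implyP..].
  apply: src_T => //; [|exact: tgt_touched|exact: T_ph].
  by move=> w; apply: T_neq_stage => //; exact: J_small.
apply: src_T => //; [|exact: tgt_touched|exact: T_ph].
by move=> w; apply: T_neq_stage => //; [rewrite eq_sym|exact: J_small].
Qed.

Lemma TA_ortho l l0 : J l -> isolated i l0 -> l != l0 -> ortho (T l) (A l0).
Proof.
move=> h h0 ne; have [_ nA _ [_ _ pA _ _]] := Aok l0.
have ci : c l0 = i by case/andP: h0 => /eqP.
rewrite /ortho nA /=; apply/andP; split.
  by apply: apart_sym; apply: AT_apart; rewrite // eq_sym.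
apply/implyP; apply: src_T => //; [|exact: tgt_touched|by rewrite -ci].
move=> w; rewrite /touched nA inE => /eqP ->; rewrite A_stage eqSS eq_sym; exact: ne.
Qed.

(** Whether K has an isolated child, whether that child is movable, and how many other
    items K can hold. *)
Let hasI (K : 'I_N) := [exists l, isolated i l && (par l == K.+1)].
Let hasV (K : 'I_N) := [exists l, movable i l && (par l == K.+1)].
Let room (K : 'I_N) := if hasI K then 0 else if d <= ez K then 2 else
  if d == (ez K).+1 then 1 else 0.

Lemma isolated_big (K : 'I_N) : hasI K -> d <= ez K.
Proof.
case/existsP => l /andP[h /eqP pl]; have [g b0] := isolated_good h.
have [_] := one_item g (fun _ => b0).
by rewrite b0 addn0 pl.
Qed.

(** If K has an isolated child and an item lands at K, then the child is movable, and no
    second item lands at K. Otherwise the number of items is limited by the size of K. A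
    virtual item that lands in the component of its own leaf conflicts with the isolated
    child, and is treated by [two_self]. *)
Lemma land_bound (K : 'I_N) : 2 < d ->
  #|[pred l | J l && (land l == K.+1)]| <= hasV K + room K.
Proof.
move=> d3; pose S := [pred l | J l && (land l == K.+1)]; rewrite -/S.
have GS l : l \in S -> J l /\ good i K.+1 (T l).
  by rewrite inE => /andP[h /eqP e]; split=> //; rewrite -e; exact: T_good.
have leR l : l \in S -> d <= (ez K).+1.
  move=> /GS[_ g]; have [|_ h] := one_item g; first by move=> lt; clear - lt d3; nat_lia.
  by have b := blob_good g; rewrite -/(ez K) in h; clear - h b; nat_lia.
have self l : l \in S -> movable i l -> move_of (T l) /\ stage (tgt (T l)) = par l.
  by move=> lS h; have [m [_ h2 h3 _ _]] := Wok h; rewrite T_virt // h2 h3.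
have noself l : l \in S -> (movable i l && (par l == K.+1)) = false ->
    move_of (T l) -> stage (tgt (T l)) != K.+1.
  move=> lS nv; have [Jl _] := GS l lS; case/orP: (Jl) => [h|h].
    by rewrite T_real //; have [_ -> _ _] := Aok l.
  by have [_ ->] := self l lS h; move: nv; rewrite h /= => ->.
rewrite /room; case: ifP => [hI|nI].
  have [l0 /andP[h0 /eqP p0]] := existsP hI.
  have [g0 b0] := isolated_good h0; rewrite p0 in g0; have [_ nA _ _] := Aok l0.
  have ne0 l : l \in S -> (movable i l && (par l == K.+1)) = false -> l != l0.
    move=> lS nv; apply: contraTneq (GS l lS).1 => ll; subst l; apply/negP.
    case/orP => [/andP[_ /eqP e]|h]; last by rewrite h p0 eqxx in nv.
    by case/andP: h0 => _; rewrite e.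
  rewrite addn0; case: (pickP S) => [l1 l1S|/eq_card0 -> //].
  have [J1 g1] := GS l1 l1S.
  have -> : hasV K.
    case v1: (movable i l1 && (par l1 == K.+1)); first by apply/existsP; exists l1.
    have o := TA_ortho J1 h0 (ne0 l1 l1S v1).
    have lf := isolated_leaf g1 g0 o (ltn0Sn _) d3 b0 nA (noself l1 l1S v1).
    apply/existsP; exists l0; rewrite /movable h0 p0 eqxx andbT /=.
    apply/andP; split; last exact/leafP.
    by apply: leq_trans (isolated_big hI); exact: ltnW.
  apply/card_le1_eqP => l2 l3 l2S l3S; apply/eqP; apply: contraT => ne; exfalso.
  rewrite eq_sym in ne.
  have [J2 g2] := GS l2 l2S; have [J3 g3] := GS l3 l3S.
  case v2: (movable i l2 && (par l2 == K.+1)).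
    case/andP: v2 => v2 /eqP p2; have [m2 t2] := self l2 l2S v2; rewrite p2 in t2.
    exact: two_self g2 g3 (T_ortho J2 J3 ne) _ d3 m2 t2.
  rewrite eq_sym in ne.
  case v3: (movable i l3 && (par l3 == K.+1)).
    case/andP: v3 => v3 /eqP p3; have [m3 t3] := self l3 l3S v3; rewrite p3 in t3.
    exact: two_self g3 g2 (T_ortho J3 J2 ne) _ d3 m3 t3.
  exact: three_items g3 g2 g0 (T_ortho J3 J2 ne) (TA_ortho J3 h0 (ne0 _ l3S v3))
    (TA_ortho J2 h0 (ne0 _ l2S v2)) _ d3.
apply: leq_trans (leq_addl _ _); case: ifP => [big|sm].
  rewrite leqNgt; apply/negP => /card_gt2P[l1 [l2 [l3 [[s1 s2 s3] [n12 n23 n31]]]]].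
  have [J1 g1] := GS l1 s1; have [J2 g2] := GS l2 s2; have [J3 g3] := GS l3 s3.
  rewrite eq_sym in n31.
  exact: three_items g1 g2 g3 (T_ortho J1 J2 n12) (T_ortho J1 J3 n31) (T_ortho J2 J3 n23) _ d3.
case: (pickP S) => [l1 l1S|/eq_card0 -> //].
have le := leR l1 l1S; have -> : d == (ez K).+1.
  by rewrite eqn_leq le ltnNge sm.
apply/card_le1_eqP => l2 l3 l2S l3S; apply/eqP; apply: contraT => ne; exfalso.
  rewrite eq_sym in ne.
have [J2 g2] := GS l2 l2S; have [J3 g3] := GS l3 l3S.
by have := two_small g2 g3 (T_ortho J2 J3 ne) (ltn0Sn _) d3; rewrite -/(ez K) sm.
Qed.

Lemma sum_card (P : pred 'I_N) : \sum_l (P l : nat) = #|P|.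
Proof.
rewrite -sum1_card [RHS]big_mkcond; apply: eq_bigr => l _.
by rewrite unfold_in; case: (P l).
Qed.

Lemma double_count (P : pred 'I_N) (f : 'I_N -> nat) : (forall l, P l -> 0 < f l < size s) ->
  \sum_l (P l : nat) = \sum_(K < N) #|[pred l | P l && (f l == K.+1)]|.
Proof.
move=> h; under [RHS]eq_bigr => K _ do rewrite -sum_card.
rewrite exchange_big; apply: eq_bigr => l _ /=; case Pl: (P l); last first.
  by rewrite big1.
have /andP[f0 fs] := h l Pl; have lt : (f l).-1 < N by rewrite -ltnS !prednK // s_pos.
rewrite (bigD1 (Ordinal lt)) //= prednK // eqxx big1 // => K ne.
case: eqP => // e; case/negP: ne; apply/eqP/ord_inj; by rewrite /= e.
Qed.

(** Summing [land_bound], the number of virtual items on the left cancels against the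
    number of components with a movable child on the right. *)
Lemma colour_bound :
  \sum_l (d * isolated i l + delta * single i l)
  <= \sum_(K < N) (d * (d <= ez K) + delta * (d == (ez K).+1)).
Proof.
have pos l : isolated i l -> 0 < par l < size s.
  move=> h; have [g b0] := isolated_good h; have [p0 _] := one_item g (fun _ => b0).
  by rewrite p0 (good_K g).
have hI : \sum_l (isolated i l : nat) <= \sum_(K < N) (hasI K : nat).
  rewrite (double_count pos); apply: leq_sum => K _.
  case: (pickP [pred l | isolated i l && (par l == K.+1)]) => [l hl|/eq_card0 -> //].
  have -> : hasI K by apply/existsP; exists l.
  apply/card_le1_eqP => l1 l2; rewrite !inE => /andP[h1 /eqP p1] /andP[h2 /eqP p2].
  by apply: isolated_uniq => //; rewrite p1 p2.
have hS : delta * (\sum_l (single i l : nat)) <= delta * \sum_(K < N) room K.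
  case: (posnP delta) => [-> //|dpos]; rewrite leq_mul2l; apply/orP; right.
  have d3 : 2 < d by rewrite /delta in dpos; clear - dpos k0; nat_lia.
  have lpos l : J l -> 0 < land l < size s.
    move=> h; have g := T_good h; rewrite (good_K g) andbT.
    by have [|p _] := one_item g; first by move=> lt; clear - lt d3; nat_lia.
  have vpos l : movable i l -> 0 < par l < size s by move=> /and3P[/pos].
  have e1 : \sum_l (J l : nat) = \sum_l (single i l : nat) + \sum_l (movable i l : nat).
    rewrite -big_split; apply: eq_bigr => l _ /=; rewrite /J.
    case hS: (single i l); case hV: (movable i l) => //.
    by case/andP: hS => _ /eqP e1; case/and3P: hV => /andP[_]; rewrite e1.
  have e2 : \sum_(K < N) (hasV K : nat) <= \sum_l (movable i l : nat).
    rewrite (double_count vpos); apply: leq_sum => K _.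
    case: (boolP (hasV K)) => // /existsP[l hl].
    by apply/card_gt0P; exists l; rewrite inE.
  have e3 : \sum_l (J l : nat) <= \sum_(K < N) (hasV K : nat) + \sum_(K < N) room K.
    rewrite (double_count lpos) -big_split; apply: leq_sum => K _; exact: land_bound.
  by clear - e1 e2 e3; nat_lia.
rewrite big_split /= -!big_distrr /=.
apply: (@leq_trans (\sum_(K < N) (d * hasI K + delta * room K))).
  rewrite big_split /= -!big_distrr /=; apply: leq_add hS; by rewrite leq_mul2l hI orbT.
apply: leq_sum => K _; rewrite /room; case: (boolP (hasI K)) => [h|_].
  by rewrite (isolated_big h) muln0 addn0 muln1 leq_addr.
rewrite muln0 add0n; case: ifP => [_|_]; last by case: ifP => _; rewrite ?muln0 // leq_addl.
rewrite muln1 /delta; apply: leq_trans (leq_addr _ _); clear - dk; nat_lia.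
Qed.

End Colour.

(** A component with e edges contributes (k+1)e. This covers its own share d, less what is
    charged to its parent if it is small, and what its own small children charge to it in
    each of the k colours. *)
Lemma pointwise (e : nat) : d + k * (d * (d <= e) + delta * (d == e.+1))
  <= (k + 1) * e + d * (e == 0) + delta * (e == 1).
Proof.
have d00 : (d <= 0) = false by rewrite leqNgt d0.
case: (posnP delta) => [de|dpos].
  have dk1 : d <= k.+1 by rewrite -subn_eq0 -/delta de.
  rewrite de !mul0n !addn0.
  case: e => [|e]; first by rewrite d00 !muln0 addn0 add0n eqxx muln1.
  rewrite muln0 addn0; case: (leqP d e.+1) => [le|_]; last first.
    by rewrite !muln0 addn0 mulnSr; apply: leq_trans dk1 _; rewrite addn1 leq_addl.
  by rewrite muln1 -{1}(mul1n d) -mulnDl addnC; apply: leq_mul.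
have dE : d = delta + k.+1 by rewrite subnK // ltnW // -subn_gt0.
case: e => [|[|e]].
- rewrite d00 !muln0 add0n; case: eqP => [d1|_]; last by rewrite !muln0 !addn0 muln1.
  by rewrite d1 in dE; move: dE dpos k0; clear; nat_lia.
- have d3 : 2 < d by rewrite dE; clear - dpos k0; nat_lia.
  have -> : (d <= 1) = false by rewrite leqNgt (ltnW d3).
  have -> : (d == 2) = false by apply/negP => /eqP h; rewrite h in d3.
  by rewrite !muln0 !muln1 {1}dE !addn0; clear; nat_lia.
rewrite !muln0 !addn0; case: (leqP d e.+2) => [le|lt].
  rewrite (_ : (d == e.+3) = false) ?muln0 ?addn0 ?muln1; last first.
    by apply/negP => /eqP h; rewrite h ltnn in le.
  by rewrite -{1}(mul1n d) -mulnDl addnC; apply: leq_mul.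
rewrite muln0 add0n; case: eqP => [h|_].
  rewrite muln1; have : delta + k = e.+2 by move: dE; rewrite h; clear; nat_lia.
  by move=> <-; rewrite dE; clear - k0; case: (k) k0 => // k' _; nia.
by rewrite !muln0 addn0; apply: (leq_trans dk); rewrite mulnC leq_mul2l orbT.
Qed.

Lemma arcs_bound : N * d <= \sum_(l < N) (k + 1) * ez l.
Proof.
have [W hW] := virtual_items.
have hc : \sum_(i < k) \sum_l (d * isolated i l + delta * single i l)
    <= k * \sum_(K < N) (d * (d <= ez K) + delta * (d == (ez K).+1)).
  move: (\sum_(K < N) _) (fun i => colour_bound (hW i)) => b cb.
  have -> : k * b = \sum_(i < k) b by rewrite sum_nat_const card_ord.
  by apply: leq_sum => i _; exact: cb.
have hp : \sum_(l < N) (d + k * (d * (d <= ez l) + delta * (d == (ez l).+1)))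
    <= \sum_(l < N) ((k + 1) * ez l + d * (ez l == 0) + delta * (ez l == 1)).
  by apply: leq_sum => l _; exact: pointwise.
have he : \sum_(l < N) (d * (ez l == 0) + delta * (ez l == 1))
    <= \sum_(i < k) \sum_l (d * isolated i l + delta * single i l).
  rewrite exchange_big; apply: leq_sum => l _ /=.
  by rewrite (bigD1 (c l)) //= /isolated /single eqxx leq_addr.
move: hp; under [X in _ <= X -> _]eq_bigr => l _ do rewrite -addnA.
rewrite !big_split /= -big_distrr /= sum_nat_const card_ord => hp.
by rewrite -(leq_add2r (k * \sum_(K < N) (d * (d <= ez K) + delta * (d == (ez K).+1))));
  apply: (leq_trans hp); rewrite leq_add2l; apply: leq_trans hc; rewrite -big_split.
Qed.

End Arcs.
Lemma small_bound : N * d <= \sum_(l < N) (k + 1) * ez l.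
Proof. by have [c [A Aok]] := entry_arcs; exact: arcs_bound Aok. Qed.

(** The explored components partition the explored vertices. *)
Lemma stage_count z : \sum_(l < size s) (conn F (nth r s l) z : nat) = explored z.
Proof.
case: (boolP (explored z)) => [hz|nz].
  rewrite (bigD1 (Ordinal hz)) //= stage_conn // big1 // => l ne.
  case: (boolP (conn F (nth r s l) z)) => // c; case/negP: ne; apply/eqP/ord_inj.
  by rewrite /= (stage_eq ok (ltn_ord l) c).
rewrite big1 // => l _; case: (boolP (conn F (nth r s l) z)) => // c; case/negP: nz.
by rewrite /explored_in (stage_eq ok (ltn_ord l) c).
Qed.

Let H := [set z | explored z].

Lemma card_H : #|H| = \sum_(l < size s) esz F (nth r s l) + size s.
Proof.
have -> : #|H| = \sum_z (explored z : nat).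
  by rewrite -sum1_card big_mkcond; apply: eq_bigr => z _; rewrite inE; case: (explored z).
under eq_bigr => z _ do rewrite -stage_count.
have e1 : size s = \sum_(l < size s) 1 by rewrite sum1_card card_ord.
rewrite exchange_big [in RHS]/= [X in _ = _ + X]e1 -big_split.
apply: eq_bigr => l _; rewrite /= addn1 -(tree_card _ fF) -sum1_card [RHS]big_mkcond.
by apply: eq_bigr => z _; rewrite mem_component; case: (conn _ _ _).
Qed.

Lemma red_H : \sum_(l < size s) esz F (nth r s l)
  <= #|[set e | (e \in F) && (ends e \subset H)]|.
Proof.
have cardE (B : {set E}) : #|B| = \sum_e (e \in B : nat).
  by rewrite -sum1_card big_mkcond; apply: eq_bigr => e _; case: (e \in B).
rewrite cardE (eq_bigr (fun l : 'I_(size s) =>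
  \sum_e (e \in component_edges F (nth r s l) : nat))); last by move=> l _; exact: cardE.
rewrite exchange_big; apply: leq_sum => e _; have [a [b j]] := joins_ex e.
rewrite (eq_bigr (fun l : 'I_(size s) => ((e \in F) && conn F (nth r s l) a : nat)));
  last by move=> l _; rewrite (mem_cedges _ _ j).
rewrite in_set; case: (boolP (e \in F)) => [eF|_]; last by rewrite big1.
rewrite /= stage_count (eqP j) subUset !sub1set !inE.
by rewrite /explored_in (conn_stage s (conn1 eF j)) andbb.
Qed.

Lemma not_sparse : ~ sparse G k d.
Proof.
move=> sp; have rH : r \in H by rewrite inE /explored_in (stage_root ok) s_pos.
have H0 : H != set0 by apply/set0Pn; exists r.
pose EH := [set e : E | ends e \subset H].
have EHe e : e \in EH -> ends e \subset H by rewrite inE.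
have := sp (Subgraph H0 EHe); rewrite /beta /nb_vertices /nb_edges /=.
have b1 : k * (#|H| - 1) <= #|[set e | (col e != None) && (ends e \subset H)]|.
  apply: (@blue_count _ _ col r) => //.
  - by move=> i w; rewrite inE; exact: Hc.
  - move=> i w v; rewrite !inE; exact: (explored_closed ok minimal).
have b2 := red_H; have b3 := card_H.
have b4 : #|[set e | (col e != None) && (ends e \subset H)]|
    + #|[set e | (e \in F) && (ends e \subset H)]| = #|EH|.
  rewrite -cardsUI; set I := _ :&: _; have -> : I = set0.
    by apply/setP => e; rewrite !inE; case: (col e == None); rewrite ?andbF.
  rewrite cards0 addn0.
  apply: eq_card => e; rewrite !inE; by case: (col e == None); rewrite ?orbF.
have big : d < esz F (nth r s 0) by rewrite s_root; exact: ok_big ok.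
have sm := small_bound; rewrite -big_distrr /= in sm.
have es : \sum_(l < size s) esz F (nth r s l) = esz F (nth r s 0) + \sum_(l < N) ez l.
  have -> : size s = N.+1 by rewrite prednK // s_pos.
  by rewrite big_ord_recl.
have t0 : size s = N.+1 by rewrite prednK // s_pos.
rewrite es in b2 b3; rewrite t0 in b3.
have := density_arith b1 b2 b3 b4 big sm.
by move: (_ * _)%N (_ * _)%N (k ^ 2)%N => x y z; lia.
Qed.

End Counting.
End Items.

(** * The decomposition *)

Section Main.
Variables (G : multigraph) (k d : nat).
Hypotheses (k0 : 0 < k) (d0 : 0 < d) (dk : d <= 2 * (k + 1)) (sp : sparse G k d).

(** A state of least measure exists if the excess is never 0, and contradicts sparsity. *)
Lemma excess_vanishes (col : edge G -> option 'I_k) :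
  (forall c, forest (blue col c)) -> forest (red col) ->
  exists col' : edge G -> option 'I_k,
    [/\ forall c, forest (blue col' c), forest (red col') & excess d (red col') = 0].
Proof.
move=> fB fF; apply: NNPP => no.
have nogood (col' : edge G -> option 'I_k) : (forall c : 'I_k, forest (blue col' c)) -> forest (red col') ->
    0 < excess d (red col').
  by move=> fB' fF'; rewrite lt0n; apply/negP => /eqP e; apply: no; exists col'.
have none n (col' : edge G -> option 'I_k) r s : state_ok d col' r s -> meas d col' s = n -> False.
  elim/ltn_ind: n col' r s => n IH col' r s ok en.
  have minimal (col2 : edge G -> option 'I_k) r2 s2 : state_ok d col2 r2 s2 ->
      meas d col' s <= meas d col2 s2.
    move=> ok2; rewrite leqNgt; apply/negP => lt.
    by rewrite en in lt; exact: IH lt _ _ _ ok2 erefl.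
  have [ph hph] := fin_all_exists (fun i => rooting r (ok_blue ok (c := i))).
  have [ta hta] := fin_all_exists hph.
  have [mu rt] := fin_all_exists hta.
  exact (not_sparse d0 ok nogood minimal rt k0 dk sp).
have [x big] := excess_gt0 (nogood col fB fF).
have [r [c cen]] := central_ex d0 fF big.
apply: (none _ col r [:: r] _ erefl); split=> //; first by rewrite -(esz_conn c).
by split=> //; exact: legal1.
Qed.

End Main.

Theorem theorem1p10 (k d : nat) (k_gt0 : 0 < k) (d_gt0 : 0 < d)
    (le_d : d <= 2 * (k + 1)) (G : multigraph)
    (G_sparse : sparse G k d)
    (G_not_overfull : forall H : subgraph G, ~ overfull (k + 1) H) :
  exists P : 'I_(k + 1) -> {set edge G},
    forest_decomposition P /\
    exists i : 'I_(k + 1),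
      forall x : vertex G, #|component_edges (P i) x| <= d.
Proof.
have dens (H : subgraph G) : nb_edges H <= (k + 1) * (nb_vertices H - 1).
  have v0 : 0 < nb_vertices H by rewrite card_gt0; exact: sub_nonempty.
  have := G_not_overfull H; rewrite /overfull; move: (nb_vertices H) v0 (nb_edges H).
  case=> // v _ e; rewrite subn1 /= => h; rewrite leqNgt; apply/negP => lt; apply: h.
  by clear - lt; nia.
have [col0 [full fB0]] := forest_cover dens.
pose col e : option 'I_k := if col0 e is Some j then
  if split j is inl i then Some i else None else None.
have blueE i : blue col i \subset blue col0 (lshift 1 i).
  apply/subsetP => e; rewrite !inE /col; case: (col0 e) => [j|] //.
  case: splitP => // i' ji /eqP [<-]; apply/eqP; congr Some; exact/ord_inj.
have redE : red col \subset blue col0 (rshift k ord0).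
  apply/subsetP => e; rewrite !inE /col; have := full e; case: (col0 e) => [j|] // _.
  case: splitP => // i' ji _; apply/eqP; congr Some; apply/ord_inj.
  by rewrite ji /= (ord1 i').
have [col' [fB fF e0]] := excess_vanishes k_gt0 d_gt0 le_d G_sparse
  (fun c => forest_sub (blueE c) (fB0 _)) (forest_sub redE (fB0 _)).
pose P (j : 'I_(k + 1)) := if split j is inl i then blue col' i else red col'.
have Pl i : P (lshift 1 i) = blue col' i by rewrite /P (unsplitK (inl i)).
have Pr : P (rshift k ord0) = red col' by rewrite /P (unsplitK (inr ord0)).
exists P; split; last first.
  by exists (rshift k ord0) => x; rewrite Pr; exact: excess0_le e0.
split.
- apply/setP => e; rewrite in_setT; apply/bigcupP; case ce: (col' e) => [i|].
    by exists (lshift 1 i) => //; rewrite Pl inE ce.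
  by exists (rshift k ord0) => //; rewrite Pr inE ce.
- move=> i j ne; rewrite -setI_eq0; apply/eqP/setP => e; rewrite !inE /P.
  apply/negP; rewrite -(splitK i) -(splitK j) in ne.
  case: (split i) (split j) ne => [a|a] [b|b] ne; rewrite !inE => /andP[/eqP ->] //.
    by rewrite (inj_eq Some_inj) => /eqP ab; rewrite ab eqxx in ne.
  by rewrite (ord1 a) (ord1 b) eqxx in ne.
- by move=> i; rewrite /P; case: (split i) => [c|_]; apply: forest_acyclic.
Qed.
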